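(* Let $a>0$, let $\lambda<\lambda_a$ be real, let $\theta\in[0,2\pi)$, and let $\mathscr D_a=i\,d/dx$ with domain $C_c^\infty(-a,a)$ be regarded as a densely defined symmetric operator on the Hilbert space $\mathcal H(T_a)$, $T_a=A_a-\lambda I$, with adjoint $\mathscr D_a^\ast$. Let $v_\pm(a,\cdot)\in\mathcal H(T_a)$ be eigenfunctions of $\mathscr D_a^\ast$ corresponding respectively to the eigenvalues $\pm i$, normalized so that $\|v_+(a,\cdot)\|_{T_a}=\|v_-(a,\cdot)\|_{T_a}$. Let $\overline{\mathscr D}_{a,\theta}$ be the self-adjoint extension of $\mathscr D_a$ with parameter $\theta$ determined by $v_\pm$. Then the function $$W(a,\theta;z)=(z-i)\int_{-a}^a v_+(a,x)e^{izx}\,dx+e^{i\theta}(z+i)\int_{-a}^a v_-(a,x)e^{izx}\,dx$$ is entire in $z$. The eigenvalues of the self-adjoint operator $\overline{\mathscr D}_{a,\theta}$ are precisely the zeros of $W(a,\theta;z)$. Furthermore, all zeros of $W(a,\theta;z)$ are real.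
   Context: All function spaces are complex; $\langle v_1,v_2\rangle_{L^2}=\int v_1\overline{v_2}\,dx$; $L^2(-a,a)$ is viewed as a closed subspace of $L^2(\mathbb R)$ by extending functions by zero. Weil functional: with $\Lambda$ the von Mangoldt function and $C_0$ the Euler--Mascheroni constant, $$W(f)=\int_{-\infty}^{\infty} f(x)(e^{x/2}+e^{-x/2})\,dx-\sum_{n\ge1}\frac{\Lambda(n)}{\sqrt n}\bigl(f(\log n)+f(-\log n)\bigr)-(\log 4\pi+C_0)f(0)-\int_0^\infty\{f(x)+f(-x)-2e^{-x/2}f(0)\}\frac{e^{x/2}\,dx}{e^x-e^{-x}}.$$ With $\widetilde v(x)=\overline{v(-x)}$ and $*$ denoting convolution, put $Q_W(v_1,v_2)=W(v_1*\widetilde{v_2})$ and $Q_W(v)=Q_W(v,v)$. For $v\in L^2(-a,a)$ the function $f=v*\widetilde v$ is continuous with compact support and $\mathrm{Re}\,f(x)\le f(0)$, so $Q_W(v)\in(-\infty,+\infty]$ is well defined. $Q_W^{\,a}$ is the restriction of $Q_W$ to $L^2(-a,a)$, with form domain $\mathfrak D(Q_W^{\,a})=\{v\in L^2(-a,a): |Q_W^{\,a}(v)|<\infty\}$. It is known that $Q_W^{\,a}$ is a densely defined, lower bounded, closed symmetric form. $A_a$ is the self-adjoint operator associated with it: $v\in\mathfrak D(A_a)$ with $A_av=h$ iff $v\in\mathfrak D(Q_W^{\,a})$, $h\in L^2(-a,a)$ and $Q_W^{\,a}(v,w)=\langle h,w\rangle_{L^2}$ for all $w\in\mathfrak D(Q_W^{\,a})$.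 $\lambda_a=\inf_{0\ne v\in\mathfrak D(Q_W^{\,a})}Q_W^{\,a}(v)/\|v\|_{L^2}^2$ is its lowest eigenvalue. For $\lambda<\lambda_a$, $T_a=A_a-\lambda I$ is positive; for $v,v_1,v_2\in C_c^\infty(-a,a)$ put $\langle v_1,v_2\rangle_{T_a}=\langle T_av_1,v_2\rangle_{L^2}=Q_W^{\,a}(v_1,v_2)-\lambda\langle v_1,v_2\rangle_{L^2}$ and $\|v\|_{T_a}^2=\langle v,v\rangle_{T_a}$. $\mathcal H(T_a)$ is the Hilbert space completion of $C_c^\infty(-a,a)$ in this norm. Since $\|\cdot\|_{T_a}$ dominates a positive multiple of $\|\cdot\|_{L^2}$ and the form is closed, $\mathcal H(T_a)$ is regarded as a subspace of $L^2(-a,a)$. The operator $\mathscr D_a$ on $\mathcal H(T_a)$ is symmetric with deficiency indices $(1,1)$, so $\ker(\mathscr D_a^\ast\mp i)$ is spanned by $v_\pm$. With $\overline{\mathscr D}_a$ the closure of $\mathscr D_a$, the self-adjoint extension $\overline{\mathscr D}_{a,\theta}$ is the restriction of $\mathscr D_a^\ast$ to $$\mathfrak D(\overline{\mathscr D}_{a,\theta})=\{v_0+c(v_++e^{i\theta}v_-): v_0\in\mathfrak D(\overline{\mathscr D}_a),\ c\in\mathbb C\},$$ i.e. $\overline{\mathscr D}_{a,\theta}(v_0+c(v_++e^{i\theta}v_-))=\overline{\mathscr D}_av_0+ic(v_+-e^{i\theta}v_-)$. *)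

(* Defs.v *)
From HB Require Import structures.
From mathcomp Require Import all_boot all_order all_algebra.
From mathcomp Require Import complex.
From mathcomp Require Import all_classical all_reals all_analysis.

Set Implicit Arguments.
Unset Strict Implicit.
Unset Printing Implicit Defensive.

Import Order.TTheory GRing.Theory Num.Theory.
Import numFieldNormedType.Exports.

Local Open Scope classical_set_scope.
Local Open Scope ring_scope.
Local Open Scope complex_scope.

Local Notation mu := lebesgue_measure.

(** * Complex-valued functions of a real variable *)

Definition ReF (R : realType) (f : R -> R[i]) (x : R) : R := complex.Re (f x).
Definition ImF (R : realType) (f : R -> R[i]) (x : R) : R := complex.Im (f x).

Definition cexp (R : realType) (z : R[i]) : R[i] :=
  (expR (complex.Re z))%:C *
  (cos (complex.Im z) +i* sin (complex.Im z)).

Definition cintegral (R : realType) (D : set R) (f : R -> R[i]) : R[i] :=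
  (\int[mu]_(x in D) ReF f x) +i* (\int[mu]_(x in D) ImF f x).

Definition cseries (R : realType) (u : nat -> R[i]) : R[i] :=
  limn (series (fun n => complex.Re (u n))) +i*
  limn (series (fun n => complex.Im (u n))).

Definition cderive (R : realType) (f : R -> R[i]) (x : R) : R[i] :=
  derive1 (ReF f) x +i* derive1 (ImF f) x.

Definition entire (R : realType) (F : R[i] -> R[i]) : Prop :=
  forall z : R[i], derivable (F : R[i]^o -> R[i]^o) z 1.

Definition convolution (R : realType) (f g : R -> R[i]) (x : R) : R[i] :=
  cintegral setT (fun y => f y * g (x - y)).

Definition tilde (R : realType) (v : R -> R[i]) (x : R) : R[i] := (v (- x))^*%C.

(** * The spaces L^2(-a,a) and C_c^oo(-a,a) *)

(* Elements of L^2 are represented by functions, which matter only up to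
   equality almost everywhere. *)
Definition aeeq (R : realType) (v w : R -> R[i]) : Prop :=
  {ae mu, forall x : R, v x = w x}.

Definition ipL2 (R : realType) (v w : R -> R[i]) : R[i] :=
  cintegral setT (fun x => v x * (w x)^*%C).

Definition normL2 (R : realType) (v : R -> R[i]) : R :=
  Num.sqrt (complex.Re (ipL2 v v)).

(* Functions on the whole line that vanish off (-a,a). *)
Definition L2 (R : realType) (a : R) : set (R -> R[i]) :=
  [set v | [/\ measurable_fun setT (ReF v), measurable_fun setT (ImF v),
     mu.-integrable setT (fun x : R => (ReF v x ^+ 2 + ImF v x ^+ 2)%:E) &
     forall x : R, x \notin `]- a, a[ -> v x = 0]].

Definition smooth (R : realType) (f : R -> R) : Prop :=
  forall (n : nat) (x : R), derivable (derive1n n f) x 1.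

Definition testfun (R : realType) (a : R) : set (R -> R[i]) :=
  [set phi | [/\ smooth (ReF phi), smooth (ImF phi),
     compact (closure [set x | phi x != 0]) &
     closure [set x | phi x != 0] `<=` `]- a, a[]].

(** * The Weil functional and the form Q_W *)

Definition vonMangoldt (R : realType) (n : nat) : R :=
  if primes n is [:: p] then ln p%:R else 0.

Definition euler_mascheroni (R : realType) : R :=
  limn (fun n : nat => series (@harmonic R) n - ln n%:R).

Definition weil_finite (R : realType) (f : R -> R[i]) : R[i] :=
  cintegral setT (fun x => f x * (expR (x / 2) + expR (- x / 2))%:C)
  - cseries (fun n => (vonMangoldt R n / Num.sqrt n%:R)%:C *
                      (f (ln n%:R) + f (- ln n%:R)))
  - (ln (4 * pi) + euler_mascheroni R)%:C * f 0.

Definition weil_arch (R : realType) (f : R -> R[i]) (x : R) : R[i] :=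
  (f x + f (- x) - (2 * expR (- x / 2))%:C * f 0) *
  (expR (x / 2) / (expR x - expR (- x)))%:C.

Definition weil (R : realType) (f : R -> R[i]) : R[i] :=
  weil_finite f - cintegral `]0, +oo[ (weil_arch f).

(* The value of W(f), possibly +oo, for f = v * v~; both terms of [weil f] are
   then real, because f (- x) is the conjugate of f x.  The integrand has an
   integrable positive part, so no +oo - oo occurs. *)
Definition weil_ext (R : realType) (f : R -> R[i]) : \bar R :=
  ((complex.Re (weil_finite f))%:E -
   \int[mu]_(x in `]0%R, +oo[) (ReF (weil_arch f) x)%:E)%E.

Definition QW (R : realType) (v w : R -> R[i]) : R[i] :=
  weil (convolution v (tilde w)).

Definition QWquad (R : realType) (v : R -> R[i]) : \bar R :=
  weil_ext (convolution v (tilde v)).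

Definition formdom (R : realType) (a : R) : set (R -> R[i]) :=
  [set v | L2 a v /\ (`|QWquad v| < +oo)%E].

Definition lowest (R : realType) (a : R) : \bar R :=
  ereal_inf [set (QWquad v * ((normL2 v ^+ 2)^-1)%:E)%E |
             v in [set v | formdom a v /\ ~ aeeq v (cst 0)]].

(** * The Hilbert space H(T_a), T_a = A_a - lambda *)

(* <T_a v, w> in terms of the form that defines A_a.  The formula makes sense on
   the whole form domain, where, the form being closed, it is the extension by
   continuity to H(T_a) of the inner product on C_c^oo(-a,a). *)
Definition ipT (R : realType) (lambda : R) (v w : R -> R[i]) : R[i] :=
  QW v w - lambda%:C * ipL2 v w.

Definition normT (R : realType) (lambda : R) (v : R -> R[i]) : R :=
  Num.sqrt (complex.Re (ipT lambda v v)).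

(* The completion of C_c^oo(-a,a) for [normT], realised inside L^2(-a,a): a
   Cauchy sequence is identified with its limit in L^2. *)
Definition HT (R : realType) (a lambda : R) : set (R -> R[i]) :=
  [set v | L2 a v /\ exists phi : nat -> R -> R[i],
    [/\ forall n, testfun a (phi n),
        forall e : R, 0 < e -> exists N : nat, forall m n : nat,
          (N <= m)%N -> (N <= n)%N -> normT lambda (phi m \- phi n) < e &
        (fun n => normL2 (phi n \- v)) @ \oo --> (0 : R)]].

(** * Unbounded operators on H(T_a) *)

(* An operator is given by its graph. *)
Definition operator (R : realType) := set ((R -> R[i]) * (R -> R[i])).

Definition op_adjoint (R : realType) (a lambda : R) (G : operator R) : operator R :=
  [set p | [/\ HT a lambda p.1, HT a lambda p.2 &
    forall q, G q -> ipT lambda q.2 p.1 = ipT lambda q.1 p.2]].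

Definition op_closure (R : realType) (a lambda : R) (G : operator R) :
    operator R :=
  [set p | [/\ HT a lambda p.1, HT a lambda p.2 &
    exists q : nat -> (R -> R[i]) * (R -> R[i]),
    [/\ forall n, G (q n),
        (fun n => normT lambda ((q n).1 \- p.1)) @ \oo --> (0 : R) &
        (fun n => normT lambda ((q n).2 \- p.2)) @ \oo --> (0 : R)]]].

Definition op_eigenfun (R : realType) (a lambda : R) (G : operator R) (z : R[i])
    (v : R -> R[i]) : Prop :=
  [/\ HT a lambda v, ~ aeeq v (cst 0) & G (v, fun x => z * v x)].

Definition op_eigenvalue (R : realType) (a lambda : R) (G : operator R)
    (z : R[i]) : Prop :=
  exists v, op_eigenfun a lambda G z v.

Definition Dop (R : realType) (a : R) : operator R :=
  [set p | testfun a p.1 /\ p.2 = (fun x => 'i%C * cderive p.1 x)].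

Definition Dext (R : realType) (a lambda theta : R) (vp vm : R -> R[i]) :
    operator R :=
  [set p | [/\ HT a lambda p.1, HT a lambda p.2 &
    exists (v0 w0 : R -> R[i]) (c : R[i]),
    [/\ op_closure a lambda (Dop a) (v0, w0),
        aeeq p.1 (fun x => v0 x + c * (vp x + cexp ('i%C * theta%:C) * vm x)) &
        aeeq p.2 (fun x =>
          w0 x + 'i%C * c * (vp x - cexp ('i%C * theta%:C) * vm x))]]].

Definition Wfun (R : realType) (a theta : R) (vp vm : R -> R[i]) (z : R[i]) :
    R[i] :=
  (z - 'i%C) * cintegral `[- a, a] (fun x => vp x * cexp ('i%C * z * x%:C))
  + cexp ('i%C * theta%:C) * (z + 'i%C) *
    cintegral `[- a, a] (fun x => vm x * cexp ('i%C * z * x%:C)).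

(* Main.v *)
(** Let [g^(z)] be the integral of [g x * exp (i z x)].  For a test function [v] the function
[g = i v' - z v] satisfies [g^(z) = 0] and
  [v x = - i exp (- i z x) * int_(-a)^x g t exp (i z t) dt];
conversely, when [g^(z) = 0] this formula defines a function of [L^2(-a,a)] that is
Hoelder-1/2 with constant [O(|g|_2)].  As the archimedean kernel grows like [1 / (2 x)] at [0],
such functions belong to the form domain, so that the solution operator is bounded from
[L^2] to [H(T_a)].  Consequently [closure D_a - z] is injective with range
[{g in H(T_a) | g^(z) = 0}].  Now [v0 + c (v+ + e^(i theta) v-)] is an eigenfunction for [z] iff
  [(closure D_a - z) v0 = c ((z - i) v+ + e^(i theta) (z + i) v-)],
which has a solution with [c <> 0] iff [W(a,theta;z) = 0].  The zeros are real because
[|v+| = |v-|] makes the extension symmetric. *)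

From HB Require Import structures.
Require Import Defs.
From mathcomp Require Import all_boot all_order all_algebra.
From mathcomp Require Import complex ring lra.
From mathcomp Require Import all_classical all_reals all_analysis.
From mathcomp Require Import measurable_realfun.
Set Implicit Arguments.
Unset Strict Implicit.
Unset Printing Implicit Defensive.

Import Order.TTheory GRing.Theory Num.Theory.
Import numFieldNormedType.Exports.
Import Normc.

Local Open Scope classical_set_scope.
Local Open Scope ring_scope.
Local Open Scope complex_scope.

Local Notation mu := lebesgue_measure.

(** * Semi-inner products *)

Section SemiInnerProduct.
Context {R : realType}.
Implicit Types (f g u v w : R -> R[i]) (c : R[i]).

(** The form is made computable by one identity: for f = v * v~, the number 2 f(0) - f(x) - f(-x) is
    |v - tau_x v|^2. The archimedean integral thus becomes a multiple of |v|^2 minus a nonnegative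
    energy, while the pole, prime and point terms are controlled by sup |f| <= |v|^2, because f is
    supported in [-2a,2a]. Since lambda < lambda_a, the norm of H(T_a) is equivalent to (|v|^2 +
    energy)^(1/2). The obstacle is that H(T_a) consists of $L^2$ limits of Cauchy sequences, for
    which the formula of the inner product must first be shown to make sense. As the energy density
    is nonnegative and continuous in v for each x, Fatou's lemma gives finite energy to the limit
    and upgrades the convergence to the norm of H(T_a). Symmetry of i d/dx comes from the
    correlations themselves: integrating by parts against every translate shows that i phi' with psi
    and phi with i psi' have the same correlation function, hence the same value of any form that
    depends on it alone. *)

Definition lincomb c v w : R -> R[i] := fun x => v x + c * w x.

(** Elements are functions, not classes modulo null sets, so positivity is only semi-definite. The
    same theory serves [ipL2], [delta x] and [ipT]. Closure under v + c w alone already yields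
    differences, zero and scalar multiples. *)
Definition semi_ip (S : set (R -> R[i]))
    (ip : (R -> R[i]) -> (R -> R[i]) -> R[i]) : Prop :=
  [/\ forall c v w, S v -> S w -> S (lincomb c v w),
      forall c u v w, S u -> S v -> S w ->
        ip (lincomb c v w) u = ip v u + c * ip w u,
      forall v w, S v -> S w -> ip w v = (ip v w)^*%C &
      forall v, S v -> 0 <= complex.Re (ip v v)].

Definition snorm (ip : (R -> R[i]) -> (R -> R[i]) -> R[i]) v : R :=
  Num.sqrt (complex.Re (ip v v)).

Lemma lincombN1 v w : v \- w = lincomb (-1) v w.
Proof. by apply/funext => x; rewrite /lincomb mulN1r. Qed.

(** The discriminant argument of Cauchy-Schwarz for a complex scalar s + i t: evaluate at the
    minimiser -(x, y) / q. For q = 0 the expression is affine, and a long enough step against (x, y)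
    makes it negative unless (x, y) = 0. *)
Lemma quadratic_ge0_disc (p q x y : R) : 0 <= p -> 0 <= q ->
  (forall s t, 0 <= p + 2 * (s * x + t * y) + (s ^+ 2 + t ^+ 2) * q) ->
  x ^+ 2 + y ^+ 2 <= p * q.
Proof.
move=> p0 q0 H.
have [q_eq0|qN0] := eqVneq q 0.
  have [->|n0] := eqVneq (x ^+ 2 + y ^+ 2) 0; first by rewrite mulr_ge0.
  set n := x ^+ 2 + y ^+ 2 in n0 *.
  have := H (- ((p + 1) / n) * x) (- ((p + 1) / n) * y).
  rewrite q_eq0 mulr0 addr0.
  have -> : (- ((p + 1) / n) * x * x + - ((p + 1) / n) * y * y) = - (p + 1).
    have -> : - ((p + 1) / n) * x * x + - ((p + 1) / n) * y * y =
              - ((p + 1) / n * n) by rewrite /n; ring.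
    by rewrite divfK.
  by move=> ?; exfalso; lra.
have q_gt0 : 0 < q by rewrite lt0r qN0.
have := H (- (x / q)) (- (y / q)).
have -> : p + 2 * (- (x / q) * x + - (y / q) * y) +
  ((- (x / q)) ^+ 2 + (- (y / q)) ^+ 2) * q = p - (x ^+ 2 + y ^+ 2) / q.
  by field.
by rewrite subr_ge0 ler_pdivrMr.
Qed.

Lemma normc_sq c : normc c ^+ 2 = complex.Re c ^+ 2 + complex.Im c ^+ 2.
Proof. by case: c => x y /=; rewrite sqr_sqrtr// addr_ge0// sqr_ge0. Qed.

Lemma normc_ge0 c : 0 <= normc c.
Proof. by case: c => x y /=; exact: sqrtr_ge0. Qed.

Lemma normcJ c : normc c^*%C = normc c.
Proof. by case: c => x y /=; rewrite sqrrN. Qed.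

Lemma cReD c d : complex.Re (c + d) = complex.Re c + complex.Re d.
Proof. by case: c d => [? ?] [? ?]. Qed.
Lemma cImD c d : complex.Im (c + d) = complex.Im c + complex.Im d.
Proof. by case: c d => [? ?] [? ?]. Qed.
Lemma cReM c d : complex.Re (c * d) =
  complex.Re c * complex.Re d - complex.Im c * complex.Im d.
Proof. by case: c d => [? ?] [? ?]. Qed.
Lemma cImM c d : complex.Im (c * d) =
  complex.Re c * complex.Im d + complex.Im c * complex.Re d.
Proof. by case: c d => [? ?] [? ?]. Qed.
Lemma cReN c : complex.Re (- c) = - complex.Re c.
Proof. by case: c. Qed.
Lemma cImN c : complex.Im (- c) = - complex.Im c.
Proof. by case: c. Qed.
Lemma cReJ c : complex.Re c^*%C = complex.Re c.
Proof. by case: c. Qed.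
Lemma cImJ c : complex.Im c^*%C = - complex.Im c.
Proof. by case: c. Qed.
Definition ReImE := (cReD, cImD, cReN, cImN, cReM, cImM, cReJ, cImJ).

Lemma ReIm_eq c d : complex.Re c = complex.Re d ->
  complex.Im c = complex.Im d -> c = d.
Proof. by case: c d => [? ?] [? ?] /= -> ->. Qed.

Lemma ler_Re_normc c : `|complex.Re c| <= normc c.
Proof.
rewrite -sqrtr_sqr; case: c => x y /=; apply: ler_wsqrtr.
by rewrite lerDl sqr_ge0.
Qed.

Lemma ler_Im_normc c : `|complex.Im c| <= normc c.
Proof.
rewrite -sqrtr_sqr; case: c => x y /=; apply: ler_wsqrtr.
by rewrite lerDr sqr_ge0.
Qed.

Lemma normc_le_ReIm c : normc c <= `|complex.Re c| + `|complex.Im c|.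
Proof.
rewrite -(@ler_pXn2r _ 2)// ?nnegrE ?normc_ge0 ?addr_ge0// normc_sq.
rewrite sqrrD !real_normK ?num_real// addrAC lerDl.
by rewrite mulrn_wge0// mulr_ge0.
Qed.

Section Theory.
Variables (S : set (R -> R[i])) (ip : (R -> R[i]) -> (R -> R[i]) -> R[i]).
Hypothesis Sip : semi_ip S ip.

Lemma semi_ip_lincomb c v w : S v -> S w -> S (lincomb c v w).
Proof. by case: Sip => + _ _ _; exact. Qed.

Lemma semi_ip_linl c u v w : S u -> S v -> S w ->
  ip (lincomb c v w) u = ip v u + c * ip w u.
Proof. by case: Sip => _ + _ _; exact. Qed.

Lemma semi_ipC v w : S v -> S w -> ip w v = (ip v w)^*%C.
Proof. by case: Sip => _ _ + _; exact. Qed.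

Lemma semi_ip_ge0 v : S v -> 0 <= complex.Re (ip v v).
Proof. by case: Sip => _ _ _; exact. Qed.

Lemma semi_ip_linr c u v w : S u -> S v -> S w ->
  ip u (lincomb c v w) = ip u v + c^*%C * ip u w.
Proof.
move=> Su Sv Sw; rewrite (semi_ipC (semi_ip_lincomb _ _ _) Su)// semi_ip_linl//.
by rewrite rmorphD rmorphM/= -!semi_ipC.
Qed.

Lemma semi_ipB v w : S v -> S w -> S (v \- w).
Proof. by rewrite lincombN1; exact: semi_ip_lincomb. Qed.

Lemma semi_ip_Im v : S v -> complex.Im (ip v v) = 0.
Proof.
by move=> Sv; have := semi_ipC Sv Sv; case: (ip v v) => x y [] /=; lra.
Qed.

Lemma semi_ip_lincomb_sq c v w : S v -> S w ->
  complex.Re (ip (lincomb c v w) (lincomb c v w)) =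
  complex.Re (ip v v) +
  2 * (complex.Re c * complex.Re (ip v w) + complex.Im c * complex.Im (ip v w))
  + (complex.Re c ^+ 2 + complex.Im c ^+ 2) * complex.Re (ip w w).
Proof.
move=> Sv Sw; have Sc := semi_ip_lincomb c Sv Sw.
rewrite semi_ip_linl// !semi_ip_linr// (semi_ipC Sv Sw) !ReImE.
rewrite (semi_ip_Im Sw); ring.
Qed.

Lemma semi_ip_CS_sq v w : S v -> S w ->
  complex.Re (ip v w) ^+ 2 + complex.Im (ip v w) ^+ 2 <=
  complex.Re (ip v v) * complex.Re (ip w w).
Proof.
move=> Sv Sw; apply: quadratic_ge0_disc; rewrite ?semi_ip_ge0// => s t.
have := semi_ip_ge0 (semi_ip_lincomb (s +i* t) Sv Sw).
by rewrite semi_ip_lincomb_sq//.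
Qed.

Lemma snorm_ge0 v : 0 <= snorm ip v.
Proof. exact: sqrtr_ge0. Qed.

Lemma snorm_sq v : S v -> snorm ip v ^+ 2 = complex.Re (ip v v).
Proof. by move=> Sv; rewrite sqr_sqrtr// semi_ip_ge0. Qed.

Lemma semi_ip_CS v w : S v -> S w -> normc (ip v w) <= snorm ip v * snorm ip w.
Proof.
move=> Sv Sw; rewrite -(@ler_pXn2r _ 2)// ?nnegrE ?normc_ge0 ?mulr_ge0 ?snorm_ge0//.
by rewrite normc_sq exprMn !snorm_sq// semi_ip_CS_sq.
Qed.

Lemma snorm_lincomb c v w : S v -> S w ->
  snorm ip (lincomb c v w) <= snorm ip v + normc c * snorm ip w.
Proof.
move=> Sv Sw; have Sc := semi_ip_lincomb c Sv Sw.
have n0 u : 0 <= snorm ip u := snorm_ge0 u.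
rewrite -(@ler_pXn2r _ 2)// ?nnegrE ?addr_ge0 ?mulr_ge0 ?normc_ge0//.
rewrite snorm_sq// semi_ip_lincomb_sq// -!snorm_sq// sqrrD exprMn normc_sq.
rewrite lerD2r lerD2l -[leRHS]mulr_natl ler_pM2l//.
have -> : complex.Re c * complex.Re (ip v w) + complex.Im c * complex.Im (ip v w)
   = complex.Re (c^*%C * ip v w) by rewrite !ReImE; ring.
apply: le_trans (ler_norm _) _; apply: le_trans (ler_Re_normc _) _.
rewrite normcM normcJ mulrCA ler_wpM2l ?normc_ge0//.
exact: semi_ip_CS.
Qed.

Lemma snormB v w : S v -> S w -> snorm ip (v \- w) <= snorm ip v + snorm ip w.
Proof.
move=> Sv Sw; rewrite lincombN1; apply: le_trans (snorm_lincomb _ Sv Sw) _.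
by rewrite /= oppr0 sqrrN expr1n expr0n addr0 sqrtr1 mul1r.
Qed.

Lemma snormBC v w : S v -> S w -> snorm ip (v \- w) = snorm ip (w \- v).
Proof.
move=> Sv Sw; rewrite /snorm !lincombN1 !semi_ip_lincomb_sq//; congr Num.sqrt.
by rewrite (semi_ipC Sw Sv) !ReImE/=; ring.
Qed.

Lemma snorm_tri u v w : S u -> S v -> S w ->
  snorm ip (u \- w) <= snorm ip (u \- v) + snorm ip (v \- w).
Proof.
move=> Su Sv Sw; rewrite (snormBC Sv Sw).
have -> : u \- w = (u \- v) \- (w \- v).
  by apply/funext => x /=; ring.
by apply: snormB; exact: semi_ipB.
Qed.

Lemma snorm_dist v w : S v -> S w ->
  `|snorm ip v - snorm ip w| <= snorm ip (v \- w).
Proof.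
move=> Sv Sw.
have H u1 u2 : S u1 -> S u2 -> snorm ip u1 - snorm ip u2 <= snorm ip (u1 \- u2).
  move=> S1 S2; rewrite lerBlDr.
  have {1}-> : u1 = lincomb 1 (u1 \- u2) u2 by apply/funext => x; rewrite /lincomb/=; ring.
  apply: le_trans (snorm_lincomb _ _ _) _ => //; first exact: semi_ipB.
  by rewrite normc1 mul1r.
by rewrite ler_norml lerNl opprB H// snormBC// H.
Qed.

Lemma semi_ipBl u v w : S u -> S v -> S w ->
  ip (v \- w) u = ip v u - ip w u.
Proof. by move=> *; rewrite lincombN1 semi_ip_linl// mulN1r. Qed.

Lemma semi_ipBr u v w : S u -> S v -> S w ->
  ip u (v \- w) = ip u v - ip u w.
Proof. by move=> *; rewrite lincombN1 semi_ip_linr// rmorphN rmorph1 mulN1r. Qed.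

Lemma semi_ip0 v : S v -> S (cst 0).
Proof. by move=> Sv; have := semi_ipB Sv Sv; congr S; apply/funext => x /=; rewrite subrr. Qed.

Lemma semi_ip_scale c v : S v -> S (fun x => c * v x).
Proof.
move=> Sv; have := semi_ip_lincomb c (semi_ip0 Sv) Sv; congr S.
by apply/funext => x; rewrite /lincomb/= add0r.
Qed.

End Theory.

Lemma semi_ip_sub (S S' : set (R -> R[i])) ip : semi_ip S ip ->
  (forall c v w, S' v -> S' w -> S' (lincomb c v w)) -> S' `<=` S -> semi_ip S' ip.
Proof.
by move=> [H1 H2 H3 H4] H sub; split=> //; move=> *; [apply: H2|apply: H3|apply: H4]; exact: sub.
Qed.

End SemiInnerProduct.

(** * Invariance of Lebesgue measure *)

Section Invariance.
Context {R : realType}.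

(** A measure that agrees with Lebesgue measure on the intervals ]a, b] is Lebesgue measure, so
    invariance need only be checked there. *)
Lemma lebesgue_pushforward_preserved (phi : R -> R) (E : set R) :
  measurable_fun setT phi ->
  (forall a b : R, lebesgue_measure (phi @^-1` `]a, b]) = lebesgue_measure `]a, b]) ->
  measurable E ->
  pushforward lebesgue_measure (phi : _ -> measurableTypeR R) E = lebesgue_measure E.
Proof.
move=> mphi0 H mE; apply/esym.
apply: lebesgue_measure_unique => //.
move=> /= X [[a b]] _ <-.
by rewrite /pushforward /= -H.
Qed.

Lemma lebesgue_preserved_integral (phi : R -> R) (f : R -> \bar R) :
  measurable_fun setT phi ->
  (forall a b : R, lebesgue_measure (phi @^-1` `]a, b]) = lebesgue_measure `]a, b]) ->
  measurable_fun [set: R] f ->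
  (\int[mu]_x f (phi x) = \int[mu]_x f x)%E.
Proof.
move=> mphi H mf.
pose mphi_mixin := isMeasurableFun.Build _ _ _ _ _ mphi.
pose phi' : {mfun R >-> R} := HB.pack phi mphi_mixin.
have ge0 (g : R -> \bar R) : measurable_fun [set: R] g -> (forall x, 0 <= g x)%E ->
    (\int[mu]_x g (phi x) = \int[mu]_x g x)%E.
  move=> mg g0.
  transitivity (\int[pushforward lebesgue_measure (phi' : _ -> measurableTypeR R)]_x g x)%E.
    by rewrite ge0_integral_pushforward.
  apply: eq_measure_integral => A mA _.
  exact: lebesgue_pushforward_preserved.
rewrite integralE [RHS]integralE; congr (_ - _)%E.
  by rewrite (funepos_comp f phi); apply: (ge0 f^\+%E) => //; exact: measurable_funepos.
by rewrite (funeneg_comp f phi); apply: (ge0 f^\-%E) => //; exact: measurable_funeneg.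
Qed.

Lemma integral_shift (c : R) (f : R -> \bar R) : measurable_fun [set: R] f ->
  (\int[mu]_x f (x - c)%R = \int[mu]_x f x)%E.
Proof.
move=> mf; apply: (lebesgue_preserved_integral (phi := fun x => x - c)) => //.
  by apply: measurable_funB.
move=> a b; have -> : (fun x : R => x - c) @^-1` `]a, b] = `](a + c), (b + c)]%classic.
  by apply/seteqP; split => x /=; rewrite !in_itv /= ltrBrDr lerBlDr.
by rewrite !lebesgue_measure_itv /= !lte_fin ltrD2r; case: ifP => // _; rewrite -!EFinD; congr (_%:E); ring.
Qed.

Lemma integral_opp (f : R -> \bar R) : measurable_fun [set: R] f ->
  (\int[mu]_x f (- x)%R = \int[mu]_x f x)%E.
Proof.
move=> mf; apply: (lebesgue_preserved_integral (phi := fun x => - x)) => //.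
  exact: oppr_measurable.
move=> a b; have -> : (fun x : R => - x) @^-1` `]a, b] = `[(- b), (- a)[%classic.
  by apply/seteqP; split => x /=; rewrite !in_itv /= => /andP[? ?]; apply/andP; lra.
by rewrite !lebesgue_measure_itv /= !lte_fin ltrN2; case: ifP => // _; rewrite -!EFinD; congr (_%:E); ring.
Qed.

Lemma integrable_shift (c : R) (f : R -> R) :
  mu.-integrable setT (EFin \o f) -> mu.-integrable setT (EFin \o (fun x => f (x - c))).
Proof.
move=> /integrableP[mf fi]; apply/integrableP; split.
  apply: (measurableT_comp (f := EFin \o f)) => //.
  by apply: measurable_funB.
have := @integral_shift c (fun x => `|(f x)%:E|)%E; rewrite /= => ->//.
by apply/measurable_EFinP; apply: measurableT_comp => //; exact/measurable_EFinP.
Qed.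

Lemma Rintegral_shift (c : R) (f : R -> R) : measurable_fun [set: R] f ->
  \int[mu]_x f (x - c) = \int[mu]_x f x.
Proof.
by move=> mf; rewrite /Rintegral (integral_shift c (f := EFin \o f))//; exact/measurable_EFinP.
Qed.

Lemma Rintegral_opp (f : R -> R) : measurable_fun [set: R] f ->
  \int[mu]_x f (- x) = \int[mu]_x f x.
Proof.
by move=> mf; rewrite /Rintegral (integral_opp (f := EFin \o f))//; exact/measurable_EFinP.
Qed.

End Invariance.

(** * Integrals of complex-valued functions *)

Section ComplexIntegral.
Context {R : realType}.
Implicit Types (D : set R) (p q : R -> R) (f g v w : R -> R[i]) (c : R[i]).

Definition rint D p := mu.-integrable D (EFin \o p).

Lemma rint_measurable D p : rint D p -> measurable_fun D p.
Proof. by move=> /integrableP[/measurable_EFinP]. Qed.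

Lemma rintD D p q : measurable D -> rint D p -> rint D q ->
  rint D (fun x => p x + q x).
Proof.
move=> mD ip iq.
have H : mu.-integrable D ((EFin \o p) \+ (EFin \o q))%E by apply: integrableD.
exact: H.
Qed.

Lemma rintZ D k p : measurable D -> rint D p -> rint D (fun x => k * p x).
Proof.
move=> mD ip.
have H : mu.-integrable D (fun x => k%:E * (EFin \o p) x)%E by apply: integrableZl.
exact: H.
Qed.

Lemma rintN D p : measurable D -> rint D p -> rint D (fun x => - p x).
Proof.
move=> mD ip; have := rintZ (-1) mD ip; congr rint.
by apply/funext => x; rewrite mulN1r.
Qed.

Lemma rintB D p q : measurable D -> rint D p -> rint D q ->
  rint D (fun x => p x - q x).
Proof. by move=> mD ip iq; apply: rintD => //; exact: rintN. Qed.

Lemma rint_le D p q : measurable D -> measurable_fun D p ->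
  (forall x, D x -> `|p x| <= q x) -> rint D q -> rint D p.
Proof.
move=> mD mp le; apply: le_integrable => //; first exact/measurable_EFinP.
move=> x Dx /=; rewrite lee_fin; apply: le_trans (le x Dx) _; exact: ler_norm.
Qed.

Lemma rint_abs D p : measurable D -> rint D p -> rint D (fun x => `|p x|).
Proof.
move=> mD ip; have mp := rint_measurable ip; apply: le_integrable ip => //.
  by apply/measurable_EFinP; apply: measurableT_comp.
by move=> x Dx; rewrite /= normr_id.
Qed.

Lemma rint_setT D p : measurable D -> rint setT p -> rint D p.
Proof. by move=> mD; apply: integrableS. Qed.

Lemma RintegralN D p : measurable D -> rint D p ->
  \int[mu]_(x in D) (- p x) = - \int[mu]_(x in D) p x.
Proof.
move=> mD ip; rewrite -mulN1r -RintegralZl//.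
by apply: eq_Rintegral => x _; rewrite mulN1r.
Qed.

Lemma ae_imply (P Q : R -> Prop) : (forall x, P x -> Q x) ->
  {ae (@lebesgue_measure R), forall x, P x} -> {ae (@lebesgue_measure R), forall x, Q x}.
Proof. exact: (@filterS _ _ (ae_filter_ringOfSetsType (@lebesgue_measure R))). Qed.

Lemma ae_imply2 (P Q S : R -> Prop) : (forall x, P x -> Q x -> S x) ->
  {ae (@lebesgue_measure R), forall x, P x} ->
  {ae (@lebesgue_measure R), forall x, Q x} -> {ae (@lebesgue_measure R), forall x, S x}.
Proof. exact: (@filterS2 _ _ (ae_filter_ringOfSetsType (@lebesgue_measure R))). Qed.

Definition cint D f := rint D (ReF f) /\ rint D (ImF f).

Lemma ReF_lincomb c f g : ReF (lincomb c f g) = fun x =>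
  ReF f x + (complex.Re c * ReF g x + - complex.Im c * ImF g x).
Proof. by apply/funext => x; rewrite /ReF /ImF /lincomb !ReImE mulNr. Qed.

Lemma ImF_lincomb c f g : ImF (lincomb c f g) = fun x =>
  ImF f x + (complex.Re c * ImF g x + complex.Im c * ReF g x).
Proof. by apply/funext => x; rewrite /ReF /ImF /lincomb !ReImE. Qed.

Lemma cint_lincomb D c f g : measurable D -> cint D f -> cint D g -> cint D (lincomb c f g).
Proof.
move=> mD [rf jf] [rg jg]; split; rewrite ?ReF_lincomb ?ImF_lincomb.
- by apply: rintD => //; apply: rintD => //; apply: rintZ.
- by apply: rintD => //; apply: rintD => //; apply: rintZ.
Qed.

Lemma cintegral_lincomb D c f g : measurable D -> cint D f -> cint D g ->
  cintegral D (lincomb c f g) = cintegral D f + c * cintegral D g.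
Proof.
move=> mD [rf jf] [rg jg]; rewrite /cintegral ReF_lincomb ImF_lincomb.
have cr a p : rint D p -> rint D (fun x => a * p x) by exact: rintZ.
rewrite !RintegralD//; try exact: cr; try by apply: rintD => //; exact: cr.
rewrite !RintegralZl//; apply: ReIm_eq; rewrite !ReImE /=; ring.
Qed.

Lemma cintegralJ D f : measurable D -> cint D f ->
  cintegral D (fun x => (f x)^*%C) = (cintegral D f)^*%C.
Proof.
move=> mD [rf jf]; apply: ReIm_eq; rewrite !ReImE /=.
  by apply: eq_Rintegral => x _; rewrite /ReF cReJ.
by rewrite -RintegralN//; apply: eq_Rintegral => x _; rewrite /ImF cImJ.
Qed.

Lemma cintegral_mkcond D f :
  cintegral D f = cintegral setT (fun x => if x \in D then f x else 0).
Proof.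
rewrite /cintegral [in LHS]Rintegral_mkcond [X in _ +i* X]Rintegral_mkcond.
congr (_ +i* _); apply: eq_Rintegral => x _; rewrite patchE /ReF /ImF.
  by case: ifP.
by case: ifP.
Qed.

Lemma cintegral_ae f g : measurable_fun setT (ReF f) -> measurable_fun setT (ImF f) ->
  measurable_fun setT (ReF g) -> measurable_fun setT (ImF g) -> aeeq f g ->
  cintegral setT f = cintegral setT g.
Proof.
move=> mrf mif mrg mig fg; rewrite /cintegral /Rintegral; congr (fine _ +i* fine _).
  apply: ae_eq_integral => //; try exact/measurable_EFinP.
  by apply: ae_imply fg => x /= E _; rewrite /ReF E.
apply: ae_eq_integral => //; try exact/measurable_EFinP.
by apply: ae_imply fg => x /= E _; rewrite /ImF E.
Qed.

(** Real and imaginary parts are bounded separately, whence the factor 2. *)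
Lemma normc_cintegral D f p : measurable D -> cint D f -> rint D p ->
  (forall x, D x -> normc (f x) <= p x) ->
  normc (cintegral D f) <= 2 * \int[mu]_(x in D) p x.
Proof.
move=> mD [rf jf] ip le; apply: le_trans (normc_le_ReIm _) _.
have H (q : R -> R) : rint D q -> (forall x, D x -> `|q x| <= p x) ->
    `|\int[mu]_(x in D) q x| <= \int[mu]_(x in D) p x.
  move=> iq leq; apply: (@le_trans _ _ (\int[mu]_(x in D) `|q x|)); first exact: le_normr_Rintegral.
  by apply: le_Rintegral => //; exact: rint_abs.
rewrite mulr_natl mulr2n lerD//= H// => x Dx; apply: le_trans (le x Dx).
  exact: ler_Re_normc.
exact: ler_Im_normc.
Qed.

End ComplexIntegral.

(** * Square-integrable functions and the $L^2$ product *)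

Section SquareIntegrable.
Context {R : realType}.
Implicit Types (D : set R) (p q : R -> R) (f g v w : R -> R[i]) (c : R[i]).

Definition rsq p := measurable_fun [set: R] p /\ rint setT (fun x => p x ^+ 2).

Lemma rsq_mul p q : rsq p -> rsq q -> rint setT (fun x => p x * q x).
Proof.
move=> [mp ip] [mq iq]; apply: (@rint_le _ _ _ (fun x => p x ^+ 2 + q x ^+ 2)) => //.
- exact: measurable_funM.
- by move=> x _; rewrite ler_norml; nra.
- exact: rintD.
Qed.

Lemma rsqD p q : rsq p -> rsq q -> rsq (fun x => p x + q x).
Proof.
move=> sp sq; split; first by apply: measurable_funD; [case: sp|case: sq].
have -> : (fun x => (p x + q x) ^+ 2) =
   fun x => p x ^+ 2 + (2 * (p x * q x) + q x ^+ 2).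
  by apply/funext => x; ring.
apply: rintD => //; first by case: sp.
apply: rintD => //; last by case: sq.
by apply: rintZ => //; exact: rsq_mul.
Qed.

Lemma rsqZ k p : rsq p -> rsq (fun x => k * p x).
Proof.
move=> [mp ip]; split; first by apply: measurable_funM.
have -> : (fun x => (k * p x) ^+ 2) = fun x => k ^+ 2 * p x ^+ 2.
  by apply/funext => x; ring.
exact: rintZ.
Qed.

(** This is [L2 a] without the support condition, because translates of a function supported in
    (-a,a) leave that interval. *)
Definition sqi v := rsq (ReF v) /\ rsq (ImF v).

Lemma L2_sqi (a : R) v : L2 a v -> sqi v.
Proof.
move=> [mr mi isq _]; split; split=> //.
  apply: rint_le isq => //; first exact: measurable_funX.
  by move=> x _; rewrite ger0_norm ?sqr_ge0// lerDl sqr_ge0.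
apply: rint_le isq => //; first exact: measurable_funX.
by move=> x _; rewrite ger0_norm ?sqr_ge0// lerDr sqr_ge0.
Qed.

Lemma sqi_L2 (a : R) v : sqi v -> (forall x, x \notin `]- a, a[ -> v x = 0) -> L2 a v.
Proof. by move=> [[? ?] [? ?]] ?; split=> //; exact: rintD. Qed.

Lemma sqi_lincomb c v w : sqi v -> sqi w -> sqi (lincomb c v w).
Proof.
move=> [rv jv] [rw jw]; rewrite /sqi ReF_lincomb ImF_lincomb.
by split; apply: rsqD => //; apply: rsqD; exact: rsqZ.
Qed.

Lemma L2_lincomb (a : R) c v w : L2 a v -> L2 a w -> L2 a (lincomb c v w).
Proof.
move=> Lv Lw; apply: sqi_L2; first by apply: sqi_lincomb; apply: (@L2_sqi a).
by move=> x xa; rewrite /lincomb; case: Lv => _ _ _ ->//; case: Lw => _ _ _ ->//; rewrite mulr0 addr0.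
Qed.

Lemma ReF_mulJ v w : ReF (fun x => v x * (w x)^*%C) =
  fun x => ReF v x * ReF w x + ImF v x * ImF w x.
Proof. by apply/funext => x; rewrite /ReF /ImF !ReImE mulrN opprK. Qed.

Lemma ImF_mulJ v w : ImF (fun x => v x * (w x)^*%C) =
  fun x => ImF v x * ReF w x - ReF v x * ImF w x.
Proof. by apply/funext => x; rewrite /ReF /ImF !ReImE; ring. Qed.

Lemma sqi_cint v w : sqi v -> sqi w -> cint setT (fun x => v x * (w x)^*%C).
Proof.
move=> [rv jv] [rw jw]; split; rewrite ?ReF_mulJ ?ImF_mulJ.
  by apply: rintD => //; exact: rsq_mul.
by apply: rintB => //; exact: rsq_mul.
Qed.

Lemma Re_ipL2 v : complex.Re (ipL2 v v) = \int[mu]_x (ReF v x ^+ 2 + ImF v x ^+ 2).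
Proof. by rewrite /ipL2 /cintegral ReF_mulJ. Qed.

Lemma ipL2_semi : semi_ip sqi (@ipL2 R).
Proof.
split.
- by move=> c v w; exact: sqi_lincomb.
- move=> c u v w su sv sw; rewrite /ipL2 -cintegral_lincomb//; try exact: sqi_cint.
  by congr cintegral; apply/funext => x; rewrite /lincomb mulrDl mulrA.
- move=> v w sv sw; rewrite /ipL2 -cintegralJ//; last exact: sqi_cint.
  by congr cintegral; apply/funext => x; rewrite rmorphM/= conjcK mulrC.
- move=> v _; rewrite Re_ipL2; apply: Rintegral_ge0 => x _.
  by rewrite addr_ge0// sqr_ge0.
Qed.

Lemma ipL2_semi_L2 (a : R) : semi_ip (L2 a) (@ipL2 R).
Proof.
apply: semi_ip_sub ipL2_semi _ _; first by move=> c v w; exact: L2_lincomb.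
by move=> v; exact: L2_sqi.
Qed.

Lemma normL2_sq v : sqi v -> normL2 v ^+ 2 = complex.Re (ipL2 v v).
Proof. exact: snorm_sq ipL2_semi _. Qed.

Lemma normL2_ge0 v : 0 <= normL2 v.
Proof. exact: sqrtr_ge0. Qed.

Lemma normL2_eq0 v : sqi v -> normL2 v = 0 -> aeeq v (cst 0).
Proof.
move=> sv n0; have : complex.Re (ipL2 v v) = 0 by rewrite -normL2_sq// n0 expr0n.
rewrite Re_ipL2 /Rintegral => I0.
have [[mr ir] [mi ii]] := sv.
have iv : rint setT (fun x => ReF v x ^+ 2 + ImF v x ^+ 2) by exact: rintD.
have E : (\int[mu]_x (ReF v x ^+ 2 + ImF v x ^+ 2)%:E = 0)%E.
  by rewrite -[LHS]fineK ?I0//; exact: integrable_fin_num.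
have arch_weight : measurable_fun [set: R] (fun x => (ReF v x ^+ 2 + ImF v x ^+ 2)%:E).
  by apply/measurable_EFinP; exact: rint_measurable iv.
have [+ _] := ae_eq_integral_abs lebesgue_measure measurableT arch_weight.
have -> : (\int[mu]_x `|(ReF v x ^+ 2 + ImF v x ^+ 2)%:E| = 0)%E.
  by rewrite -[RHS]E; apply: eq_integral => x _; rewrite gee0_abs// lee_fin addr_ge0// sqr_ge0.
move=> /(_ erefl); apply: ae_imply => x /= /(_ I) [] H.
have [h1 h2] : ReF v x = 0 /\ ImF v x = 0 by split; nra.
by apply: ReIm_eq.
Qed.

Lemma aeeq_ipL2 v v' w w' : sqi v -> sqi v' -> sqi w -> sqi w' ->
  aeeq v v' -> aeeq w w' -> ipL2 v w = ipL2 v' w'.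
Proof.
move=> sv sv' sw sw' vv ww; apply: cintegral_ae.
- exact: rint_measurable (sqi_cint sv sw).1.
- exact: rint_measurable (sqi_cint sv sw).2.
- exact: rint_measurable (sqi_cint sv' sw').1.
- exact: rint_measurable (sqi_cint sv' sw').2.
- by apply: ae_imply2 vv ww => x -> ->.
Qed.

End SquareIntegrable.

(** * Correlations and translation differences *)

Section Correlation.
Context {R : realType}.
Implicit Types (p q : R -> R) (u v w : R -> R[i]) (c : R[i]) (x y : R).

Definition tau x v : R -> R[i] := fun y => v (y - x).
Definition gcorr v w : R -> R[i] := convolution v (tilde w).

(** Seen as a product of [v] with a translate of [w], the correlation inherits sesquilinearity and
    the Cauchy-Schwarz bound from [ipL2]. *)
Lemma gcorrE v w x : gcorr v w x = ipL2 v (tau x w).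
Proof.
rewrite /gcorr /convolution /ipL2; congr cintegral; apply/funext => y.
by rewrite /tilde /tau opprB.
Qed.

Lemma rsq_shift x p : rsq p -> rsq (fun y => p (y - x)).
Proof.
move=> [mp ip]; split; last exact: (integrable_shift x ip).
by apply: measurableT_comp => //; apply: measurable_funB.
Qed.

Lemma tau_sqi x v : sqi v -> sqi (tau x v).
Proof. by move=> [rv iv]; split; [exact: (rsq_shift x rv)|exact: (rsq_shift x iv)]. Qed.

Lemma ipL2_tau x v w : sqi v -> sqi w -> ipL2 (tau x v) (tau x w) = ipL2 v w.
Proof.
move=> sv sw; have [H1 H2] := sqi_cint sv sw; rewrite /ipL2 /cintegral.
congr (_ +i* _).
  exact: (Rintegral_shift x (rint_measurable H1)).
exact: (Rintegral_shift x (rint_measurable H2)).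
Qed.

Lemma normL2_tau x v : sqi v -> normL2 (tau x v) = normL2 v.
Proof. by move=> sv; rewrite /normL2 ipL2_tau. Qed.

Lemma gcorr_linl c u v w : sqi u -> sqi v -> sqi w ->
  gcorr (lincomb c v w) u = lincomb c (gcorr v u) (gcorr w u).
Proof.
move=> su sv sw; apply/funext => x; rewrite /lincomb !gcorrE.
by rewrite (semi_ip_linl ipL2_semi)//; exact: tau_sqi.
Qed.

Lemma gcorr_linr c u v w : sqi u -> sqi v -> sqi w ->
  gcorr u (lincomb c v w) = lincomb c^*%C (gcorr u v) (gcorr u w).
Proof.
move=> su sv sw; apply/funext => x; rewrite /lincomb !gcorrE.
have -> : tau x (fun y => v y + c * w y) = lincomb c (tau x v) (tau x w) by [].
by rewrite (semi_ip_linr ipL2_semi)//; exact: tau_sqi.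
Qed.

Lemma tau_add x y v : tau x (tau y v) = tau (x + y) v.
Proof. by apply/funext => z; rewrite /tau; congr v; ring. Qed.

Lemma tau0 v : tau 0 v = v.
Proof. by apply/funext => z; rewrite /tau subr0. Qed.

Lemma gcorrC v w x : sqi v -> sqi w -> gcorr w v x = (gcorr v w (- x))^*%C.
Proof.
move=> sv sw; rewrite !gcorrE -(ipL2_tau x sv (tau_sqi _ sw)) tau_add subrr tau0.
by rewrite (semi_ipC ipL2_semi (tau_sqi x sv) sw).
Qed.

Lemma gcorr_ge v w x : sqi v -> sqi w -> normc (gcorr v w x) <= normL2 v * normL2 w.
Proof.
move=> sv sw; rewrite gcorrE -(normL2_tau x sw).
exact: semi_ip_CS ipL2_semi _ _ sv (tau_sqi x sw).
Qed.

Lemma gcorr0 v w : gcorr v w 0 = ipL2 v w.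
Proof. by rewrite gcorrE tau0. Qed.

Lemma cintegral0 (D : set R) : cintegral D (fun=> 0) = 0.
Proof. by rewrite /cintegral /Rintegral !integral0_eq. Qed.

(** A shift of length at least 2a separates the supports. This makes the prime sum finite and
    confines the pole integral to a bounded interval. *)
Lemma gcorr_supp (a : R) v w x : L2 a v -> L2 a w -> 2 * a <= `|x| -> gcorr v w x = 0.
Proof.
move=> [_ _ _ v0] [_ _ _ w0] ax; rewrite gcorrE /ipL2.
have -> : (fun y => v y * (tau x w y)^*%C) = fun=> 0.
  apply/funext => y; have [ya|/v0 ->] := boolP (y \in `]- a, a[); last by rewrite mul0r.
  rewrite /tau w0 ?rmorph0 ?mulr0//; apply/negP; move: ya; rewrite !in_itv/=.
  move=> /andP[y1 y2] /andP[y3 y4]; move: ax; rewrite leNgt ltr_norml => /negP; apply.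
  by apply/andP; lra.
exact: cintegral0.
Qed.

Lemma aeeq_normB v v' : sqi v -> sqi v' -> aeeq v v' -> normL2 (v \- v') = 0.
Proof.
move=> sv sv' vv; rewrite /normL2.
have s0 : sqi (cst 0 : R -> R[i]) := semi_ip0 ipL2_semi sv.
have sB := semi_ipB ipL2_semi sv sv'.
rewrite (@aeeq_ipL2 _ (v \- v') (cst 0) (v \- v') (cst 0))//; last first.
- by apply: ae_imply vv => x /= ->; rewrite subrr.
- by apply: ae_imply vv => x /= ->; rewrite subrr.
rewrite /ipL2 (_ : (fun _ => _) = fun=> 0) ?cintegral0 ?sqrtr0//.
by apply/funext => x; rewrite mul0r.
Qed.

Definition corr p q x : R := \int[mu]_y (p y * q (y - x)).

(** Tonelli gives measurability in x for nonnegative integrands only, so the product is recovered by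
    polarisation from (p(y) + q(y - x))^2; the integral of q(y - x)^2 does not depend on x. *)
Lemma corr_measurable p q : rsq p -> rsq q -> measurable_fun [set: R] (corr p q).
Proof.
move=> sp sq.
pose F x := (\int[lebesgue_measure]_y ((p y + q (y - x)) ^+ 2)%:E)%E.
have mF : measurable_fun [set: R] F.
  pose h (z : R * R) := ((p z.2 + q (z.2 - z.1)) ^+ 2)%:E.
  have mh : measurable_fun [set: R * R] h.
    apply/measurable_EFinP; apply: measurable_funX; apply: measurable_funD.
      by apply: measurableT_comp => //; case: sp.
    apply: measurableT_comp; first by case: sq.
    by apply: measurable_funB.
  have h0 z : (0 <= h z)%E by rewrite lee_fin sqr_ge0.
  exact: (@measurable_fun_fubini_tonelli_F _ _ (measurableTypeR R) (measurableTypeR R) R lebesgue_measure h mh h0).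
have -> : corr p q = fun x => 2^-1 * (fine (F x) - (\int[mu]_y (p y ^+ 2) + \int[mu]_y (q y ^+ 2))).
  apply/funext => x; have sqx := rsq_shift x sq.
  have -> : fine (F x) = \int[mu]_y (p y ^+ 2) + (2 * corr p q x + \int[mu]_y (q y ^+ 2)).
    rewrite /corr -RintegralZl//; last exact: rsq_mul.
    rewrite -(Rintegral_shift x (f := fun y => q y ^+ 2)); last exact: rint_measurable sq.2.
    rewrite -RintegralD//; [|apply: rintZ => //; exact: rsq_mul|exact: sqx.2].
    rewrite -RintegralD//; [|exact: sp.2|apply: rintD => //; [apply: rintZ => //; exact: rsq_mul|exact: sqx.2]].
    by rewrite /F /Rintegral; congr fine; apply: eq_integral => y _; congr EFin; ring.
  by field.
apply: measurable_funM => //; apply: measurable_funB => //.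
by apply: measurableT_comp => //; exact: fine_measurable.
Qed.

Lemma ReF_gcorr v w : sqi v -> sqi w -> ReF (gcorr v w) =
  fun x => corr (ReF v) (ReF w) x + corr (ImF v) (ImF w) x.
Proof.
move=> [rv iv] [rw iw]; apply/funext => x; rewrite {1}/ReF gcorrE /ipL2 /cintegral /= ReF_mulJ.
by rewrite RintegralD//; apply: rsq_mul => //; [exact: (rsq_shift x rw)|exact: (rsq_shift x iw)].
Qed.

Lemma ImF_gcorr v w : sqi v -> sqi w -> ImF (gcorr v w) =
  fun x => corr (ImF v) (ReF w) x - corr (ReF v) (ImF w) x.
Proof.
move=> [rv iv] [rw iw]; apply/funext => x; rewrite {1}/ImF gcorrE /ipL2 /cintegral /= ImF_mulJ.
by rewrite RintegralB//; apply: rsq_mul => //; [exact: (rsq_shift x rw)|exact: (rsq_shift x iw)].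
Qed.

Lemma gcorr_measurable v w : sqi v -> sqi w ->
  measurable_fun [set: R] (ReF (gcorr v w)) /\ measurable_fun [set: R] (ImF (gcorr v w)).
Proof.
move=> sv sw; rewrite ReF_gcorr// ImF_gcorr//; move: sv sw => [? ?] [? ?].
by split; [apply: measurable_funD|apply: measurable_funB]; exact: corr_measurable.
Qed.

(* The polarised form of [|v - tau x v|^2]; the archimedean term of [Q_W] is an
   integral of it, up to a multiple of the L^2 product (see [weil_arch_gcorr]). *)
Definition delta x v w : R[i] := ipL2 (v \- tau x v) (w \- tau x w).

Lemma delta_semi x : semi_ip sqi (delta x).
Proof.
have H c v w : lincomb c v w \- tau x (lincomb c v w) = lincomb c (v \- tau x v) (w \- tau x w).
  by apply/funext => y; rewrite /lincomb /tau /=; ring.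
have S v : sqi v -> sqi (v \- tau x v).
  by move=> sv; apply: semi_ipB ipL2_semi _ _ sv (tau_sqi x sv).
split.
- by move=> c v w; exact: sqi_lincomb.
- by move=> c u v w su sv sw; rewrite /delta H (semi_ip_linl ipL2_semi)//; exact: S.
- by move=> v w sv sw; apply: (semi_ipC ipL2_semi); exact: S.
- by move=> v sv; apply: (semi_ip_ge0 ipL2_semi); exact: S.
Qed.

Lemma deltaE x v w : sqi v -> sqi w ->
  delta x v w = 2 * gcorr v w 0 - gcorr v w x - gcorr v w (- x).
Proof.
move=> sv sw; have tv := tau_sqi x sv; have tw := tau_sqi x sw.
rewrite /delta (semi_ipBl ipL2_semi)//; last exact: semi_ipB ipL2_semi _ _ _ _.
rewrite !(semi_ipBr ipL2_semi)// ipL2_tau// gcorr0 !gcorrE.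
have -> : ipL2 v (tau (- x) w) = ipL2 (tau x v) w.
  by rewrite -(ipL2_tau x)//; [rewrite tau_add subrr tau0|exact: tau_sqi].
ring.
Qed.

Definition nu v x : R := complex.Re (delta x v v).

Lemma nu_ge0 v x : sqi v -> 0 <= nu v x.
Proof. exact: semi_ip_ge0 (delta_semi x) _. Qed.

Lemma nuE v x : sqi v -> nu v x = 2 * normL2 v ^+ 2 - 2 * ReF (gcorr v v) x.
Proof.
move=> sv; rewrite /nu deltaE// (gcorrC (- x) sv sv) opprK gcorr0 !ReImE -normL2_sq// /ReF /=.
ring.
Qed.

Lemma nu_measurable v : sqi v -> measurable_fun [set: R] (nu v).
Proof.
move=> sv; have -> : nu v = fun x => 2 * normL2 v ^+ 2 - 2 * ReF (gcorr v v) x.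
  by apply/funext => x; exact: nuE.
apply: measurable_funB => //; apply: measurable_funM => //.
by case: (gcorr_measurable sv sv).
Qed.

Lemma nu_le v x : sqi v -> nu v x <= 4 * normL2 v ^+ 2.
Proof.
move=> sv; rewrite nuE//.
have : `|ReF (gcorr v v) x| <= normL2 v * normL2 v.
  by apply: le_trans (gcorr_ge x sv sv); exact: ler_Re_normc.
rewrite ler_norml => /andP[h _]; rewrite expr2; lra.
Qed.

Lemma delta_le x v w : sqi v -> sqi w -> normc (delta x v w) <= nu v x + nu w x.
Proof.
move=> sv sw; have := semi_ip_CS (delta_semi x) sv sw.
rewrite -[nu v x](snorm_sq (delta_semi x) sv) -[nu w x](snorm_sq (delta_semi x) sw).
move/le_trans; apply; nra.
Qed.

Lemma nu_lincomb x c v w : sqi v -> sqi w ->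
  nu (lincomb c v w) x <= 2 * nu v x + 2 * normc c ^+ 2 * nu w x.
Proof.
move=> sv sw; have D := delta_semi x.
have := snorm_lincomb D c sv sw; set s := snorm _ _; set s1 := snorm _ v; set s2 := snorm _ w => H.
rewrite -[nu _ _](snorm_sq D (sqi_lincomb c sv sw)) -[nu v _](snorm_sq D sv) -[nu w _](snorm_sq D sw).
rewrite -/s -/s1 -/s2.
have s0 : 0 <= s by exact: snorm_ge0.
have : s ^+ 2 <= (s1 + normc c * s2) ^+ 2 by rewrite ler_pXn2r// nnegrE// (le_trans s0 H).
have := sqr_ge0 (s1 - normc c * s2); nra.
Qed.

(** For fixed x the square root of [nu] is a seminorm bounded by 2 [normL2], hence continuous on
    $L^2$. This is the pointwise convergence that Fatou's lemma will require. *)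
Lemma nu_cvg (un : nat -> R -> R[i]) v x : (forall n, sqi (un n)) -> sqi v ->
  (fun n => normL2 (un n \- v)) @ \oo --> (0 : R) ->
  (fun n => nu (un n) x) @ \oo --> nu v x.
Proof.
move=> su sv uv; have D := delta_semi x.
have -> : nu v x = snorm (delta x) v * snorm (delta x) v by rewrite -expr2 (snorm_sq D).
have -> : (fun n => nu (un n) x) = fun n => snorm (delta x) (un n) * snorm (delta x) (un n).
  by apply/funext => n; rewrite -expr2 (snorm_sq D).
suff H : (fun n => snorm (delta x) (un n)) @ \oo --> snorm (delta x) v by exact: cvgM.
apply/cvgrPdist_le => /= e e0.
move/cvgrPdist_le : uv => /(_ (e / 2)); rewrite divr_gt0// => /(_ isT).
apply: filterS => n /=; rewrite sub0r normrN ger0_norm ?normL2_ge0// => H.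
rewrite distrC; apply: le_trans (snorm_dist D (su n) sv) _.
have sB := semi_ipB ipL2_semi (su n) sv.
have n0 := normL2_ge0 (un n \- v).
have e0' := ltW e0.
rewrite -(@ler_pXn2r _ 2)// ?nnegrE ?snorm_ge0// (snorm_sq D)//.
by apply: le_trans (nu_le x sB) _; nra.
Qed.

End Correlation.

(** * The archimedean kernel *)

Section Weights.
Context {R : realType}.
Implicit Types (x : R).

Definition arch_kernel x : R := expR (x / 2) / (expR x - expR (- x)).
(** The coefficient left in front of 2 f(0) once f(x) + f(-x) is written as 2 f(0) minus [delta].
    The factor 1 - exp(-x/2) cancels the singularity of the kernel at 0. *)
Definition arch_weight x : R := (1 - expR (- x / 2)) * arch_kernel x.

Lemma arch_kernel_gt0 x : 0 < x -> 0 < arch_kernel x.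
Proof.
move=> x0; rewrite divr_gt0 ?expR_gt0// subr_gt0 ltr_expR; lra.
Qed.

(** With s = exp(-x/2) the kernel is s / (1 - s^4), and (1 - s) s / (1 - s^4) <= s because s^4 <= s
    for 0 < s < 1. *)
Lemma arch_weight_bound x : 0 < x -> 0 <= arch_weight x <= expR (- x / 2).
Proof.
move=> x0; rewrite /arch_weight; set s := expR (- x / 2).
have s0 : 0 < s by exact: expR_gt0.
have s1 : s < 1 by rewrite -expR0 ltr_expR; lra.
have k0 := ltW (arch_kernel_gt0 x0); have s1' := ltW s1.
rewrite mulr_ge0 ?subr_ge0//=.
have -> : arch_kernel x = s / (1 - s ^+ 4).
  have e1 : expR (x / 2) = s^-1 by rewrite /s -expRN; congr expR; lra.
  have e2 : expR x = s^-1 ^+ 2 by rewrite -e1 expr2 -expRD; congr expR; lra.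
  have e3 : expR (- x) = s ^+ 2 by rewrite /s expr2 -expRD; congr expR; lra.
  rewrite /arch_kernel e1 e2 e3; field.
  have s4 : s ^+ 4 < 1 by rewrite exprn_ilt1// ltW.
  rewrite (gt_eqF s0) /=.
  by apply/andP; split; lra.
have s4 : s ^+ 4 <= s by rewrite -[leRHS]expr1 ler_wiXn2l// ltW.
rewrite mulrA ler_pdivrMr; last lra.
by rewrite mulrC ler_pM2l//; lra.
Qed.

Lemma measurable_arch_kernel : measurable_fun (`]0, +oo[%classic : set R) arch_kernel.
Proof.
apply: open_continuous_measurable_fun; first exact: rray_open.
move=> x; rewrite inE/= in_itv/= andbT => x0.
apply: cvgM.
  apply: continuous_comp; last exact: continuous_expR.
  by apply: cvgM; [exact: cvg_id|exact: cvg_cst].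
apply: cvgV; first by rewrite subr_eq0; apply/eqP => /expR_inj; lra.
apply: cvgB; first exact: continuous_expR.
by apply: continuous_comp; [exact: cvgN|exact: continuous_expR].
Qed.

Lemma rint_arch_weight : rint `]0, +oo[ arch_weight.
Proof.
have H := @integrable_exponential_pdf R 2^-1.
(* The bound exp(-x/2) is twice the exponential density of rate 1/2. *)
apply: (@rint_le _ _ _ (fun x => 2 * exponential_pdf 2^-1 x)) => //.
- apply: measurable_funM; last exact: measurable_arch_kernel.
  apply: measurable_funB => //; apply: measurableT_comp; first exact: measurable_expR.
  by apply: measurable_funM => //; exact: measurable_funTS.
- move=> x /=; rewrite in_itv/= andbT => x0.
  have /andP[m0 m1] := arch_weight_bound x0; rewrite ger0_norm// (exponential_pdfE _ (ltW x0)).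
  rewrite mulrA mulfV// mul1r; apply: le_trans m1 _; rewrite le_eqVlt; apply/orP; left.
  by apply/eqP; congr expR; lra.
- apply: rintZ => //; apply: rint_setT => //; apply: H; lra.
Qed.

End Weights.

(** * The Weil functional on compactly supported functions *)

Section Weil.
Context {R : realType}.
Implicit Types (f g : R -> R[i]) (c : R[i]) (A M x : R).

(** The class on which [weil] is linear: bounded support makes the prime sum finite, and the
    archimedean integrand is integrable. *)
Definition weil_adm A g :=
  [/\ measurable_fun [set: R] (ReF g), measurable_fun [set: R] (ImF g),
      exists M, forall x, normc (g x) <= M,
      forall x, A <= `|x| -> g x = 0 &
      cint `]0, +oo[ (weil_arch g)].

(** Here the bound [M] is named, for estimates of [weil_finite] that are uniform in [g]. *)
Definition weil_reg A M g :=
  [/\ measurable_fun [set: R] (ReF g), measurable_fun [set: R] (ImF g),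
      forall x, normc (g x) <= M &
      forall x, A <= `|x| -> g x = 0].

Definition wpole g x : R[i] := g x * (expR (x / 2) + expR (- x / 2))%:C.
Definition wprime g (n : nat) : R[i] := (vonMangoldt R n / Num.sqrt n%:R)%:C *
                      (g (ln n%:R) + g (- ln n%:R)).

Lemma weil_finiteE g : weil_finite g = cintegral setT (wpole g) - cseries (wprime g)
  - (ln (4 * pi) + euler_mascheroni R)%:C * g 0.
Proof. by []. Qed.

(** From n >= exp A follows log n >= A, outside the support. The cut-off depends on [A] alone, so
    one index serves all functions supported in [-A,A]. *)
Lemma wprime_eq0 A g n : (forall x, A <= `|x| -> g x = 0) ->
  (Num.Def.archi_bound (expR A) <= n)%N -> wprime g n = 0.
Proof.
move=> g0 An; have Al : A <= ln n%:R.
  have e0 : expR A <= n%:R.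
    apply: le_trans (ltW (archi_boundP (expR_ge0 A))) _; by rewrite ler_nat.
  by rewrite -[A]expRK ler_ln// posrE ?expR_gt0// (lt_le_trans (expR_gt0 A)).
rewrite /wprime !g0 ?addr0 ?mulr0// ?normrN; exact: le_trans Al (ler_norm _).
Qed.

Lemma cseries_finite (un : nat -> R[i]) N : (forall n, (N <= n)%N -> un n = 0) ->
  cseries un = \sum_(0 <= n < N) un n.
Proof.
have L (r : nat -> R) : (forall n, (N <= n)%N -> r n = 0) ->
    limn (series r) = \sum_(0 <= n < N) r n.
  move=> r0; apply: cvg_lim => //; apply: cvg_near_cst; near=> n.
  have Nn : (N <= n)%N by near: n; exists N.
  rewrite /series/= (big_cat_nat (n := N))//= [X in _ + X]big1_seq ?addr0//.
  by move=> i; rewrite mem_index_iota => /andP[_ /andP[/r0]].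
move=> u0; rewrite /cseries !L; first last.
- by move=> n /u0 ->.
- by move=> n /u0 ->.
by elim/big_rec3: _ => // i x y z _ <-; case: (un i).
Unshelve. all: by end_near. Qed.

Lemma wpole_lincomb c f g : wpole (lincomb c f g) = lincomb c (wpole f) (wpole g).
Proof. by apply/funext => x; rewrite /wpole /lincomb mulrDl mulrA. Qed.

Lemma wprime_lincomb c f g n : wprime (lincomb c f g) n = wprime f n + c * wprime g n.
Proof. by rewrite /wprime /lincomb; ring. Qed.

Lemma weil_arch_lincomb c f g : weil_arch (lincomb c f g) = lincomb c (weil_arch f) (weil_arch g).
Proof. by apply/funext => x; rewrite /weil_arch /lincomb; ring. Qed.

Lemma expR_le_bound A x : `|x| <= A -> expR (x / 2) + expR (- x / 2) <= 2 * expR A.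
Proof.
rewrite ler_norml => /andP[? ?].
have -> : 2 * expR A = expR A + expR A by ring.
by apply: lerD; rewrite ler_expR; lra.
Qed.

Lemma rint_box (p q K : R) : rint setT (fun x => K * \1_(`[p, q] : set R) x).
Proof.
apply: rintZ => //; apply/integrableP; split.
  apply/measurable_EFinP; exact: measurable_indic.
under eq_integral do rewrite /= ger0_norm ?ler0n//.
rewrite integral_indic//.
apply: (@le_lt_trans _ _ (lebesgue_measure (`[p, q]%classic : set R))); first by rewrite setIT.
rewrite lebesgue_measure_itv /=.
by case: ifP => _; rewrite ?ltry// -EFinB ltry.
Qed.

Lemma Rintegral_box (p q K : R) : p <= q ->
  \int[mu]_x (K * \1_(`[p, q] : set R) x) = K * (q - p).
Proof.
move=> pq; rewrite RintegralZl//; last first.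
  by have := rint_box p q 1; congr rint; apply/funext => x; rewrite mul1r.
congr (_ * _); rewrite /Rintegral integral_indic//.
transitivity (fine (lebesgue_measure (`[p, q]%classic : set R))); first by rewrite setIT.
rewrite lebesgue_measure_itv /= lte_fin; case: ltP => // qp.
by rewrite (le_anti (introT andP (conj pq qp))) subrr.
Qed.

Lemma wpole_bound A M g : weil_reg A M g -> forall x,
  normc (wpole g x) <= (2 * M * expR A) * \1_(`[- A, A] : set R) x.
Proof.
move=> [_ _ gM g0] x; rewrite indicE; have M0 : 0 <= M := le_trans (normc_ge0 _) (gM 0).
have [xA|/ltW xA] := leP `|x| A.
  rewrite mem_set ?mulr1; last by move: xA; rewrite ler_norml /= in_itv.
  rewrite /wpole normcM /= expr0n /= addr0 sqrtr_sqr ger0_norm ?addr_ge0 ?expR_ge0//.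
  have := expR_le_bound xA; have := gM x; have := normc_ge0 (g x).
  have := expR_ge0 (x / 2); have := expR_ge0 (- x / 2); nra.
by rewrite /wpole g0// mul0r normc0 mulr_ge0// ?ler0n// !mulr_ge0// expR_ge0.
Qed.

Lemma wpole_cint A M g : weil_reg A M g -> cint setT (wpole g).
Proof.
move=> H; have B := wpole_bound H; case: H => mr mi _ _.
have E1 : ReF (wpole g) = fun x => ReF g x * (expR (x / 2) + expR (- x / 2)).
  by apply/funext => x; rewrite /ReF /wpole !ReImE/= mulr0 subr0.
have E2 : ImF (wpole g) = fun x => ImF g x * (expR (x / 2) + expR (- x / 2)).
  by apply/funext => x; rewrite /ImF /wpole !ReImE/= mulr0 add0r.
have mw : measurable_fun [set: R] (fun x : R => expR (x / 2) + expR (- x / 2)).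
  apply: measurable_funD; (apply: measurableT_comp; first exact: measurable_expR).
    exact: measurable_funM.
  by apply: measurable_funM => //; exact: oppr_measurable.
split; apply: rint_le (rint_box (- A) A (2 * M * expR A)) => //.
- by rewrite E1; exact: measurable_funM.
- by move=> x _; apply: le_trans (B x); exact: ler_Re_normc.
- by rewrite E2; exact: measurable_funM.
- by move=> x _; apply: le_trans (B x); exact: ler_Im_normc.
Qed.

Lemma weil_adm_weil_reg A g : weil_adm A g -> exists M, weil_reg A M g.
Proof. by move=> [mr mi [M gM] g0 _]; exists M. Qed.

Lemma weil_lincomb A c f g : weil_adm A f -> weil_adm A g -> weil (lincomb c f g) = weil f + c * weil g.
Proof.
move=> wf wg; have [M1 rf] := weil_adm_weil_reg wf; have [M2 rg] := weil_adm_weil_reg wg.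
have pf := wpole_cint rf; have pg := wpole_cint rg.
case: wf wg => _ _ _ f0 af [_ _ _ g0 ag].
rewrite /weil !weil_finiteE weil_arch_lincomb wpole_lincomb !cintegral_lincomb//.
set N := Num.Def.archi_bound (expR A).
rewrite (@cseries_finite (wprime (lincomb c f g)) N); last first.
  by move=> n Nn; rewrite wprime_lincomb (wprime_eq0 f0)// (wprime_eq0 g0)// mulr0 addr0.
rewrite (@cseries_finite _ N); last by move=> n; exact: wprime_eq0.
rewrite (@cseries_finite _ N); last by move=> n; exact: wprime_eq0.
under eq_bigr do rewrite wprime_lincomb.
rewrite big_split /= -mulr_sumr /lincomb; ring.
Qed.

Definition reflJ g : R -> R[i] := fun x => (g (- x))^*%C.

(** Every weight in [weil] is real and every term is symmetric under x -> -x. Since [gcorr w v] is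
    the reflected conjugate of [gcorr v w], this is what makes the form Hermitian. *)
Lemma weil_reflJ A g : weil_adm A g -> weil (reflJ g) = (weil g)^*%C.
Proof.
move=> wg; have [M rg] := weil_adm_weil_reg wg; have pg := wpole_cint rg.
case: wg => _ _ _ g0 ag; rewrite /weil !weil_finiteE.
have -> : cintegral setT (wpole (reflJ g)) = (cintegral setT (wpole g))^*%C.
  rewrite -cintegralJ//; have [p1 p2] := pg.
  rewrite /cintegral; congr (_ +i* _).
    rewrite -[RHS]Rintegral_opp; last first.
      have -> : ReF (fun x => (wpole g x)^*%C) = ReF (wpole g).
        by apply/funext => x; rewrite /ReF cReJ.
      exact: rint_measurable p1.
    apply: eq_Rintegral => x _; rewrite /ReF /wpole /reflJ !ReImE /=.
    by rewrite !mulr0 opprK; congr (_ * _ - _); rewrite addrC.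
  rewrite -[RHS]Rintegral_opp; last first.
    have -> : ImF (fun x => (wpole g x)^*%C) = fun x => - ImF (wpole g) x.
      by apply/funext => x; rewrite /ImF cImJ.
    by apply: rint_measurable; exact: rintN.
  apply: eq_Rintegral => x _; rewrite /ImF /wpole /reflJ !ReImE /=.
  by rewrite !mulr0 !add0r opprK mulNr; congr (- (_ * _)); rewrite addrC.
have -> : cseries (wprime (reflJ g)) = (cseries (wprime g))^*%C.
  rewrite (@cseries_finite (wprime (reflJ g)) (Num.Def.archi_bound (expR A))); last first.
    by move=> n; apply: wprime_eq0 => x Ax; rewrite /reflJ g0 ?normrN// rmorph0.
  rewrite (@cseries_finite (wprime g) (Num.Def.archi_bound (expR A))); last first.
    by move=> n; exact: wprime_eq0.
  rewrite rmorph_sum; apply: eq_bigr => n _.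
  rewrite -[RHS]/((wprime g n)^*%C) /wprime /reflJ [RHS]rmorphM.
  by congr (_ * _); [rewrite -[RHS]/(_^*%C) conjc_real|rewrite [RHS]rmorphD /= opprK addrC].
have -> : reflJ g 0 = (g 0)^*%C by rewrite /reflJ oppr0.
have -> : cintegral `]0, +oo[ (weil_arch (reflJ g)) = (cintegral `]0, +oo[ (weil_arch g))^*%C.
  rewrite -cintegralJ//; congr cintegral; apply/funext => x.
  have cM (c d : R[i]) : (c * d)^*%C = c^*%C * d^*%C by exact: rmorphM.
  have cB (c d : R[i]) : (c - d)^*%C = c^*%C - d^*%C by exact: rmorphB.
  have cD (c d : R[i]) : (c + d)^*%C = c^*%C + d^*%C by exact: rmorphD.
  rewrite /weil_arch /reflJ cM cB cD cM !conjc_real opprK oppr0.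
  by congr ((_ - _) * _); rewrite addrC.
have cM (c d : R[i]) : (c * d)^*%C = c^*%C * d^*%C by exact: rmorphM.
have cB (c d : R[i]) : (c - d)^*%C = c^*%C - d^*%C by exact: rmorphB.
by rewrite !(cM, cB) conjc_real.
Qed.

(** The constant depends on the support alone. A correlation is bounded by the product of the $L^2$
    norms, so the pole, prime and point terms become $L^2$-bounded perturbations of the archimedean
    term. *)
Lemma weil_finite_bound A : exists2 C : R, 0 <= C &
  forall M g, weil_reg A M g -> normc (weil_finite g) <= C * M.
Proof.
set N := Num.Def.archi_bound (expR A).
(* One constant for each term: the pole integral (with the 2 of [normc_cintegral]), the prime sum
   (with a 2 for the two values at log n and -log n), and the value at 0. *)
pose C1 : R := 2 * \int[mu]_x (2 * expR A * \1_(`[- A, A] : set R) x).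
pose L (n : nat) : R := normc ((vonMangoldt R n / Num.sqrt n%:R)%:C : R[i]) * 2.
pose C2 : R := \sum_(0 <= n < N) L n.
pose C3 : R := normc ((ln (4 * pi) + euler_mascheroni R)%:C : R[i]).
have C10 : 0 <= C1.
  rewrite mulr_ge0//; apply: Rintegral_ge0 => x _.
  by rewrite !mulr_ge0// ?expR_ge0// indicE ler0n.
have C20 : 0 <= C2 by apply: sumr_ge0 => n _; rewrite mulr_ge0// normc_ge0.
have C30 : 0 <= C3 by exact: normc_ge0.
exists (C1 + C2 + C3); first by rewrite !addr_ge0.
move=> M g H; have [mr mi gM g0] := H; have M0 : 0 <= M := le_trans (normc_ge0 _) (gM 0).
rewrite weil_finiteE.
have nB (u v : R[i]) : normc (u - v) <= normc u + normc v.
  by apply: le_trans (le_normcD _ _) _; rewrite normcN.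
apply: le_trans (nB _ _) _.
have -> : (C1 + C2 + C3) * M = C1 * M + C2 * M + C3 * M by ring.
apply: lerD; last first.
  by rewrite normcM ler_wpM2l.
apply: le_trans (nB _ _) _; apply: lerD.
  apply: le_trans (normc_cintegral measurableT (wpole_cint H) (rint_box (- A) A (2 * M * expR A)) _) _.
    by move=> x _; exact: wpole_bound H x.
  have -> : \int[mu]_x (2 * M * expR A * \1_(`[- A, A] : set R) x) =
            M * \int[mu]_x (2 * expR A * \1_(`[- A, A] : set R) x).
    rewrite -RintegralZl//; last exact: rint_box.
    by apply: eq_Rintegral => x _; ring.
  by rewrite /C1 mulrCA [leRHS]mulrC.
rewrite (@cseries_finite _ N); last by move=> n; exact: wprime_eq0.
rewrite /C2 mulr_suml; elim/big_ind2: _ => //.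
- by rewrite normc0.
- by move=> u r v t ur vt; apply: le_trans (le_normcD _ _) _; rewrite lerD.
- move=> n _; rewrite /wprime normcM /L -mulrA ler_wpM2l ?normc_ge0//.
  apply: le_trans (le_normcD _ _) _; have := gM (ln n%:R); have := gM (- ln n%:R); lra.
Qed.

End Weil.

(** * The form domain and the inner product of [H(T_a)] *)

Section FormDomain.
Context {R : realType}.
Implicit Types (u v w : R -> R[i]) (c : R[i]) (a x y lambda : R).

(* A subspace of the form domain on which everything is computed: finiteness of
   [arch_energy] is what makes [QWquad] finite, the rest of [Q_W] being L^2-bounded. *)
Definition weil_dom a : set (R -> R[i]) :=
  [set v | L2 a v /\ rint `]0, +oo[ (fun x => nu v x * arch_kernel x)].
Definition arch_energy v : R := \int[mu]_(x in `]0, +oo[) (nu v x * arch_kernel x).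
Definition arch_const : R := \int[mu]_(x in `]0, +oo[) arch_weight x.

Lemma weil_dom_L2 a v : weil_dom a v -> L2 a v. Proof. by case. Qed.
Lemma weil_dom_sqi a v : weil_dom a v -> sqi v. Proof. by move=> /weil_dom_L2 /L2_sqi. Qed.

Lemma in_ray x : x \in (`]0, +oo[%classic : set R) -> 0 < x.
Proof. by rewrite inE /= in_itv /= andbT. Qed.

Lemma ray_gt0 x : (`]0, +oo[%classic : set R) x -> 0 < x.
Proof. by rewrite /= in_itv /= andbT. Qed.

Lemma nu_arch_measurable v : sqi v ->
  measurable_fun (`]0, +oo[%classic : set R) (fun x => nu v x * arch_kernel x).
Proof.
move=> sv; apply: measurable_funM; last exact: measurable_arch_kernel.
by apply: measurable_funTS; exact: nu_measurable.
Qed.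

Lemma weil_dom_lincomb a c v w : weil_dom a v -> weil_dom a w -> weil_dom a (lincomb c v w).
Proof.
move=> [Lv iv] [Lw iw]; split; first exact: L2_lincomb.
have sv := L2_sqi Lv; have sw := L2_sqi Lw.
apply: (@rint_le _ _ _ (fun x => 2 * (nu v x * arch_kernel x) + 2 * normc c ^+ 2 * (nu w x * arch_kernel x))) => //.
- by apply: nu_arch_measurable; exact: sqi_lincomb.
- move=> x /ray_gt0 x0; have k0 := ltW (arch_kernel_gt0 x0).
  rewrite ger0_norm; last by rewrite mulr_ge0// nu_ge0//; exact: sqi_lincomb.
  by have := nu_lincomb x c sv sw; nra.
- by apply: rintD => //; exact: rintZ.
Qed.

Lemma delta_measurable v w : sqi v -> sqi w ->
  measurable_fun [set: R] (ReF (fun x => delta x v w)) /\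
  measurable_fun [set: R] (ImF (fun x => delta x v w)).
Proof.
move=> sv sw; have [mr mi] := gcorr_measurable sv sw.
have -> : (fun x => delta x v w) = fun x => 2 * gcorr v w 0 - gcorr v w x - gcorr v w (- x).
  by apply/funext => x; exact: deltaE.
split.
  have -> : ReF (fun x => 2 * gcorr v w 0 - gcorr v w x - gcorr v w (- x)) =
     fun x => complex.Re (2 * gcorr v w 0) - ReF (gcorr v w) x - ReF (gcorr v w) (- x).
    by apply/funext => x; rewrite /ReF !cReD !cReN.
  apply: measurable_funB; first exact: measurable_funB.
  by apply: measurableT_comp => //; exact: oppr_measurable.
have -> : ImF (fun x => 2 * gcorr v w 0 - gcorr v w x - gcorr v w (- x)) =
   fun x => complex.Im (2 * gcorr v w 0) - ImF (gcorr v w) x - ImF (gcorr v w) (- x).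
  by apply/funext => x; rewrite /ImF !cImD !cImN.
apply: measurable_funB; first exact: measurable_funB.
by apply: measurableT_comp => //; exact: oppr_measurable.
Qed.

(** By Cauchy-Schwarz [delta x v w] is at most [nu v x + nu w x], so finite energy of both arguments
    suffices. *)
Lemma weil_dom_cint a v w : weil_dom a v -> weil_dom a w ->
  cint `]0, +oo[ (fun x => delta x v w * (arch_kernel x)%:C).
Proof.
move=> Fv Fw; have sv := weil_dom_sqi Fv; have sw := weil_dom_sqi Fw.
case: Fv Fw => _ iv [_ iw]; have [mr mi] := delta_measurable sv sw.
have E1 : ReF (fun x => delta x v w * (arch_kernel x)%:C) = fun x => ReF (fun x => delta x v w) x * arch_kernel x.
  by apply/funext => x; rewrite /ReF !ReImE /= mulr0 subr0.
have E2 : ImF (fun x => delta x v w * (arch_kernel x)%:C) = fun x => ImF (fun x => delta x v w) x * arch_kernel x.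
  by apply/funext => x; rewrite /ImF !ReImE /= mulr0 add0r.
have H (p : R -> R) : measurable_fun [set: R] p -> (forall x, `|p x| <= normc (delta x v w)) ->
    rint `]0, +oo[ (fun x => p x * arch_kernel x).
  move=> mp lep; apply: (@rint_le _ _ _ (fun x => nu v x * arch_kernel x + nu w x * arch_kernel x)) => //.
  - by apply: measurable_funM; [exact: measurable_funTS|exact: measurable_arch_kernel].
  - move=> x /ray_gt0 x0; have k0 := ltW (arch_kernel_gt0 x0).
    rewrite normrM (ger0_norm k0) -mulrDl ler_wpM2r//.
    by apply: le_trans (lep x) _; exact: delta_le.
  - exact: rintD.
split; rewrite ?E1 ?E2; apply: H => // x; [exact: ler_Re_normc|exact: ler_Im_normc].
Qed.

(** The first summand is integrable against any value f(0); the second carries the energy density,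
    the only part of the form that the $L^2$ norm does not control. *)
Lemma weil_arch_gcorr v w : sqi v -> sqi w -> weil_arch (gcorr v w) =
  lincomb (-1) (fun x => (2 * gcorr v w 0) * (arch_weight x)%:C) (fun x => delta x v w * (arch_kernel x)%:C).
Proof.
move=> sv sw; apply/funext => x; rewrite /lincomb deltaE// /weil_arch /arch_weight -/(arch_kernel x).
by rewrite !rmorphM rmorphB rmorph1 /=; ring.
Qed.

Lemma cint_arch_weight c : cint `]0, +oo[ (fun x => c * (arch_weight x)%:C).
Proof.
have E1 : ReF (fun x => c * (arch_weight x)%:C) = fun x => complex.Re c * arch_weight x.
  by apply/funext => x; rewrite /ReF !ReImE /= mulr0 subr0.
have E2 : ImF (fun x => c * (arch_weight x)%:C) = fun x => complex.Im c * arch_weight x.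
  by apply/funext => x; rewrite /ImF !ReImE /= mulr0 add0r.
by split; rewrite ?E1 ?E2; apply: rintZ => //; exact: rint_arch_weight.
Qed.

Lemma gcorr_weil_reg a v w : L2 a v -> L2 a w ->
  weil_reg (2 * a) (normL2 v * normL2 w) (gcorr v w).
Proof.
move=> Lv Lw; have sv := L2_sqi Lv; have sw := L2_sqi Lw.
have [mr mi] := gcorr_measurable sv sw; split=> //.
  by move=> x; exact: gcorr_ge.
by move=> x; exact: gcorr_supp.
Qed.

Lemma weil_dom_weil_adm a v w : weil_dom a v -> weil_dom a w -> weil_adm (2 * a) (gcorr v w).
Proof.
move=> Fv Fw; have sv := weil_dom_sqi Fv; have sw := weil_dom_sqi Fw.
have [mr mi gM g0] := gcorr_weil_reg (weil_dom_L2 Fv) (weil_dom_L2 Fw); split=> //.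
  by exists (normL2 v * normL2 w).
by rewrite weil_arch_gcorr//; apply: cint_lincomb => //; [exact: cint_arch_weight|exact: weil_dom_cint Fv Fw].
Qed.

Lemma ipTE lambda v w : ipT lambda v w = weil (gcorr v w) - lambda%:C * gcorr v w 0.
Proof. by rewrite /ipT gcorr0. Qed.

Lemma ipT_linl a lambda c u v w : weil_dom a u -> weil_dom a v -> weil_dom a w ->
  ipT lambda (lincomb c v w) u = ipT lambda v u + c * ipT lambda w u.
Proof.
move=> Fu Fv Fw; rewrite !ipTE gcorr_linl; try exact: (@weil_dom_sqi a).
rewrite (@weil_lincomb _ (2 * a)); try exact: weil_dom_weil_adm.
rewrite /lincomb; move: (weil (gcorr v u)) (weil (gcorr w u)) (gcorr v u 0) (gcorr w u 0).
by move=> p q r s; ring.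
Qed.

Lemma ipTC a lambda v w : weil_dom a v -> weil_dom a w -> ipT lambda w v = (ipT lambda v w)^*%C.
Proof.
move=> Fv Fw; have sv := weil_dom_sqi Fv; have sw := weil_dom_sqi Fw.
have E : gcorr w v = reflJ (gcorr v w) by apply/funext => x; rewrite gcorrC.
rewrite !ipTE E (weil_reflJ (weil_dom_weil_adm Fv Fw)) /reflJ oppr0.
have cM (z d : R[i]) : (z * d)^*%C = z^*%C * d^*%C by exact: rmorphM.
have cB (z d : R[i]) : (z - d)^*%C = z^*%C - d^*%C by exact: rmorphB.
move: (weil (gcorr v w)) (gcorr v w 0) => p q.
by rewrite cB cM conjc_real.
Qed.

Lemma Re_cintegral (D : set R) (f : R -> R[i]) :
  complex.Re (cintegral D f) = \int[mu]_(x in D) ReF f x.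
Proof. by []. Qed.

Lemma cReB (z d : R[i]) : complex.Re (z - d) = complex.Re z - complex.Re d.
Proof. by rewrite cReD cReN. Qed.

Lemma cReZ (r : R) (z : R[i]) : complex.Re (r%:C * z) = r * complex.Re z.
Proof. by case: z => p q /=; rewrite mul0r subr0. Qed.

Lemma Re_ipT lambda v : sqi v ->
  complex.Re (ipT lambda v v) = complex.Re (QW v v) - lambda * normL2 v ^+ 2.
Proof. by move=> sv; rewrite /ipT (cReB (QW v v)) cReZ (normL2_sq sv). Qed.

Lemma Re_arch a v : weil_dom a v -> ReF (weil_arch (gcorr v v)) =
  fun x => 2 * normL2 v ^+ 2 * arch_weight x - nu v x * arch_kernel x.
Proof.
move=> Fv; have sv := weil_dom_sqi Fv; apply/funext => x.
rewrite /ReF weil_arch_gcorr// /lincomb gcorr0 !ReImE -(normL2_sq sv) (semi_ip_Im ipL2_semi sv).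
rewrite -/(nu v x); move: (nu v x) (complex.Im (delta x v v)) (normL2 v) (arch_weight x) (arch_kernel x).
by move=> p q r s t /=; ring.
Qed.

Lemma arch_rint a v : weil_dom a v -> rint `]0, +oo[ (ReF (weil_arch (gcorr v v))).
Proof. by move=> Fv; have [_ _ _ _ []] := weil_dom_weil_adm Fv Fv. Qed.

Lemma Re_QW a v : weil_dom a v -> complex.Re (QW v v) =
  complex.Re (weil_finite (gcorr v v)) + arch_energy v - 2 * normL2 v ^+ 2 * arch_const.
Proof.
move=> Fv; rewrite /QW -/(gcorr v v) /weil (cReB (weil_finite _)) Re_cintegral (Re_arch Fv).
have im := rintZ (2 * normL2 v ^+ 2) (measurable_itv _) (@rint_arch_weight R).
rewrite RintegralB//; last by case: Fv.
rewrite RintegralZl//; last exact: rint_arch_weight.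
by rewrite -/(arch_energy v) -/arch_const; ring.
Qed.

(** The archimedean integrand is integrable, so taking the finite part loses nothing. This connects
    [lowest], defined by the extended-valued form, with [ipT]. *)
Lemma QWquadE a v : weil_dom a v -> QWquad v = (complex.Re (QW v v))%:E.
Proof.
move=> Fv; rewrite /QWquad /weil_ext -/(gcorr v v) /QW -/(gcorr v v) /weil.
rewrite (cReB (weil_finite _)) Re_cintegral [RHS]EFinB; congr (_ - _)%E.
rewrite /Rintegral fineK//.
by apply: integrable_fin_num => //; exact: arch_rint Fv.
Qed.

(** What remains after removing the energy is [weil_finite], bounded through the supremum of the
    correlation, and the multiple [arch_const] of the squared norm. *)
Lemma QW_arch_energy_bound a : exists2 C : R, 0 <= C &
  forall v, weil_dom a v -> `|complex.Re (QW v v) - arch_energy v| <= C * normL2 v ^+ 2.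
Proof.
have [C C0 HC] := @weil_finite_bound R (2 * a); exists (C + 2 * `|arch_const|).
  by rewrite addr_ge0// mulr_ge0.
move=> v Fv; rewrite (Re_QW Fv).
have := HC _ _ (gcorr_weil_reg (weil_dom_L2 Fv) (weil_dom_L2 Fv)) => /(le_trans (ler_Re_normc _)).
set r := complex.Re _ => H.
have -> : r + arch_energy v - 2 * normL2 v ^+ 2 * arch_const - arch_energy v =
  r - 2 * normL2 v ^+ 2 * arch_const by ring.
apply: le_trans (ler_normB _ _) _; rewrite [leRHS]mulrDl; apply: lerD; first by rewrite expr2.
have N0 : 0 <= 2 * normL2 v ^+ 2 by rewrite mulr_ge0// sqr_ge0.
by rewrite normrM (ger0_norm N0) mulrAC.
Qed.

(** Equality holds at every point, although the data agree only almost everywhere: the correlation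
    with a null function vanishes by Cauchy-Schwarz. This matters because [weil] evaluates at 0 and
    at the points log n. *)
Lemma gcorr_aeeq v v' w w' : sqi v -> sqi v' -> sqi w -> sqi w' ->
  aeeq v v' -> aeeq w w' -> gcorr v w = gcorr v' w'.
Proof.
move=> sv sv' sw sw' vv ww; apply/funext => x.
have S := @ipL2_semi R.
have H1 : gcorr (v \- v') w x = 0.
  have := gcorr_ge x (semi_ipB S sv sv') sw; rewrite (aeeq_normB sv sv' vv) mul0r => h.
  by apply: eq0_normc; apply/eqP; rewrite eq_le h normc_ge0.
have H2 : gcorr v' (w \- w') x = 0.
  have := gcorr_ge x sv' (semi_ipB S sw sw'); rewrite (aeeq_normB sw sw' ww) mulr0 => h.
  by apply: eq0_normc; apply/eqP; rewrite eq_le h normc_ge0.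
move: H1 H2; rewrite !lincombN1 gcorr_linl// gcorr_linr// /lincomb rmorphN rmorph1 !mulN1r.
by move=> /subr0_eq -> /subr0_eq.
Qed.

Lemma ipT_aeeq lambda v v' w w' : sqi v -> sqi v' -> sqi w -> sqi w' ->
  aeeq v v' -> aeeq w w' -> ipT lambda v w = ipT lambda v' w'.
Proof. by move=> *; rewrite !ipTE (@gcorr_aeeq v v' w w'). Qed.

Lemma ipT_aeeq0 lambda v w : sqi v -> sqi w -> aeeq v (cst 0) -> ipT lambda v w = 0.
Proof.
move=> sv sw v0; rewrite ipTE.
have s0 : sqi (cst 0 : R -> R[i]) := semi_ip0 ipL2_semi sv.
have aw : aeeq w w by apply: ae_imply v0.
rewrite (gcorr_aeeq sv s0 sw sw v0 aw).
have -> : gcorr (cst 0) w = fun=> 0.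
  apply/funext => x; rewrite gcorrE /ipL2 -[RHS](cintegral0 setT); congr cintegral.
  by apply/funext => y; rewrite mul0r.
rewrite mulr0 subr0 /weil weil_finiteE.
have -> : wpole (fun=> (0 : R[i])) = fun=> 0 by apply/funext => x; rewrite /wpole mul0r.
have -> : weil_arch (fun=> (0 : R[i])) = fun=> 0.
  by apply/funext => x; rewrite /weil_arch mulr0 subr0 addr0 mul0r.
rewrite !cintegral0 (@cseries_finite _ _ 0) ?big_geq ?mulr0 ?subr0//.
by move=> n _; rewrite /wprime addr0 mulr0.
Qed.

(** The gap between [lambda] and the bottom of the form is the coercivity constant. Null functions
    are excluded from the infimum defining [lowest] and are treated separately. *)
Lemma weil_dom_coercive a lambda : (lambda%:E < lowest a)%E -> exists2 d : R, 0 < d &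
  forall v, weil_dom a v -> d * normL2 v ^+ 2 <= complex.Re (ipT lambda v v).
Proof.
move=> hl.
(* The bottom itself when it is finite, and [lambda + 1] when it is [+oo]. *)
have [l [ll lL]] : exists l, lambda < l /\ (l%:E <= lowest a)%E.
  move: hl; case: (lowest a) => [r||//].
    by rewrite lte_fin => lr; exists r.
  by move=> _; exists (lambda + 1); rewrite leey ltrDl.
exists (l - lambda); first by rewrite subr_gt0.
move=> v Fv; have sv := weil_dom_sqi Fv.
have [v0|v0] := pselect (aeeq v (cst 0)).
  rewrite ipT_aeeq0//.
  have s0 : sqi (cst 0 : R -> R[i]) := semi_ip0 ipL2_semi sv.
  have := aeeq_normB sv s0 v0; have -> : v \- cst 0 = v by apply/funext => x /=; rewrite subr0.
  by move=> ->; rewrite expr0n mulr0.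
have n0 : 0 < normL2 v ^+ 2.
  rewrite lt0r sqr_ge0 andbT sqrf_eq0; apply/eqP => n0; apply: v0; exact: normL2_eq0.
have fd : formdom a v.
  by split; [exact: weil_dom_L2|rewrite (QWquadE Fv) /= ltry].
have : (l%:E <= QWquad v * ((normL2 v ^+ 2)^-1)%:E)%E.
  by apply: le_trans lL _; apply: ereal_inf_lbound; exists v.
rewrite (QWquadE Fv) -EFinM lee_fin ler_pdivlMr// => H.
by rewrite Re_ipT// mulrBl lerD2r.
Qed.

Lemma ipT_semi a lambda : (lambda%:E < lowest a)%E -> semi_ip (weil_dom a) (@ipT R lambda).
Proof.
move=> hl; have [d d0 H] := weil_dom_coercive hl; split.
- by move=> c v w; exact: weil_dom_lincomb.
- by move=> c u v w; exact: ipT_linl.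
- by move=> v w; exact: ipTC.
- by move=> v Fv; apply: le_trans (H v Fv); rewrite mulr_ge0 ?sqr_ge0// ltW.
Qed.

(** Equivalence of [normT] with the norm built from [normL2] and [arch_energy]. Upper control comes
    from the boundedness of the remaining terms, lower control from coercivity. From here on the
    arithmetic terms of the form are no longer visible. *)
Lemma normT_bounds a lambda : (lambda%:E < lowest a)%E -> exists2 C : R, 0 < C &
  forall v, weil_dom a v -> [/\ normL2 v <= C * normT lambda v,
    arch_energy v <= C * normT lambda v ^+ 2 &
    normT lambda v ^+ 2 <= arch_energy v + C * normL2 v ^+ 2].
Proof.
move=> hl; have S := ipT_semi hl; have [d d0 Hd] := weil_dom_coercive hl.
have [K K0 HK] := QW_arch_energy_bound a.
pose K' := K + `|lambda|.
have K'0 : 0 <= K' by rewrite addr_ge0.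
(* A single constant for the three bounds: the first uses 1 and 1/d, the second 1 + K'/d, the third
   K'. *)
pose C := 1 + d^-1 + K' + K' / d.
have di : 0 < d^-1 by rewrite invr_gt0.
have Kd : 0 <= K' / d by rewrite divr_ge0// ltW.
exists C; first by rewrite /C; lra.
move=> v Fv.
have nT : normT lambda v ^+ 2 = complex.Re (QW v v) - lambda * normL2 v ^+ 2.
  by rewrite -[LHS]/(snorm (ipT lambda) v ^+ 2) (snorm_sq S Fv) (Re_ipT _ (weil_dom_sqi Fv)).
have h1 := Hd v Fv; rewrite -(snorm_sq S Fv) -/(normT lambda v) in h1.
have h1' : normL2 v ^+ 2 <= d^-1 * normT lambda v ^+ 2.
  by rewrite mulrC ler_pdivlMr// mulrC.
have h2 := HK v Fv; rewrite ler_distl in h2; case/andP: h2 => h2 h3.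
have n0 := sqr_ge0 (normL2 v); have l1 := ler_norm lambda.
have l2 : - lambda <= `|lambda| by rewrite ler_normr lexx orbT.
have t0 := sqr_ge0 (normT lambda v).
split.
- rewrite -(@ler_pXn2r _ 2)// ?nnegrE ?normL2_ge0//; last first.
    by rewrite mulr_ge0 ?sqrtr_ge0//; rewrite /C; lra.
  apply: le_trans h1' _; rewrite exprMn ler_wpM2r//.
  have : d^-1 <= C by rewrite /C; lra.
  have : 1 <= C by rewrite /C; lra.
  nra.
- have : arch_energy v <= normT lambda v ^+ 2 + K' * normL2 v ^+ 2 by rewrite nT /K'; nra.
  move/le_trans; apply.
  have : K' * normL2 v ^+ 2 <= K' * (d^-1 * normT lambda v ^+ 2) by rewrite ler_wpM2l.
  have : 0 <= (d^-1 + K') * normT lambda v ^+ 2 by rewrite mulr_ge0//; lra.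
  rewrite /C; lra.
- rewrite nT.
  have : K' * normL2 v ^+ 2 <= C * normL2 v ^+ 2 by rewrite ler_wpM2r// /C; lra.
  rewrite /K'; nra.
Qed.

(** Lower semicontinuity of the energy under $L^2$ convergence: the densities are nonnegative and
    converge for every x by [nu_cvg], so Fatou's lemma applies. This plays the part of the
    closedness of the form. *)
Lemma arch_energy_fatou (un : nat -> R -> R[i]) v (M : R) :
  (forall n, sqi (un n)) -> sqi v ->
  (fun n => normL2 (un n \- v)) @ \oo --> (0 : R) ->
  (forall n, rint `]0, +oo[ (fun x => nu (un n) x * arch_kernel x)) ->
  (forall n, arch_energy (un n) <= M) ->
  rint `]0, +oo[ (fun x => nu v x * arch_kernel x) /\ arch_energy v <= M.
Proof.
move=> su sv uv iu BM.
have kc x : 0 < x -> 0 <= arch_kernel x by move=> /arch_kernel_gt0 /ltW.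
have mk w : sqi w -> measurable_fun (`]0, +oo[%classic : set R) (fun x => (nu w x * arch_kernel x)%:E).
  by move=> sw; apply/measurable_EFinP; exact: nu_arch_measurable.
have H : (\int[lebesgue_measure]_(x in `]0%R, +oo[)
    limn_einf (fun n => (nu (un n) x * arch_kernel x)%:E) <=
    limn_einf (fun n => \int[lebesgue_measure]_(x in `]0%R, +oo[) (nu (un n) x * arch_kernel x)%:E))%E.
  apply: fatou => //; first by move=> n; exact: mk.
  by move=> n x /ray_gt0 x0; rewrite lee_fin mulr_ge0 ?nu_ge0// kc.
have E : (\int[lebesgue_measure]_(x in `]0%R, +oo[) (nu v x * arch_kernel x)%:E =
    \int[lebesgue_measure]_(x in `]0%R, +oo[)
    limn_einf (fun n => (nu (un n) x * arch_kernel x)%:E))%E.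
  apply: eq_integral => x /in_ray x0; apply/esym.
  have cv : (fun n => (nu (un n) x * arch_kernel x)%:E) @ \oo --> (nu v x * arch_kernel x)%:E.
    apply: cvg_EFin; first by near=> n.
    by apply: cvgM; [exact: nu_cvg|exact: cvg_cst].
  by case: (cvg_limn_einf_sup cv).
have Fat : (\int[lebesgue_measure]_(x in `]0%R, +oo[) (nu v x * arch_kernel x)%:E <= M%:E)%E.
  rewrite E; apply: le_trans H _; rewrite limn_einf_lim.
  apply: lime_le; first exact: is_cvg_einfs.
  near=> n; apply: (@le_trans _ _ (\int[lebesgue_measure]_(x in `]0%R, +oo[) (nu (un n) x * arch_kernel x)%:E)%E).
    by apply: ereal_inf_lbound; exists n => /=.
  have := BM n; rewrite /arch_energy /Rintegral -lee_fin fineK//.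
  by apply: integrable_fin_num => //; exact: iu.
have I : rint `]0, +oo[ (fun x => nu v x * arch_kernel x).
  apply/integrableP; split; first exact: mk.
  apply: le_lt_trans (ltry M); apply: le_trans Fat; rewrite le_eqVlt; apply/orP; left.
  apply/eqP; apply: eq_integral => x /in_ray x0.
  by rewrite /= ger0_norm// mulr_ge0 ?nu_ge0// kc.
split=> //; rewrite /arch_energy /Rintegral -lee_fin fineK//.
exact: integrable_fin_num.
Unshelve. all: by end_near. Qed.

End FormDomain.

(** * Smooth functions and test functions *)

Section Smooth.
Context {R : realType}.
Implicit Types (f g : R -> R).

(** A coinduction principle: a class of derivable functions that is stable under derivation consists
    of smooth functions. It avoids formulas for the n-th derivative. *)
Lemma smooth_class (C : set (R -> R)) :
  (forall f, C f -> (forall x : R, derivable f x 1) /\ C (derive1 f)) ->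
  forall f, C f -> smooth f.
Proof.
move=> HC f Cf n x.
have : C (derive1n n f) by elim: n => // n IH; rewrite derive1nS; exact: (HC _ IH).2.
by move=> /HC[+ _]; exact.
Qed.

Lemma smooth_derivable f x : smooth f -> derivable f x 1.
Proof. by move=> /(_ 0%N x). Qed.

Lemma smooth_derive1 f : smooth f -> smooth (derive1 f).
Proof. by move=> sf n x; rewrite -derive1Sn; exact: sf. Qed.

Lemma smooth_is_derive f x : smooth f -> is_derive x (1 : R) f ((derive1 f) x).
Proof. by move=> sf; rewrite derive1E; apply: derivableP; exact: smooth_derivable. Qed.

Lemma derive1_is_derive f g : (forall x : R, is_derive x (1 : R) f (g x)) -> (derive1 f) = g.
Proof. by move=> H; apply/funext => x; rewrite derive1E; exact: derive_val. Qed.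

Lemma smooth_primitive f g : (forall x : R, is_derive x (1 : R) f (g x)) ->
  smooth g -> smooth f.
Proof.
move=> H sg [|n] x; first exact: ex_derive.
by rewrite derive1Sn (derive1_is_derive H); exact: sg.
Qed.

Lemma is_derive_add f g (x df dg : R) : is_derive x (1 : R) f df ->
  is_derive x (1 : R) g dg -> is_derive x (1 : R) (fun y => f y + g y) (df + dg).
Proof. by move=> Hf Hg; exact: is_deriveD. Qed.

Lemma is_derive_mul f g (x df dg : R) : is_derive x (1 : R) f df ->
  is_derive x (1 : R) g dg -> is_derive x (1 : R) (fun y => f y * g y) (f x * dg + df * g x).
Proof. by move=> Hf Hg; have := is_deriveM Hf Hg; rewrite /GRing.scale /= [g x * _]mulrC. Qed.

(* Smoothness is proved through classes of functions closed under differentiation; this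
   one contains the sums and products. *)
Inductive smooth_alg : (R -> R) -> Prop :=
| SmoothAlgBase f : smooth f -> smooth_alg f
| SmoothAlgAdd f g : smooth_alg f -> smooth_alg g -> smooth_alg (fun x => f x + g x)
| SmoothAlgMul f g : smooth_alg f -> smooth_alg g -> smooth_alg (fun x => f x * g x).

Lemma smooth_alg_smooth f : smooth_alg f -> smooth f.
Proof.
apply: smooth_class => {}f.
suff H : smooth_alg f -> exists2 g, smooth_alg g & forall x : R, is_derive x (1 : R) f (g x).
  move=> /H[g ag fg]; split; first by move=> x; exact: ex_derive.
  by rewrite (derive1_is_derive fg).
elim=> {f} [f sf|f g _ [f' af' Hf] _ [g' ag' Hg]|f g af [f' af' Hf] ag [g' ag' Hg]].
- by exists (derive1 f); [apply: SmoothAlgBase; exact: smooth_derive1|move=> x; exact: smooth_is_derive].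
- exists (fun x => f' x + g' x); first exact: SmoothAlgAdd.
  by move=> x; exact: is_derive_add.
- exists (fun x => f x * g' x + f' x * g x).
    by apply: SmoothAlgAdd; exact: SmoothAlgMul.
  by move=> x; exact: is_derive_mul.
Qed.

Lemma smoothD f g : smooth f -> smooth g -> smooth (fun x => f x + g x).
Proof. by move=> sf sg; apply/smooth_alg_smooth/SmoothAlgAdd; exact: SmoothAlgBase. Qed.

Lemma smoothM f g : smooth f -> smooth g -> smooth (fun x => f x * g x).
Proof. by move=> sf sg; apply/smooth_alg_smooth/SmoothAlgMul; exact: SmoothAlgBase. Qed.

Lemma smooth_cst (k : R) : smooth (fun=> k).
Proof.
apply: (@smooth_class [set f | exists k, f = fun=> k]); last by exists k.
move=> _ [l ->]; split; first by move=> x; exact: ex_derive.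
by exists 0; apply: derive1_is_derive => x; exact: is_derive_cst.
Qed.

Lemma smoothN f : smooth f -> smooth (fun x => - f x).
Proof.
move=> sf; have -> : (fun x => - f x) = fun x => (-1) * f x.
  by apply/funext => x; rewrite mulN1r.
exact: (smoothM (@smooth_cst (-1)) sf).
Qed.

Lemma smoothB f g : smooth f -> smooth g -> smooth (fun x => f x - g x).
Proof. by move=> sf sg; exact: (smoothD sf (smoothN sg)). Qed.

Lemma smooth_continuous f : smooth f -> continuous f.
Proof.
by move=> sf x; apply/differentiable_continuous/derivable1_diffP; exact: smooth_derivable.
Qed.

Lemma is_derive_mulc (b x : R) : is_derive x (1 : R) (fun x : R => b * x) b.
Proof.
have := @is_deriveZ _ _ _ id b x (1 : R) 1 (is_derive_id x (1 : R)).
by rewrite [b *: 1]mulr1.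
Qed.

Lemma is_derive_expM (b x : R) : is_derive x (1 : R) (fun x => expR (b * x)) (b * expR (b * x)).
Proof.
have Hb := is_derive_mulc b x.
rewrite mulrC; exact: (is_derive1_comp (is_derive_expR (b * x)) Hb).
Qed.

Lemma is_derive_cosM (b x : R) : is_derive x (1 : R) (fun x => cos (b * x)) (- b * sin (b * x)).
Proof.
have Hb := is_derive_mulc b x.
have -> : - b * sin (b * x) = (- sin (b * x)) * b by ring.
exact: (is_derive1_comp (is_derive_cos (b * x)) Hb).
Qed.

Lemma is_derive_sinM (b x : R) : is_derive x (1 : R) (fun x => sin (b * x)) (b * cos (b * x)).
Proof.
have Hb := is_derive_mulc b x.
rewrite mulrC; exact: (is_derive1_comp (is_derive_sin (b * x)) Hb).
Qed.

Lemma smooth_expM (b : R) : smooth (fun x => expR (b * x)).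
Proof.
apply: (@smooth_class [set f | exists k : R, f = fun x => k * expR (b * x)]); last first.
  by exists 1; apply/funext => x; rewrite mul1r.
move=> _ [k ->].
have H x : is_derive x (1 : R) (fun x => k * expR (b * x)) (k * b * expR (b * x)).
  have := is_derive_mul (is_derive_cst k x (1 : R)) (is_derive_expM b x).
  by rewrite mul0r addr0 mulrA.
split; first by move=> x; case: (H x).
by exists (k * b); exact: derive1_is_derive.
Qed.

(** The multiples of the cosine alone are not stable under derivation; the span of cosine and sine
    is. *)
Lemma smooth_cos_sin (b k l : R) : smooth (fun x => k * cos (b * x) + l * sin (b * x)).
Proof.
apply: (@smooth_class [set f | exists k l : R, f = fun x => k * cos (b * x) + l * sin (b * x)]); last first.
  by exists k, l.
move=> _ [{}k [{}l ->]].
have H x : is_derive x (1 : R) (fun x => k * cos (b * x) + l * sin (b * x))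
    ((l * b) * cos (b * x) + (- (k * b)) * sin (b * x)).
  have := is_derive_add (is_derive_mul (is_derive_cst k x (1 : R)) (is_derive_cosM b x))
     (is_derive_mul (is_derive_cst l x (1 : R)) (is_derive_sinM b x)).
  rewrite !mul0r !addr0; set e := _ + _; set e' := _ + _.
  by have -> : e = e' by rewrite /e /e' /cst; ring.
split; first by move=> x; case: (H x).
by exists (l * b), (- (k * b)); exact: derive1_is_derive.
Qed.

Lemma smooth_cosM (b : R) : smooth (fun x => cos (b * x)).
Proof.
by have := @smooth_cos_sin b 1 0; congr smooth; apply/funext => x; rewrite mul1r mul0r addr0.
Qed.

Lemma smooth_sinM (b : R) : smooth (fun x => sin (b * x)).
Proof.
by have := @smooth_cos_sin b 0 1; congr smooth; apply/funext => x; rewrite mul1r mul0r add0r.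
Qed.

End Smooth.

(** * Complex-valued smooth functions and the support of test functions *)

Section ComplexSmooth.
Context {R : realType}.
Implicit Types (f g F G phi : R -> R[i]) (c z : R[i]) (a b : R).

Definition cder F f := forall x : R,
  is_derive x (1 : R) (ReF F) (ReF f x) /\ is_derive x (1 : R) (ImF F) (ImF f x).

Lemma cderM F f G g : cder F f -> cder G g ->
  cder (fun x => F x * G x) (fun x => F x * g x + f x * G x).
Proof.
move=> HF HG x; have [r1 i1] := HF x; have [r2 i2] := HG x.
have Nd (p : R -> R) (dp : R) : is_derive x (1 : R) p dp -> is_derive x (1 : R) (fun y => - p y) (- dp).
  by move=> H; exact: is_deriveN.
split.
  have -> : ReF (fun x => F x * G x) = fun x => ReF F x * ReF G x + - (ImF F x * ImF G x).
    by apply/funext => y; rewrite /ReF cReM.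
  have := is_derive_add (is_derive_mul r1 r2) (Nd _ _ (is_derive_mul i1 i2)).
  by congr is_derive; rewrite /ReF !ReImE /ReF /ImF; ring.
have -> : ImF (fun x => F x * G x) = fun x => ReF F x * ImF G x + ImF F x * ReF G x.
  by apply/funext => y; rewrite /ImF cImM.
have := is_derive_add (is_derive_mul r1 i2) (is_derive_mul i1 r2).
by congr is_derive; rewrite /ImF !ReImE /ReF /ImF; ring.
Qed.

Lemma cder_cst c : cder (fun=> c) (fun=> 0).
Proof. by move=> x; split; exact: is_derive_cst. Qed.

Lemma cderZ c F f : cder F f -> cder (fun x => c * F x) (fun x => c * f x).
Proof.
move=> HF; have := cderM (cder_cst c) HF; congr cder; apply/funext => x.
by rewrite mul0r addr0.
Qed.

Lemma cder_cderive F f : cder F f -> cderive F = f.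
Proof.
move=> HF; apply/funext => x; have [r i] := HF x; rewrite /cderive !derive1E.
by rewrite !derive_val; apply: ReIm_eq.
Qed.

Definition csmooth f := smooth (ReF f) /\ smooth (ImF f).

Lemma csmooth_cder f : csmooth f -> cder f (cderive f).
Proof. by move=> [sr si] x; split; exact: smooth_is_derive. Qed.

Lemma csmooth_cderive f : csmooth f -> csmooth (cderive f).
Proof. by move=> [sr si]; split; exact: smooth_derive1. Qed.

Lemma csmoothM f g : csmooth f -> csmooth g -> csmooth (fun x => f x * g x).
Proof.
move=> [rf jf] [rg jg]; split.
  have -> : ReF (fun x => f x * g x) = fun x => ReF f x * ReF g x - ImF f x * ImF g x.
    by apply/funext => y; rewrite /ReF cReM.
  by apply: smoothB; exact: smoothM.
have -> : ImF (fun x => f x * g x) = fun x => ReF f x * ImF g x + ImF f x * ReF g x.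
  by apply/funext => y; rewrite /ImF cImM.
by apply: smoothD; exact: smoothM.
Qed.

Lemma csmooth_cst c : csmooth (fun=> c).
Proof. by split; exact: smooth_cst. Qed.

Lemma csmoothD f g : csmooth f -> csmooth g -> csmooth (fun x => f x + g x).
Proof.
move=> [rf jf] [rg jg]; split.
  by have := smoothD rf rg; congr smooth; apply/funext => x; rewrite /ReF cReD.
by have := smoothD jf jg; congr smooth; apply/funext => x; rewrite /ImF cImD.
Qed.

Lemma csmooth_lincomb c f g : csmooth f -> csmooth g -> csmooth (lincomb c f g).
Proof.
by move=> sf sg; exact: (csmoothD sf (csmoothM (csmooth_cst c) sg)).
Qed.

Lemma csmoothJ f : csmooth f -> csmooth (fun x => (f x)^*%C).
Proof.
move=> [rf jf]; split.
  by have := rf; congr smooth; apply/funext => x; rewrite /ReF cReJ.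
by have := smoothN jf; congr smooth; apply/funext => x; rewrite /ImF cImJ.
Qed.

Lemma csmooth_primitive F f : cder F f -> csmooth f -> csmooth F.
Proof.
by move=> HF [rf jf]; split; apply: smooth_primitive; [move=> x; exact: (HF x).1| |move=> x; exact: (HF x).2|].
Qed.

(** The compact support is replaced by a margin: [b] is the maximum of |x| on the support, and it is
    below [a] because the support lies in the open interval. *)
Lemma testfunP a phi : testfun a phi <->
  csmooth phi /\ exists2 b, b < a & forall x, b < `|x| -> phi x = 0.
Proof.
split=> [[sr si cK Ka]|[[sr si] [b ba phi0]]].
  split=> //; have [K0|/set0P K0] := eqVneq (closure [set x : R | phi x != 0]) set0.
    exists (a - 1); first by rewrite ltrBlDr ltrDl.
    move=> x _; apply/eqP; apply: contrapT => /negP nx.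
    by have := @subset_closure _ [set x : R | phi x != 0] x nx; rewrite K0.
  have [c cin cmax] := @compact_EVT_max _ R (fun x : R => `|x|) _ K0 cK
     (continuous_subspaceT (@norm_continuous _ _)).
  exists `|c|.
    by move: cin; rewrite inE => /Ka; rewrite /= in_itv /= ltr_norml.
  move=> x cx; apply/eqP; apply: contrapT => /negP nx.
  have xK : x \in closure [set x : R | phi x != 0] by rewrite inE; apply: subset_closure.
  by have := cmax x xK; rewrite leNgt cx.
have sub : [set x : R | phi x != 0] `<=` `[- b, b].
  move=> x /= nx; rewrite in_itv /= -ler_norml leNgt; apply/negP => /phi0 p0.
  by rewrite p0 eqxx in nx.
have csub : closure [set x : R | phi x != 0] `<=` `[- b, b].
  rewrite closureE => x; apply; split => //; exact: interval_closed.
split=> //.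
  apply: subclosed_compact csub; first exact: closed_closure.
  exact: segment_compact.
by move=> x /csub /=; rewrite !in_itv /= => /andP[? ?]; apply/andP; split; lra.
Qed.

End ComplexSmooth.

(** * Complex exponentials *)

Section Exponential.
Context {R : realType}.
Implicit Types (w z : R[i]) (x y b : R).

Lemma MVT0 (f df : R -> R) b : (forall x : R, is_derive x (1 : R) f (df x)) ->
  exists2 c, `|c| <= `|b| & f b - f 0 = df c * b.
Proof.
move=> H.
have cf : continuous f.
  by move=> x; apply/differentiable_continuous/derivable1_diffP; case: (H x).
have [b0|b0] := leP 0 b.
  have [c] := @MVT_segment _ f df 0 b b0 (fun x _ => H x) (continuous_subspaceT cf).
  rewrite in_itv /= subr0 => /andP[c0 cb] ->; exists c => //.
  by rewrite !ger0_norm.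
have [c] := @MVT_segment _ f df b 0 (ltW b0) (fun x _ => H x) (continuous_subspaceT cf).
rewrite in_itv /= sub0r => /andP[bc c0] E; exists c.
  by rewrite !ler0_norm ?lerN2// ltW.
by rewrite -opprB E mulrN opprK.
Qed.

Lemma cos_sub1_le b : `|cos b - 1| <= `|b|.
Proof.
have [c _] := @MVT0 cos (fun x => - sin x) b (fun x => is_derive_cos x).
rewrite cos0 => ->; rewrite normrM normrN -[leRHS]mul1r ler_wpM2r//; exact: sin_max.
Qed.

Lemma sin_le b : `|sin b| <= `|b|.
Proof.
have [c _] := @MVT0 sin cos b (fun x => is_derive_sin x).
rewrite sin0 subr0 => ->; rewrite normrM -[leRHS]mul1r ler_wpM2r//; exact: cos_max.
Qed.

Lemma cos_sub1_le2 b : `|cos b - 1| <= b ^+ 2.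
Proof.
have [c cb] := @MVT0 cos (fun x => - sin x) b (fun x => is_derive_cos x).
rewrite cos0 => ->; rewrite normrM normrN -real_normK ?num_real// expr2 ler_wpM2r//.
exact: le_trans (sin_le c) cb.
Qed.

Lemma sin_sub_le2 b : `|sin b - b| <= b ^+ 2.
Proof.
have [c cb] := @MVT0 sin cos b (fun x => is_derive_sin x).
rewrite sin0 subr0 => ->; have -> : cos c * b - b = (cos c - 1) * b by ring.
rewrite normrM -real_normK ?num_real// expr2 ler_wpM2r//.
exact: le_trans (cos_sub1_le c) cb.
Qed.

Lemma expR_sub1_le b : `|expR b - 1| <= `|b| * expR `|b|.
Proof.
have [c cb] := @MVT0 expR expR b (fun x => is_derive_expR x).
rewrite expR0 => ->; rewrite normrM mulrC ler_wpM2l// ger0_norm ?expR_ge0// ler_expR.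
exact: le_trans (ler_norm c) cb.
Qed.

Lemma expR_sub1_le2 b : `|expR b - 1 - b| <= b ^+ 2 * expR `|b|.
Proof.
have [c cb] := @MVT0 expR expR b (fun x => is_derive_expR x).
rewrite expR0 => ->; have -> : expR c * b - b = (expR c - 1) * b by ring.
rewrite normrM -real_normK ?num_real// expr2 [leRHS]mulrAC ler_wpM2r//.
apply: le_trans (expR_sub1_le c) _; rewrite ler_pM ?expR_ge0 ?ler_expR//.
Qed.

Lemma cexpD w z : cexp (w + z) = cexp w * cexp z.
Proof.
rewrite /cexp cReD cImD expRD cosD sinD; apply: ReIm_eq; rewrite !(cReM, cImM) /=; ring.
Qed.

Lemma cexp0 : cexp (0 : R[i]) = 1.
Proof. by rewrite /cexp /= expR0 cos0 sin0; apply: ReIm_eq => /=; ring. Qed.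

Lemma normc_cexp w : normc (cexp w) = expR (complex.Re w).
Proof.
rewrite /cexp normcM /= expr0n /= addr0 sqrtr_sqr ger0_norm ?expR_ge0//.
by rewrite cos2Dsin2 sqrtr1 mulr1.
Qed.

Lemma Re_cexp w : complex.Re (cexp w) = expR (complex.Re w) * cos (complex.Im w).
Proof. by rewrite /cexp cReM /= mul0r subr0. Qed.

Lemma Im_cexp w : complex.Im (cexp w) = expR (complex.Re w) * sin (complex.Im w).
Proof. by rewrite /cexp cImM /= mul0r addr0. Qed.

Lemma expR_Re_le w : expR (complex.Re w) <= expR (normc w).
Proof. by rewrite ler_expR; apply: le_trans (ler_norm _) (ler_Re_normc w). Qed.

Lemma normc_cexp_sub1 w : normc (cexp w - 1) <= 4 * expR (normc w) * normc w.
Proof.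
apply: le_trans (normc_le_ReIm _) _.
rewrite !(cReD, cReN, cImD, cImN) Re_cexp Im_cexp /= oppr0 addr0.
set p := complex.Re w; set q := complex.Im w; set n := normc w.
have pn : `|p| <= n := ler_Re_normc w; have qn : `|q| <= n := ler_Im_normc w.
have e0 := expR_ge0 p; have en : expR p <= expR n := expR_Re_le w.
have n0 : 0 <= n := normc_ge0 w.
have H1 : `|expR p * cos q - 1| <= expR n * n + n * expR n.
  have -> : expR p * cos q - 1 = expR p * (cos q - 1) + (expR p - 1) by ring.
  apply: le_trans (ler_normD _ _) _; apply: lerD.
    rewrite normrM ger0_norm//; apply: ler_pM => //.
    exact: le_trans (cos_sub1_le q) qn.
  by apply: le_trans (expR_sub1_le p) _; rewrite ler_pM ?expR_ge0 ?ler_expR.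
have H2 : `|expR p * sin q| <= expR n * n.
  rewrite normrM ger0_norm//; apply: ler_pM => //.
  exact: le_trans (sin_le q) qn.
have := expR_ge0 n; nra.
Qed.

Lemma normc_cexp_sub2 w : normc (cexp w - 1 - w) <= 4 * expR (normc w) * normc w ^+ 2.
Proof.
apply: le_trans (normc_le_ReIm _) _.
rewrite !(cReD, cReN, cImD, cImN) Re_cexp Im_cexp /= oppr0 addr0.
set p := complex.Re w; set q := complex.Im w; set n := normc w.
have pn : `|p| <= n := ler_Re_normc w; have qn : `|q| <= n := ler_Im_normc w.
have e0 := expR_ge0 p; have en : expR p <= expR n := expR_Re_le w.
have n0 : 0 <= n := normc_ge0 w.
have sq r : `|r| <= n -> r ^+ 2 <= n ^+ 2.
  by move=> h; rewrite -real_normK ?num_real// ler_pXn2r// nnegrE.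
have ep : expR `|p| <= expR n by rewrite ler_expR.
have H1 : `|expR p * cos q - 1 - p| <= expR n * n ^+ 2 + n ^+ 2 * expR n.
  have -> : expR p * cos q - 1 - p = expR p * (cos q - 1) + (expR p - 1 - p) by ring.
  apply: le_trans (ler_normD _ _) _; apply: lerD.
    rewrite normrM ger0_norm//; apply: ler_pM => //.
    exact: le_trans (cos_sub1_le2 q) (sq _ qn).
  apply: le_trans (expR_sub1_le2 p) _; apply: ler_pM; rewrite ?sqr_ge0 ?expR_ge0//.
  exact: sq.
have H2 : `|expR p * sin q - q| <= expR n * n ^+ 2 + n * expR n * n.
  have -> : expR p * sin q - q = expR p * (sin q - q) + (expR p - 1) * q by ring.
  apply: le_trans (ler_normD _ _) _; apply: lerD.
    rewrite normrM ger0_norm//; apply: ler_pM => //.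
    exact: le_trans (sin_sub_le2 q) (sq _ qn).
  rewrite normrM; apply: ler_pM => //.
  apply: le_trans (expR_sub1_le p) _; apply: ler_pM => //; exact: expR_ge0.
have -> : 4 * expR n * n ^+ 2 = (expR n * n ^+ 2 + n ^+ 2 * expR n) + (expR n * n ^+ 2 + n * expR n * n).
  by ring.
exact: lerD.
Qed.

Definition expi z x : R[i] := cexp ('i%C * z * x%:C).

Lemma Re_iz z x : complex.Re ('i%C * z * x%:C) = - complex.Im z * x.
Proof. by case: z => p q /=; ring. Qed.

Lemma Im_iz z x : complex.Im ('i%C * z * x%:C) = complex.Re z * x.
Proof. by case: z => p q /=; ring. Qed.

Lemma normc_iz z x : normc ('i%C * z * x%:C) = normc z * `|x|.
Proof.
have ni : normc ('i%C : R[i]) = 1 by rewrite /= expr0n expr1n add0r sqrtr1.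
by rewrite !normcM ni mul1r; congr (_ * _); rewrite /= expr0n addr0 sqrtr_sqr.
Qed.

Lemma expiD z x y : expi z (x + y) = expi z x * expi z y.
Proof. by rewrite /expi -cexpD rmorphD mulrDr. Qed.

Lemma expi0 z : expi z 0 = 1.
Proof. by rewrite /expi mulr0 cexp0. Qed.

Lemma expiN z x : expi (- z) x = expi z (- x).
Proof. by rewrite /expi rmorphN !mulrN mulNr. Qed.

Lemma expiVr z x : expi z x * expi (- z) x = 1.
Proof. by rewrite expiN -expiD subrr expi0. Qed.

Lemma normc_expi z x : normc (expi z x) = expR (- complex.Im z * x).
Proof. by rewrite normc_cexp Re_iz. Qed.

Lemma normc_expi_le z x y : `|x| <= y -> normc (expi z x) <= expR (normc z * y).
Proof.
move=> xy; rewrite normc_expi ler_expR; apply: le_trans (ler_norm _) _.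
by rewrite normrM normrN ler_pM// ler_Im_normc.
Qed.

Lemma expi_csmooth z : csmooth (expi z).
Proof.
split.
  have -> : ReF (expi z) = fun x => expR (- complex.Im z * x) * cos (complex.Re z * x).
    by apply/funext => x; rewrite /ReF Re_cexp Re_iz Im_iz.
  exact: (smoothM (@smooth_expM _ _) (@smooth_cosM _ _)).
have -> : ImF (expi z) = fun x => expR (- complex.Im z * x) * sin (complex.Re z * x).
  by apply/funext => x; rewrite /ImF Im_cexp Re_iz Im_iz.
exact: (smoothM (@smooth_expM _ _) (@smooth_sinM _ _)).
Qed.

Lemma Re_imul z w : complex.Re ('i%C * z * w) =
  - complex.Im z * complex.Re w - complex.Re z * complex.Im w.
Proof. by case: z w => p q [r s] /=; ring. Qed.

Lemma Im_imul z w : complex.Im ('i%C * z * w) =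
  - complex.Im z * complex.Im w + complex.Re z * complex.Re w.
Proof. by case: z w => p q [r s] /=; ring. Qed.

Lemma expi_cder z : cder (expi z) (fun x => 'i%C * z * expi z x).
Proof.
have E1 : ReF (expi z) = fun x => expR (- complex.Im z * x) * cos (complex.Re z * x).
  by apply/funext => x; rewrite /ReF Re_cexp Re_iz Im_iz.
have E2 : ImF (expi z) = fun x => expR (- complex.Im z * x) * sin (complex.Re z * x).
  by apply/funext => x; rewrite /ImF Im_cexp Re_iz Im_iz.
move=> x; split.
  have -> : ReF (fun x => 'i%C * z * expi z x) x =
      - complex.Im z * ReF (expi z) x - complex.Re z * ImF (expi z) x.
    exact: Re_imul.
  rewrite E1 E2.
  have := is_derive_mul (is_derive_expM (- complex.Im z) x) (is_derive_cosM (complex.Re z) x).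
  by congr is_derive; ring.
have -> : ImF (fun x => 'i%C * z * expi z x) x =
    - complex.Im z * ImF (expi z) x + complex.Re z * ReF (expi z) x.
  exact: Im_imul.
rewrite E1 E2.
have := is_derive_mul (is_derive_expM (- complex.Im z) x) (is_derive_sinM (complex.Re z) x).
by congr is_derive; ring.
Qed.

Lemma csmooth_measurable (f : R -> R[i]) : csmooth f ->
  measurable_fun [set: R] (ReF f) /\ measurable_fun [set: R] (ImF f).
Proof.
by move=> [sr si]; split; apply: continuous_measurable_fun; exact: smooth_continuous.
Qed.

End Exponential.

(** * Solving [i v' - z v = g] *)

Section Holder.
Context {R : realType}.
Implicit Types (u v : R -> R[i]) (a x y : R).

Lemma bounded_sqi u (p q K : R) : p <= q ->
  measurable_fun [set: R] (ReF u) -> measurable_fun [set: R] (ImF u) ->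
  (forall t, normc (u t) <= K * \1_(`[p, q] : set R) t) ->
  sqi u /\ normL2 u ^+ 2 <= K ^+ 2 * (q - p).
Proof.
move=> pq mr mi le.
have le2 t : ReF u t ^+ 2 + ImF u t ^+ 2 <= K ^+ 2 * \1_(`[p, q] : set R) t.
  rewrite -normc_sq; have := le t; have := normc_ge0 (u t).
  by rewrite indicE; case: (t \in _); rewrite /= ?mulr1 ?mulr0; nra.
have ib := rint_box p q (K ^+ 2).
have sr : rsq (ReF u).
  split=> //; apply: rint_le ib => //; first exact: measurable_funX.
  move=> t _; rewrite ger0_norm ?sqr_ge0//; apply: le_trans (le2 t).
  by rewrite lerDl sqr_ge0.
have si : rsq (ImF u).
  split=> //; apply: rint_le ib => //; first exact: measurable_funX.
  move=> t _; rewrite ger0_norm ?sqr_ge0//; apply: le_trans (le2 t).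
  by rewrite lerDr sqr_ge0.
split=> //; rewrite normL2_sq// Re_ipL2 -Rintegral_box//.
by apply: le_Rintegral => //; apply: rintD => //; [case: sr|case: si].
Qed.

Lemma weight_ge x : 0 < x -> (x <= 1 -> x <= 3 * (1 - expR (- x / 2))) /\
  (1 <= x -> 1 <= 3 * (1 - expR (- x / 2))).
Proof.
move=> x0; set s := expR (- x / 2).
have s0 : 0 < s by exact: expR_gt0.
have H : s * (1 + x / 2) <= 1.
  have e : s * expR (x / 2) = 1 by rewrite /s -expRD -(expR0 R); congr expR; lra.
  by rewrite -[leRHS]e ler_wpM2l ?(ltW s0)// expR_ge1Dx.
by split => hx; nra.
Qed.

(* For a Hoelder-1/2 function [nu u x] is [O(x)], which cancels the singularity of
   [arch_kernel] at [0]. *)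
Lemma weil_dom_holder a u (H : R) : 0 < a -> L2 a u -> 0 <= H ->
  (forall x y, `|x - y| <= 1 -> normc (u x - u y) ^+ 2 <= H * `|x - y|) ->
  weil_dom a u /\ arch_energy u <= 3 * ((2 * a + 1) * H + 4 * normL2 u ^+ 2) * arch_const.
Proof.
move=> a0 Lu H0 hol; have su := L2_sqi Lu.
set K := 3 * ((2 * a + 1) * H + 4 * normL2 u ^+ 2).
have n0 := sqr_ge0 (normL2 u).
have ah : 0 <= (2 * a + 1) * H by rewrite mulr_ge0//; lra.
have nub x : 0 < x -> nu u x <= K * (1 - expR (- x / 2)).
  move=> x0; have [w1 w2] := weight_ge x0.
  have [x1|x1] := leP x 1; last first.
    have := w2 (ltW x1); have := nu_le x su; rewrite /K; set s := expR _; nra.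
  have : nu u x <= (2 * a + 1) * (H * x).
    have sd : sqi (u \- tau x u) := semi_ipB (@ipL2_semi R) su (tau_sqi x su).
    have [[mr _] [mi _]] := sd.
    pose L := Num.sqrt (H * x).
    have LL : L ^+ 2 = H * x by rewrite sqr_sqrtr// mulr_ge0// ltW.
    have aa : - a <= a + 1 by lra.
    have bd t : normc ((u \- tau x u) t) <= L * \1_(`[- a, a + 1] : set R) t.
      have [/= tA|tA] := boolP (t \in `[- a, a + 1]).
        rewrite indicE mem_set //= mulr1 -(@ler_pXn2r _ 2)// ?nnegrE ?normc_ge0 ?sqrtr_ge0//.
        rewrite LL; have e : `|t - (t - x)| = x by rewrite opprB addrC subrK gtr0_norm.
        by have := hol t (t - x); rewrite e; apply.
      rewrite /= /tau; case: Lu => _ _ _ u0.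
      rewrite !u0 ?subrr ?normc0; first by rewrite mulr_ge0 ?sqrtr_ge0// indicE ler0n.
      - apply/negP => /= h; move/negP: tA; apply; move: h; rewrite !in_itv /=.
        by move=> /andP[h1 h2]; apply/andP; split; lra.
      - apply/negP => /= h; move/negP: tA; apply; move: h; rewrite !in_itv /=.
        by move=> /andP[h1 h2]; apply/andP; split; lra.
    have [_] := bounded_sqi aa mr mi bd; rewrite LL normL2_sq// /nu /delta.
    by move/le_trans; apply; rewrite mulrC; apply: ler_wpM2r; [rewrite mulr_ge0// ltW|lra].
  have := w1 x1; set s := expR _ => h1 h2.
  have : (2 * a + 1) * (H * x) <= (2 * a + 1) * H * (3 * (1 - s)).
    by rewrite mulrA ler_wpM2l.
  have s1 : 0 <= 1 - s by lra.
  have : 0 <= 4 * normL2 u ^+ 2 * (3 * (1 - s)) by apply: mulr_ge0; apply: mulr_ge0.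
  rewrite /K; lra.
have key x : 0 < x -> nu u x * arch_kernel x <= K * arch_weight x.
  by move=> x0; rewrite /arch_weight [leRHS]mulrA; apply: ler_wpM2r; [exact: ltW (arch_kernel_gt0 x0)|exact: nub].
have im := rintZ K (measurable_itv _) (@rint_arch_weight R).
have I : rint `]0, +oo[ (fun x => nu u x * arch_kernel x).
  apply: rint_le im => //; first exact: nu_arch_measurable.
  move=> x /ray_gt0 x0; rewrite ger0_norm; first exact: key.
  by rewrite mulr_ge0 ?nu_ge0// ltW// arch_kernel_gt0.
split; first by split.
rewrite /arch_energy /arch_const -RintegralZl//; last exact: rint_arch_weight.
by apply: le_Rintegral => // x /ray_gt0; exact: key.
Qed.

Lemma holder_measurable u (H : R) : 0 <= H ->
  (forall x y, `|x - y| <= 1 -> normc (u x - u y) ^+ 2 <= H * `|x - y|) ->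
  measurable_fun [set: R] (ReF u) /\ measurable_fun [set: R] (ImF u).
Proof.
move=> H0 hol.
have C (p : R -> R) : (forall x y, `|p x - p y| <= normc (u x - u y)) -> continuous p.
  move=> hp x; apply/cvgrPdist_le => /= e e0.
  near=> t; have xt : `|x - t| <= Num.min 1 (e ^+ 2 / (H + 1)).
    near: t; exists (Num.min 1 (e ^+ 2 / (H + 1))) => /=; last by move=> t /= /ltW.
    by rewrite lt_min ltr01 divr_gt0 ?exprn_gt0//; lra.
  move: xt; rewrite le_min => /andP[x1 x2].
  apply: le_trans (hp x t) _; rewrite -(@ler_pXn2r _ 2)// ?nnegrE ?normc_ge0 ?(ltW e0)//.
  apply: le_trans (hol x t x1) _; move: x2; rewrite ler_pdivlMr; last by lra.
  by have := normr_ge0 (x - t); nra.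
split; apply: continuous_measurable_fun; apply: C => x y.
  by rewrite /ReF -cReN -cReD; exact: ler_Re_normc.
by rewrite /ImF -cImN -cImD; exact: ler_Im_normc.
Unshelve. all: by end_near. Qed.

End Holder.

Section Primitive.
Context {R : realType}.
Implicit Types (g h phi : R -> R[i]) (z c : R[i]) (a x y : R).

Definition fprim z g x : R[i] := cintegral `]-oo, x] (fun t => g t * expi z t).
(* The vector that represents the functional [g |-> fprim z g x] on [L^2(-a,a)]. *)
Definition expi_trunc a z x : R -> R[i] :=
  fun t => if (- a <= t <= a) && (t <= x) then (expi z t)^*%C else 0.
Definition expi_bound a z : R := expR (normc z * a).

Lemma itv_dec a x (t : R) : (- a <= t <= a) && (t <= x) = (t \in `[- a, a] `&` `]-oo, x]).
Proof.
by apply/idP/idP; rewrite inE /= !in_itv /=; [move=> /andP[-> ->]|move=> [-> ->]].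
Qed.

Lemma expi_trunc_sqi a z x : 0 < a -> sqi (expi_trunc a z x).
Proof.
move=> a0; have [mr mi] := csmooth_measurable (csmoothJ (expi_csmooth z)).
have mD : measurable (`[- a, a] `&` `]-oo, x] : set R) by apply: measurableI.
have mI : measurable_fun [set: R] (\1_(`[- a, a] `&` `]-oo, x]) : R -> R).
  exact: measurable_indic.
have aa : - a <= a by lra.
apply: (bounded_sqi (K := expi_bound a z) aa _ _ _).1.
- have -> : ReF (expi_trunc a z x) = fun t => ReF (fun x => (expi z x)^*%C) t * \1_(`[- a, a] `&` `]-oo, x]) t.
    apply/funext => t; rewrite /ReF /expi_trunc itv_dec indicE.
    by case: ifP => _; rewrite ?mulr1 ?mulr0.
  exact: measurable_funM.
- have -> : ImF (expi_trunc a z x) = fun t => ImF (fun x => (expi z x)^*%C) t * \1_(`[- a, a] `&` `]-oo, x]) t.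
    apply/funext => t; rewrite /ImF /expi_trunc itv_dec indicE.
    by case: ifP => _; rewrite ?mulr1 ?mulr0.
  exact: measurable_funM.
- move=> t; rewrite /expi_trunc indicE; case: ifP => [/andP[ta _]|_]; last first.
    by rewrite normc0 mulr_ge0 ?expR_ge0.
  rewrite mem_set ?mulr1 ?normcJ; last by rewrite /= in_itv.
  by apply: normc_expi_le; rewrite ler_norml.
Qed.

Lemma fprim_ip a z g x : L2 a g -> fprim z g x = ipL2 g (expi_trunc a z x).
Proof.
move=> [_ _ _ g0]; rewrite /fprim cintegral_mkcond /ipL2; congr cintegral; apply/funext => t.
rewrite /expi_trunc; have [ta|ta] := boolP (- a <= t <= a); last first.
  rewrite andFb conjc0 mulr0; case: ifP => // _; rewrite g0 ?mul0r//.
  apply/negP; rewrite in_itv /= => /andP[h1 h2]; move/negP: ta; apply.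
  by apply/andP; split; lra.
rewrite andTb; have -> : (t \in (`]-oo, x]%classic : set R)) = (t <= x).
  by apply/idP/idP; rewrite inE /= in_itv.
by case: ifP; rewrite ?conjcK// conjc0 mulr0.
Qed.

Lemma fprim_lincomb a z c g h x : 0 < a -> L2 a g -> L2 a h ->
  fprim z (lincomb c g h) x = fprim z g x + c * fprim z h x.
Proof.
move=> a0 Lg Lh; rewrite !(@fprim_ip a)//; last exact: L2_lincomb.
apply: (semi_ip_linl ipL2_semi); try exact: (@L2_sqi _ a).
exact: expi_trunc_sqi.
Qed.

Lemma fprim_holder a z g x y : 0 < a -> L2 a g -> x <= y ->
  normc (fprim z g y - fprim z g x) ^+ 2 <= expi_bound a z ^+ 2 * (y - x) * normL2 g ^+ 2.
Proof.
move=> a0 Lg xy; have S := @ipL2_semi R; have sg := L2_sqi Lg.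
rewrite !(@fprim_ip a)// -(semi_ipBr S)//; try exact: expi_trunc_sqi.
have sB : sqi (expi_trunc a z y \- expi_trunc a z x) by apply: (semi_ipB S); exact: expi_trunc_sqi.
have [[mr _] [mi _]] := sB.
have [|_ B] := bounded_sqi (K := expi_bound a z) xy mr mi.
  move=> t; have -> : (expi_trunc a z y \- expi_trunc a z x) t = expi_trunc a z y t - expi_trunc a z x t by [].
  rewrite /expi_trunc indicE; have : - a <= t <= a -> normc (expi z t)^*%C <= expi_bound a z.
    by rewrite normcJ => ta; apply: normc_expi_le; rewrite ler_norml.
  move: ((expi z t)^*%C) => E.
  have [ta /(_ isT) eb|_ _] := boolP (- a <= t <= a); last first.
    by rewrite !andFb subrr normc0 mulr_ge0 ?expR_ge0.
  rewrite !andTb.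
  have [ty|ty] := leP t y; have [tx|tx] := leP t x.
  - by rewrite subrr normc0 mulr_ge0 ?expR_ge0.
  - by rewrite subr0 mem_set ?mulr1//= in_itv /= (ltW tx) ty.
  - by exfalso; lra.
  - by rewrite subrr normc0 mulr_ge0 ?expR_ge0.
have := semi_ip_CS S sg sB; rewrite -/(normL2 g) -/(normL2 (expi_trunc a z y \- expi_trunc a z x)) => CS.
have n0 := normL2_ge0 g; have h0 := normL2_ge0 (expi_trunc a z y \- expi_trunc a z x).
apply: (@le_trans _ _ ((normL2 g * normL2 (expi_trunc a z y \- expi_trunc a z x)) ^+ 2)).
  by rewrite ler_pXn2r// nnegrE ?normc_ge0// mulr_ge0.
by rewrite exprMn mulrC ler_wpM2r// sqr_ge0.
Qed.

Lemma fprim_zero z g x : (forall t, t <= x -> g t = 0) -> fprim z g x = 0.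
Proof.
move=> g0; rewrite /fprim cintegral_mkcond -[RHS](cintegral0 setT); congr cintegral.
apply/funext => t; case: ifP => //; rewrite inE /= in_itv /= => tx.
by rewrite g0// mul0r.
Qed.

Lemma fprim_eq z g x y : (forall t, x < t -> g t = 0) -> (forall t, y < t -> g t = 0) ->
  fprim z g x = fprim z g y.
Proof.
move=> gx gy.
have H s : (forall t, s < t -> g t = 0) -> fprim z g s = cintegral setT (fun t => g t * expi z t).
  move=> gs; rewrite /fprim cintegral_mkcond; congr cintegral; apply/funext => t.
  case: ifP => // /negP; rewrite inE /= in_itv /= => /negP; rewrite -ltNge => /gs ->.
  by rewrite mul0r.
by rewrite !H.
Qed.

Lemma L2_left a g : L2 a g -> forall t, t <= - a -> g t = 0.
Proof. by move=> [_ _ _ g0] t ta; apply: g0; rewrite in_itv /= ltNge ta. Qed.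

Lemma L2_right a g : L2 a g -> forall t, a <= t -> g t = 0.
Proof. by move=> [_ _ _ g0] t ta; apply: g0; rewrite in_itv /= [t < a]ltNge ta andbF. Qed.

Lemma fprim_out a z g x : L2 a g -> fprim z g a = 0 -> a <= `|x| -> fprim z g x = 0.
Proof.
move=> Lg P0 ax; have [x0|x0] := leP 0 x.
  rewrite ger0_norm// in ax; rewrite -P0; apply: fprim_eq => t h; apply: (L2_right Lg); lra.
rewrite ler0_norm ?(ltW x0)// in ax; apply: fprim_zero => t tx; apply: (L2_left Lg); lra.
Qed.

Lemma fprim_bound a z g x : 0 < a -> L2 a g -> fprim z g a = 0 ->
  normc (fprim z g x) ^+ 2 <= expi_bound a z ^+ 2 * (2 * a) * normL2 g ^+ 2.
Proof.
move=> a0 Lg P0.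
have nn : 0 <= expi_bound a z ^+ 2 * (2 * a) * normL2 g ^+ 2.
  by apply: mulr_ge0; [apply: mulr_ge0; [exact: sqr_ge0|lra]|exact: sqr_ge0].
have [xa|xa] := leP a `|x|; first by rewrite (fprim_out Lg P0 xa) normc0 expr0n.
move: xa; rewrite ltr_norml => /andP[h1 h2].
have Pa : fprim z g (- a) = 0 by apply: fprim_zero; exact: L2_left Lg.
rewrite -[fprim z g x]subr0 -Pa; apply: le_trans (fprim_holder z a0 Lg (ltW h1)) _.
by rewrite ler_wpM2r ?sqr_ge0// ler_wpM2l ?sqr_ge0//; lra.
Qed.

Definition resolvent z g x : R[i] := - 'i%C * expi (- z) x * fprim z g x.

Lemma resolvent_lincomb a z c g h : 0 < a -> L2 a g -> L2 a h ->
  resolvent z (lincomb c g h) = lincomb c (resolvent z g) (resolvent z h).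
Proof.
move=> a0 Lg Lh; apply/funext => x; rewrite /resolvent (@fprim_lincomb a)// /lincomb; ring.
Qed.

Lemma normcNi : normc (- 'i%C : R[i]) = 1.
Proof. by rewrite /= oppr0 sqrrN expr0n expr1n add0r sqrtr1. Qed.

Lemma resolvent_holder a z : 0 < a -> exists2 C : R, 0 <= C & forall g,
  L2 a g -> fprim z g a = 0 -> forall x y, `|x - y| <= 1 ->
  normc (resolvent z g x - resolvent z g y) ^+ 2 <= C * normL2 g ^+ 2 * `|x - y|.
Proof.
move=> a0; pose M := expi_bound a z; pose M1 := expR (normc z * (a + 1)).
pose L := 4 * expR (normc z) * normc z.
have z0 := normc_ge0 z.
have L0 : 0 <= L by rewrite !mulr_ge0 ?expR_ge0.
have M0 : 0 <= M by exact: expR_ge0.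
have M10 : 0 <= M1 by exact: expR_ge0.
pose C := 2 * M1 ^+ 2 * M ^+ 2 * (1 + 2 * a * L ^+ 2).
have C0 : 0 <= C by rewrite !mulr_ge0 ?sqr_ge0// addr_ge0// !mulr_ge0 ?sqr_ge0// ltW.
exists C => // g Lg P0.
suff W x y : x <= y -> `|x - y| <= 1 ->
    normc (resolvent z g x - resolvent z g y) ^+ 2 <= C * normL2 g ^+ 2 * `|x - y|.
  move=> x y; have [xy|/ltW xy] := leP x y; first exact: W.
  by rewrite distrC -[resolvent z g x - _]opprB normcN; exact: W.
move=> xy d1.
have n0 := sqr_ge0 (normL2 g).
have [xa|xa] := ltP (a + 1) `|x|.
  have ya : a <= `|y|.
    have := ler_distD 0 x y; have := lerB_dist x y.
    have := ler_normB x (x - y); rewrite opprB addrC subrK; lra.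
  rewrite /resolvent (fprim_out Lg P0 ya) (fprim_out Lg P0); last by lra.
  by rewrite !mulr0 subrr normc0 expr0n /=; apply: mulr_ge0 => //; exact: mulr_ge0.
have [ya|ya] := ltP (a + 1) `|y|.
  have xa' : a <= `|x|.
    have := lerB_dist y x; rewrite distrC; lra.
  rewrite /resolvent (fprim_out Lg P0 xa') (fprim_out Lg P0); last by lra.
  by rewrite !mulr0 subrr normc0 expr0n /=; apply: mulr_ge0 => //; exact: mulr_ge0.
set d := `|x - y| in d1 *; have d0 : 0 <= d by exact: normr_ge0.
have -> : resolvent z g x - resolvent z g y =
    - 'i%C * (expi (- z) x * (fprim z g x - fprim z g y) + expi (- z) y * (expi (- z) (x - y) - 1) * fprim z g y).
  have -> : expi (- z) x = expi (- z) y * expi (- z) (x - y) by rewrite -expiD; congr expi; ring.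
  by rewrite /resolvent (_ : expi (- z) x = expi (- z) y * expi (- z) (x - y));
    [move: (expi (- z) y) (expi (- z) (x - y)) => e f; ring|rewrite -expiD; congr expi; ring].
rewrite normcM normcNi mul1r.
set P := fprim z g x - fprim z g y; set Q := fprim z g y.
have hP : normc P ^+ 2 <= M ^+ 2 * d * normL2 g ^+ 2.
  rewrite /P -normcN opprB /d distrC ger0_norm ?subr_ge0//; exact: fprim_holder.
have hQ : normc Q ^+ 2 <= M ^+ 2 * (2 * a) * normL2 g ^+ 2 by exact: fprim_bound.
have e1 : normc (expi (- z) x) <= M1 by rewrite expiN; apply: normc_expi_le; rewrite normrN.
have e2 : normc (expi (- z) y) <= M1 by rewrite expiN; apply: normc_expi_le; rewrite normrN.
have e3 : normc (expi (- z) (x - y) - 1) <= L * d.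
  rewrite expiN opprB; apply: le_trans (normc_cexp_sub1 _) _; rewrite normc_iz distrC -/d.
  rewrite /L -!mulrA ler_wpM2l// ler_wpM2r ?mulr_ge0// ler_expR.
  by rewrite -[leRHS]mulr1 ler_wpM2l.
set A := expi (- z) x * P; set B := _ * Q.
have hA : normc A <= M1 * normc P by rewrite normcM ler_wpM2r ?normc_ge0.
have hB : normc B <= M1 * (L * d) * normc Q.
  by rewrite normcM ler_wpM2r ?normc_ge0// normcM ler_pM ?normc_ge0.
have hAB : normc (A + B) <= M1 * normc P + M1 * (L * d) * normc Q.
  by apply: le_trans (le_normcD _ _) _; exact: lerD.
set p := normc P in hP hAB *; set q := normc Q in hQ hAB *.
apply: (@le_trans _ _ (2 * M1 ^+ 2 * p ^+ 2 + 2 * M1 ^+ 2 * L ^+ 2 * d ^+ 2 * q ^+ 2)).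
  have : normc (A + B) ^+ 2 <= (M1 * p + M1 * (L * d) * q) ^+ 2.
    rewrite ler_pXn2r// nnegrE ?normc_ge0// addr_ge0// !mulr_ge0// ?normc_ge0//.
  move/le_trans; apply.
  have := sqr_ge0 (M1 * p - M1 * (L * d) * q).
  rewrite -subr_ge0 => h; rewrite -subr_ge0; apply: le_trans h _.
  by rewrite subr0 le_eqVlt; apply/orP; left; apply/eqP; ring.
have -> : C * normL2 g ^+ 2 * d = 2 * M1 ^+ 2 * (M ^+ 2 * d * normL2 g ^+ 2)
   + 2 * M1 ^+ 2 * L ^+ 2 * d * (M ^+ 2 * (2 * a) * normL2 g ^+ 2) by rewrite /C; ring.
apply: lerD; first by rewrite ler_wpM2l// !mulr_ge0// sqr_ge0.
have T0 : 0 <= 2 * M1 ^+ 2 * L ^+ 2.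
  by apply: mulr_ge0; [apply: mulr_ge0 => //; exact: sqr_ge0|exact: sqr_ge0].
apply: ler_pM; [by apply: mulr_ge0 => //; exact: sqr_ge0|exact: sqr_ge0| |exact: hQ].
apply: ler_wpM2l => //.
by rewrite expr2 -[leRHS]mulr1 ler_wpM2l.
Qed.

Lemma resolvent_bounds a z : 0 < a -> exists2 C : R, 0 <= C & forall g,
  L2 a g -> fprim z g a = 0 -> [/\ weil_dom a (resolvent z g), normL2 (resolvent z g) <= C * normL2 g &
    arch_energy (resolvent z g) <= C * normL2 g ^+ 2].
Proof.
move=> a0; have [H H0 hol] := resolvent_holder z a0.
pose M := expi_bound a z; have M0 : 0 <= M by exact: expR_ge0.
pose D := M ^+ 2 * (2 * a); have D0 : 0 <= D by rewrite /D !mulr_ge0 ?sqr_ge0// ltW.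
have K0 : 0 <= arch_const :> R.
  by apply: Rintegral_ge0 => x /ray_gt0 x0; have /andP[] := arch_weight_bound x0.
pose C2 := 3 * ((2 * a + 1) * H + 4 * D ^+ 2) * arch_const.
have C20 : 0 <= C2.
  by rewrite !mulr_ge0// addr_ge0// mulr_ge0 ?sqr_ge0//; lra.
exists (D + C2); first by rewrite addr_ge0.
move=> g Lg P0; have n0 := normL2_ge0 g.
have Hg0 : 0 <= H * normL2 g ^+ 2 by rewrite mulr_ge0 ?sqr_ge0.
have [mr mi] := holder_measurable Hg0 (hol g Lg P0).
pose K := Num.sqrt D * normL2 g * M.
have K'0 : 0 <= K by rewrite !mulr_ge0 ?sqrtr_ge0.
have bd t : normc (resolvent z g t) <= K * \1_(`[- a, a] : set R) t.
  have [ta|ta] := leP `|t| a; last first.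
    by rewrite /resolvent (fprim_out Lg P0 (ltW ta)) mulr0 normc0 mulr_ge0// indicE ler0n.
  rewrite indicE mem_set; last by rewrite /= in_itv /= -ler_norml.
  rewrite mulr1 /resolvent normcM (normcM (- 'i%C)) normcNi mul1r mulrC.
  apply: ler_pM; rewrite ?normc_ge0//; last by rewrite expiN; apply: normc_expi_le; rewrite normrN.
  rewrite -(@ler_pXn2r _ 2)// ?nnegrE ?normc_ge0 ?mulr_ge0 ?sqrtr_ge0//.
  by rewrite exprMn (sqr_sqrtr D0) /D; exact: fprim_bound.
have aa : - a <= a by lra.
have [sS] := bounded_sqi aa mr mi bd.
have -> : K ^+ 2 * (a - - a) = (D * normL2 g) ^+ 2.
  by rewrite /K !exprMn sqr_sqrtr// /D; ring.
move=> nS.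
have LS : L2 a (resolvent z g).
  apply: sqi_L2 => // x xa; rewrite /resolvent (fprim_out Lg P0) ?mulr0//.
  rewrite leNgt; apply/negP; rewrite ltr_norml => h; by rewrite in_itv /= h in xa.
have [FS BS] := weil_dom_holder a0 LS Hg0 (hol g Lg P0).
split=> //.
  have Dn : 0 <= D * normL2 g by exact: mulr_ge0.
  have h : normL2 (resolvent z g) <= D * normL2 g.
    by rewrite -(@ler_pXn2r _ 2)// nnegrE normL2_ge0.
  by apply: le_trans h _; rewrite ler_wpM2r// lerDl.
apply: le_trans BS _; rewrite [leRHS]mulrDl.
have : 3 * ((2 * a + 1) * (H * normL2 g ^+ 2) + 4 * normL2 (resolvent z g) ^+ 2) * arch_const <= C2 * normL2 g ^+ 2.
  have -> : C2 * normL2 g ^+ 2 = 3 * ((2 * a + 1) * (H * normL2 g ^+ 2) + 4 * (D * normL2 g) ^+ 2) * arch_const.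
    by rewrite /C2; ring.
  by rewrite ler_wpM2r// ler_wpM2l// lerD2l ler_wpM2l.
move/le_trans; apply; rewrite lerDr mulr_ge0 ?sqr_ge0//.
Qed.

Lemma testfun_csmooth a phi : testfun a phi -> csmooth phi.
Proof. by move=> /testfunP[]. Qed.

Lemma testfun_lincomb a c phi psi : testfun a phi -> testfun a psi -> testfun a (lincomb c phi psi).
Proof.
move=> /testfunP[s1 [b1 ba1 z1]] /testfunP[s2 [b2 ba2 z2]]; apply/testfunP; split.
  exact: csmooth_lincomb.
exists (Num.max b1 b2); first by rewrite gt_max ba1.
by move=> x; rewrite gt_max => /andP[h1 h2]; rewrite /lincomb z1// z2// mulr0 addr0.
Qed.

Lemma testfun_mul a phi f : testfun a phi -> csmooth f -> testfun a (fun x => phi x * f x).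
Proof.
move=> /testfunP[s1 [b ba z0]] sf; apply/testfunP; split; first exact: csmoothM.
by exists b => // x bx; rewrite z0// mul0r.
Qed.

Lemma cderive_out phi (b : R) : (forall x, b < `|x| -> phi x = 0) ->
  forall x, b < `|x| -> cderive phi x = 0.
Proof.
move=> z0 x bx.
have N : \forall y \near x, b < `|y|.
  have O : open [set y : R | b < `|y|].
    have -> : [set y : R | b < `|y|] = (fun y : R => `|y|) @^-1` [set t | b < t] by [].
    by apply: open_comp; [move=> y _; exact: norm_continuous|exact: open_gt].
  exact: (open_nbhs_nbhs (conj O bx)).
have D0 (p : R -> R) : (forall y, b < `|y| -> p y = 0) -> derive1 p x = 0.
  move=> p0; rewrite derive1E (@near_eq_derive _ _ _ p (cst 0)) ?derive_cst//.
  by apply: filterS N => y /p0.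
by rewrite /cderive !D0// => y /z0; rewrite /ReF /ImF => ->.
Qed.

Lemma testfun_cderive a phi : testfun a phi -> testfun a (cderive phi).
Proof.
move=> /testfunP[s1 [b ba z0]]; apply/testfunP; split; first exact: csmooth_cderive.
by exists b => //; exact: cderive_out.
Qed.

Lemma testfun_L2 a phi : testfun a phi -> L2 a phi.
Proof.
move=> /testfunP[[sr si] [b ba z0]].
have [mr mi] := csmooth_measurable (conj sr si).
have H (p : R -> R) : smooth p -> (forall x, b < `|x| -> p x = 0) ->
    rint setT (fun x => p x ^+ 2).
  move=> sp p0.
  have I : mu.-integrable `[- b, b] (EFin \o (fun x => p x ^+ 2)).
    apply: continuous_compact_integrable; first exact: segment_compact.
    apply: continuous_subspaceT => x; apply: (@cvgM _ _ _ _ p p).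
    - exact: smooth_continuous.
    - exact: smooth_continuous.
  have mb : measurable (`[- b, b] : set R) by [].
  have := proj1 (@integrable_mkcond _ (measurableTypeR R) R lebesgue_measure
    `[- b, b]%classic (EFin \o (fun x => p x ^+ 2)) mb) I.
  rewrite /rint; congr (is_true (mu.-integrable _ _)); apply/funext => x.
  rewrite patchE; case: ifPn => // xb; rewrite /= p0 ?expr0n//.
  rewrite ltNge; apply/negP => h; move/negP: xb; apply; rewrite inE /= in_itv /=.
  by rewrite -ler_norml.
apply: sqi_L2.
  split; split=> //; apply: H => // x /z0; rewrite /ReF /ImF => -> //.
move=> x; rewrite in_itv /= -ltr_norml -leNgt => ax; apply: z0; exact: lt_le_trans ba ax.
Qed.

Lemma cintegral_FTC2 F f (p q : R) : p < q -> cder F f -> csmooth f ->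
  cintegral `[p, q] f = F q - F p.
Proof.
move=> pq HF [sr si].
have H (P h : R -> R) : (forall x : R, is_derive x (1 : R) P (h x)) -> smooth h ->
    \int[mu]_(x in `[p, q]) h x = P q - P p.
  move=> HP sh; rewrite /Rintegral (continuous_FTC2 (F := P) pq)//.
  - by apply: continuous_subspaceT; exact: smooth_continuous.
  - have cP : continuous P.
      by move=> x; apply/differentiable_continuous/derivable1_diffP; case: (HP x).
    split; first by move=> x _; case: (HP x).
      exact: (cvg_at_right_filter (cP p)).
    exact: (cvg_at_left_filter (cP q)).
  - by move=> x _; rewrite (derive1_is_derive HP).
apply: ReIm_eq; rewrite !(cReD, cReN, cImD, cImN) /=.
  by apply: (H (ReF F)) => // x; case: (HF x).
by apply: (H (ImF F)) => // x; case: (HF x).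
Qed.

Definition shiftD z phi x : R[i] := 'i%C * cderive phi x - z * phi x.

Lemma testfun_shiftD a z phi : testfun a phi -> testfun a (shiftD z phi).
Proof.
move=> tp; have td := testfun_cderive tp.
have t0 : testfun a (fun x => 'i%C * cderive phi x).
  have := testfun_mul td (csmooth_cst 'i%C); congr testfun.
  by apply/funext => x; rewrite mulrC.
have := testfun_lincomb (- z) t0 tp; congr testfun.
by apply/funext => x; rewrite /lincomb /shiftD mulNr.
Qed.

Lemma fprim_shiftD a z phi x : testfun a phi -> fprim z (shiftD z phi) x = 'i%C * phi x * expi z x.
Proof.
move=> tp; have Lp := testfun_L2 tp; have Ls := testfun_L2 (testfun_shiftD z tp).
have [xa|xa] := leP x (- a).
  rewrite (L2_left Lp xa) mulr0 mul0r; apply: fprim_zero => t tx; apply: (L2_left Ls); lra.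
have -> : fprim z (shiftD z phi) x = cintegral `[- a, x] (fun t => shiftD z phi t * expi z t).
  rewrite /fprim cintegral_mkcond [RHS]cintegral_mkcond; congr cintegral; apply/funext => t.
  have -> : (t \in (`[- a, x]%classic : set R)) = (- a <= t) && (t \in (`]-oo, x]%classic : set R)).
    apply/idP/andP => [|[h1]]; rewrite !inE /= !in_itv /=; first by move=> /andP.
    by rewrite h1.
  case: ifP => //= h; case: (leP (- a) t) => //= ta.
  by rewrite (L2_left Ls (ltW ta)) mul0r.
have sp := testfun_csmooth tp; have sE := expi_csmooth z.
rewrite (@cintegral_FTC2 (fun x => 'i%C * phi x * expi z x) _ _ _ xa).
- by rewrite (L2_left Lp (lexx _)) mulr0 mul0r subr0.
- have := cderM (cderZ 'i%C (csmooth_cder sp)) (expi_cder z); congr cder.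
  apply/funext => t; rewrite /shiftD mulrBl.
  have -> : 'i%C * phi t * ('i%C * z * expi z t) = ('i%C * 'i%C) * (z * phi t * expi z t) by ring.
  rewrite -expr2 sqr_i; move: (cderive phi t) (phi t) (expi z t) => d p e; ring.
- exact: (csmoothM (testfun_csmooth (testfun_shiftD z tp)) sE).
Qed.

Lemma resolvent_shiftD a z phi : testfun a phi -> resolvent z (shiftD z phi) = phi.
Proof.
move=> tp; apply/funext => x; rewrite /resolvent (fprim_shiftD z x tp).
have -> : - 'i%C * expi (- z) x * ('i%C * phi x * expi z x) =
  - ('i%C * 'i%C) * (expi z x * expi (- z) x) * phi x.
  by move: (expi z x) (expi (- z) x) => e f; ring.
by rewrite expiVr -expr2 sqr_i opprK !mul1r.
Qed.

Lemma fprim_shiftD_end a z phi : 0 < a -> testfun a phi -> fprim z (shiftD z phi) a = 0.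
Proof.
move=> a0 tp; rewrite (fprim_shiftD z a tp).
by rewrite (L2_right (testfun_L2 tp) (lexx _)) mulr0 mul0r.
Qed.

Lemma fprim_cder a z g : 0 < a -> testfun a g -> cder (fprim z g) (fun x => g x * expi z x).
Proof.
move=> a0 tg; have Lg := testfun_L2 tg.
have sgE : csmooth (fun x => g x * expi z x) := csmoothM (testfun_csmooth tg) (expi_csmooth z).
have tgE : testfun a (fun x => g x * expi z x) := testfun_mul tg (expi_csmooth z).
have LgE := L2_sqi (testfun_L2 tgE).
have [[mr _] [mi _]] := LgE.
have LE : cint setT (fun x => g x * expi z x).
  have h := sqi_cint (L2_sqi Lg) (expi_trunc_sqi z (a) a0).
  have -> : (fun x => g x * expi z x) = (fun x => g x * (expi_trunc a z a x)^*%C); last exact: h.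
  apply/funext => t; rewrite /expi_trunc; have [ta|ta] := boolP (- a <= t <= a).
    by move/andP: (ta) => [_ ->]; rewrite andbT conjcK.
  rewrite andFb conjc0; case: Lg => _ _ _ ->; rewrite ?mul0r//.
  apply/negP; rewrite in_itv /= => /andP[h1 h2]; move/negP: ta; apply.
  by apply/andP; split; lra.
have H (p : R -> R) : continuous p -> rint setT p -> forall x : R,
    is_derive x (1 : R) (fun y => \int[mu]_(t in `]-oo, y]) p t) (p x).
  move=> cp ip x.
  have xx : x < x + 1 by rewrite ltrDl.
  have [d e] := continuous_FTC1 (a := -oo%O) xx (rint_setT (measurable_itv _) ip) (ltNyr x) (cp x).
  have := derivableP d; rewrite -derive1E e; exact.
move=> x; split.
  have [sr _] := sgE; exact: (H _ (smooth_continuous sr) LE.1).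
have [_ si] := sgE; exact: (H _ (smooth_continuous si) LE.2).
Qed.

Lemma resolvent_testfun a z g : 0 < a -> testfun a g -> fprim z g a = 0 ->
  testfun a (resolvent z g) /\ shiftD z (resolvent z g) = g.
Proof.
move=> a0 tg P0; have Pc := fprim_cder z a0 tg.
have Lg := testfun_L2 tg.
have sP : csmooth (fprim z g).
  by apply: csmooth_primitive Pc _; apply: csmoothM; [exact: testfun_csmooth tg|exact: expi_csmooth].
have sE := expi_csmooth (- z).
have cE := cderZ (- 'i%C) (expi_cder (- z)).
have sS : csmooth (resolvent z g).
  exact: (csmoothM (csmoothM (csmooth_cst (- 'i%C)) sE) sP).
split.
  apply/testfunP; split=> //.
  have /testfunP[_ [b ba z0]] := tg.
  exists (Num.max b 0); first by rewrite gt_max ba a0.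
  move=> x; rewrite gt_max => /andP[bx x0'].
  have -> : resolvent z g x = - 'i%C * expi (- z) x * fprim z g x by [].
  suff -> : fprim z g x = 0 by rewrite mulr0.
  have [x0|x0] := leP 0 x.
    rewrite ger0_norm// in bx; rewrite -P0; apply: fprim_eq => t h.
      by apply: z0; apply: lt_le_trans bx _; apply: le_trans (ltW h) _; exact: ler_norm.
    exact: (L2_right Lg (ltW h)).
  rewrite ltr0_norm// in bx; apply: fprim_zero => t tx; apply: z0.
  apply: lt_le_trans bx _; rewrite ler0_norm; lra.
have cS := cderM cE Pc.
have -> : shiftD z (resolvent z g) = fun x => 'i%C * cderive (resolvent z g) x - z * resolvent z g x by [].
rewrite (cder_cderive cS); apply/funext => x; rewrite /resolvent.
have := expiVr z x; move: (expi z x) (expi (- z) x) (fprim z g x) (g x) => e f p q ef.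
have ii : 'i%C * 'i%C = -1 :> R[i] by rewrite -expr2 sqr_i.
have -> : 'i%C * (- 'i%C * f * (q * e) + - 'i%C * ('i%C * - z * f) * p) - z * (- 'i%C * f * p)
  = - ('i%C * 'i%C) * (e * f) * q + (('i%C * 'i%C) + 1) * ('i%C * z * f * p) by ring.
by rewrite ef ii addNr opprK mul0r addr0 !mul1r.
Qed.

Lemma testfun_weil_dom a phi : 0 < a -> testfun a phi -> weil_dom a phi.
Proof.
move=> a0 tp; have [C _ HC] := resolvent_bounds 0 a0.
have [+ _ _] := HC _ (testfun_L2 (testfun_shiftD 0 tp)) (fprim_shiftD_end 0 a0 tp).
by rewrite (resolvent_shiftD 0 tp).
Qed.

End Primitive.

(** * The space [H(T_a)] and the operator [i d/dx] *)

Section Limits.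
Context {R : realType}.
Implicit Types (u w : nat -> R).

Lemma cvg0P u : (forall n, 0 <= u n) -> (u @ \oo --> (0 : R)) <->
  (forall e, 0 < e -> exists N : nat, forall n, (N <= n)%N -> u n <= e).
Proof.
move=> u0; split=> [/cvgrPdist_le H e /H [N _ HN]|H].
  by exists N => n Nn; have := HN n Nn; rewrite /= sub0r normrN ger0_norm.
apply/cvgrPdist_le => e /H[N HN]; exists N => // n Nn /=.
by rewrite sub0r normrN ger0_norm// HN.
Qed.

Lemma cvg0_lin (k l : R) u w : u @ \oo --> (0 : R) -> w @ \oo --> (0 : R) ->
  (fun n => k * u n + l * w n) @ \oo --> (0 : R).
Proof.
move=> cu cw; have -> : (0 : R) = k * 0 + l * 0 by ring.
by apply: cvgD; apply: cvgMr.
Qed.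

Lemma cvg0_le u w : (forall n, 0 <= u n) -> (forall n, u n <= w n) ->
  w @ \oo --> (0 : R) -> u @ \oo --> (0 : R).
Proof.
move=> u0 uw cw; have w0 n : 0 <= w n by exact: le_trans (uw n).
apply/(cvg0P u0) => e e0; have [H _] := cvg0P w0; have [N HN] := H cw e e0.
by exists N => n Nn; apply: le_trans (uw n) (HN n Nn).
Qed.

Lemma lim0_le (A : R) u : (forall n, A <= u n) -> u @ \oo --> (0 : R) -> A <= 0.
Proof.
move=> Au cu; apply/ler_addgt0Pr => e e0; rewrite add0r.
have /cvgrPdist_le/(_ e e0)[N _ HN] := cu.
have := HN N (leqnn N); rewrite /= sub0r normrN => h.
by apply: le_trans (Au N) _; apply: le_trans (ler_norm _) h.
Qed.

Lemma normc_lim0 (d : R[i]) u : (forall n, normc d <= u n) -> u @ \oo --> (0 : R) -> d = 0.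
Proof.
move=> H cu; apply: eq0_normc; apply/eqP; rewrite eq_le normc_ge0 andbT.
exact: lim0_le H cu.
Qed.

End Limits.

Section HT.
Context {R : realType}.
Variables (a lambda : R).
Hypotheses (a0 : 0 < a) (hl : (lambda%:E < lowest a)%E).
Implicit Types (u v w g h phi : R -> R[i]) (c z : R[i]).

Let ST := ipT_semi hl.

Lemma normT_ge0 v : 0 <= normT lambda v.
Proof. exact: sqrtr_ge0. Qed.

Lemma sqi_subsub u v w : (u \- w) \- (u \- v) = v \- w.
Proof. by apply/funext => x /=; ring. Qed.

Lemma HT_dense v : HT a lambda v -> weil_dom a v /\ exists phi : nat -> R -> R[i],
  (forall n, testfun a (phi n)) /\ (fun n => normT lambda (phi n \- v)) @ \oo --> (0 : R).
Proof.
move=> [Lv [phi [tphi Cphi phiv]]].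
have [C C0 HC] := normT_bounds hl.
have Fphi n : weil_dom a (phi n) by exact: testfun_weil_dom.
have sphi n : sqi (phi n) := weil_dom_sqi (Fphi n).
have sv := L2_sqi Lv; have SL := @ipL2_semi R.
have FB m n : weil_dom a (phi m \- phi n) by apply: (semi_ipB ST).
have shiftc N : (fun n => normL2 (phi (n + N)%N \- v)) @ \oo --> (0 : R).
  by rewrite (cvg_shiftn N (fun n => normL2 (phi n \- v))).
have Fv : weil_dom a v.
  have [N HN] := Cphi 1 ltr01.
  pose M := C * (normT lambda (phi N) + 1) ^+ 2.
  have BN n : arch_energy (phi (n + N)%N) <= M.
    have [_ B _] := HC _ (Fphi (n + N)%N); apply: le_trans B _.
    rewrite ler_wpM2l ?(ltW C0)// ler_pXn2r// ?nnegrE ?normT_ge0 ?addr_ge0 ?normT_ge0//.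
    have h2 := HN (n + N)%N N (leq_addl _ _) (leqnn _).
    have : `|normT lambda (phi (n + N)%N) - normT lambda (phi N)| <=
        normT lambda (phi (n + N)%N \- phi N) := snorm_dist ST (Fphi (n + N)%N) (Fphi N).
    by rewrite ler_distl => /andP[_ h1]; lra.
  have [I _] := arch_energy_fatou (fun n => sphi (n + N)%N) sv (shiftc N) (fun n => (Fphi (n + N)%N).2) BN.
  by split.
split=> //; exists phi; split=> //.
apply/cvg0P; first by move=> n; exact: normT_ge0.
move=> e e0; pose e' := e / (1 + 2 * C).
have C1 : 0 < 1 + 2 * C by lra.
have e'0 : 0 < e' by rewrite divr_gt0.
have [N1 HN1] := Cphi e' e'0.
have [N2 HN2] : exists N : nat, forall n, (N <= n)%N -> normL2 (phi n \- v) <= e'.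
  have n0 n : 0 <= normL2 (phi n \- v) := normL2_ge0 _.
  by have [H _] := cvg0P n0; exact: H phiv e' e'0.
exists (maxn N1 N2) => n; rewrite geq_max => /andP[n1 n2].
have Fnv : weil_dom a (phi n \- v) by apply: (semi_ipB ST).
have [_ _ B] := HC _ Fnv.
have BB : arch_energy (phi n \- v) <= C * e' ^+ 2.
  have un m : sqi (phi n \- phi (m + N1)%N) := weil_dom_sqi (FB _ _).
  have cu : (fun m => normL2 ((phi n \- phi (m + N1)%N) \- (phi n \- v))) @ \oo --> (0 : R).
    have -> : (fun m => normL2 ((phi n \- phi (m + N1)%N) \- (phi n \- v))) =
       fun m => normL2 (phi (m + N1)%N \- v); last exact: shiftc.
    apply/funext => m; rewrite sqi_subsub.
    exact: (snormBC SL sv (sphi _)).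
  have [||//] := arch_energy_fatou un (weil_dom_sqi Fnv) cu (M := C * e' ^+ 2).
    by move=> m; case: (FB n (m + N1)%N).
  move=> m; have [_ B' _] := HC _ (FB n (m + N1)%N); apply: le_trans B' _.
  rewrite ler_wpM2l ?(ltW C0)// ler_pXn2r// ?nnegrE ?normT_ge0 ?(ltW e'0)//.
  by apply: ltW; apply: HN1 => //; exact: leq_addl.
rewrite -(@ler_pXn2r _ 2)// ?nnegrE ?normT_ge0 ?(ltW e0)//.
apply: le_trans B _.
have h2 : normL2 (phi n \- v) ^+ 2 <= e' ^+ 2.
  by rewrite ler_pXn2r// ?nnegrE ?normL2_ge0 ?(ltW e'0)// HN2.
have h3 : C * normL2 (phi n \- v) ^+ 2 <= C * e' ^+ 2 by rewrite ler_wpM2l// ltW.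
have e2 : e ^+ 2 = (1 + 2 * C) ^+ 2 * e' ^+ 2.
  by rewrite /e' -exprMn mulrC divfK// gt_eqF.
have := sqr_ge0 e'; rewrite e2 => h4; nra.
Qed.

Lemma HT_weil_dom v : HT a lambda v -> weil_dom a v.
Proof. by move=> /HT_dense[]. Qed.

Lemma normL2_normT : exists2 C : R, 0 < C & forall v, weil_dom a v -> normL2 v <= C * normT lambda v.
Proof.
by have [C C0 HC] := normT_bounds hl; exists C => // v /HC[].
Qed.

Lemma HT_intro v (phi : nat -> R -> R[i]) : weil_dom a v -> (forall n, testfun a (phi n)) ->
  (fun n => normT lambda (phi n \- v)) @ \oo --> (0 : R) -> HT a lambda v.
Proof.
move=> Fv tphi cphi; have [C C0 HC] := normL2_normT.
have Fphi n : weil_dom a (phi n) by exact: testfun_weil_dom.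
split; first exact: weil_dom_L2.
exists phi; split=> //.
  move=> e e0; have n0 n : 0 <= normT lambda (phi n \- v) := normT_ge0 _.
  have [H _] := cvg0P n0; have e3 : 0 < e / 3 by rewrite divr_gt0.
  have [N HN] := H cphi _ e3; exists N => m n Nm Nn.
  apply: le_lt_trans (snorm_tri ST (Fphi m) Fv (Fphi n)) _.
  rewrite (snormBC ST Fv (Fphi n)).
  have := HN m Nm; have := HN n Nn; rewrite /normT /snorm; lra.
apply: (@cvg0_le _ _ (fun n => C * normT lambda (phi n \- v) + 0 * normT lambda (phi n \- v))).
- by move=> n; exact: normL2_ge0.
- by move=> n; rewrite mul0r addr0; apply: HC; apply: (semi_ipB ST).
- exact: cvg0_lin.
Qed.

Lemma testfun_HT phi : testfun a phi -> HT a lambda phi.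
Proof.
move=> tphi; have Fphi := testfun_weil_dom a0 tphi.
apply: (@HT_intro _ (fun=> phi)) => //.
have -> : (fun _ : nat => normT lambda (phi \- phi)) = fun=> 0; last exact: cvg_cst.
apply/funext => n; have := snormB ST; rewrite /normT.
have -> : phi \- phi = lincomb (-1) phi phi by exact: lincombN1.
rewrite -[LHS]/(snorm (ipT lambda) (lincomb (-1) phi phi)) /snorm (semi_ip_lincomb_sq ST)//.
by rewrite (semi_ip_Im ST)//= => _; rewrite -[RHS]sqrtr0; congr Num.sqrt; ring.
Qed.

Lemma HT_lincomb c v w : HT a lambda v -> HT a lambda w -> HT a lambda (lincomb c v w).
Proof.
move=> Hv Hw; have [Fv [p [tp cp]]] := HT_dense Hv; have [Fw [q [tq cq]]] := HT_dense Hw.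
apply: (@HT_intro _ (fun n => lincomb c (p n) (q n))).
- exact: weil_dom_lincomb.
- by move=> n; exact: testfun_lincomb.
apply: (@cvg0_le _ _ (fun n => 1 * normT lambda (p n \- v) + normc c * normT lambda (q n \- w))).
- by move=> n; exact: normT_ge0.
- move=> n; rewrite mul1r.
  have -> : lincomb c (p n) (q n) \- lincomb c v w = lincomb c (p n \- v) (q n \- w).
    by apply/funext => x; rewrite /lincomb /=; ring.
  by apply: (snorm_lincomb ST); apply: (semi_ipB ST) => //; exact: testfun_weil_dom.
- exact: cvg0_lin.
Qed.

Lemma ipT_HT : semi_ip (HT a lambda) (@ipT R lambda).
Proof. by apply: semi_ip_sub ST _ _; [move=> c v w; exact: HT_lincomb|move=> v; exact: HT_weil_dom]. Qed.

Let SH := ipT_HT.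

Lemma HT_sqi v : HT a lambda v -> sqi v.
Proof. by move=> /HT_weil_dom /weil_dom_sqi. Qed.

Lemma HT_L2 v : HT a lambda v -> L2 a v.
Proof. by case. Qed.

Lemma testfun_iD phi : testfun a phi -> testfun a (fun x => 'i%C * cderive phi x).
Proof.
move=> tp; have := testfun_mul (testfun_cderive tp) (csmooth_cst 'i%C); congr testfun.
by apply/funext => x; rewrite mulrC.
Qed.

Lemma csmooth_tau x phi : csmooth phi -> csmooth (tau x phi) /\ cderive (tau x phi) = tau x (cderive phi).
Proof.
have D (f : R -> R) (y : R) : smooth f -> is_derive y (1 : R) (fun t => f (t - x)) (derive1 f (y - x)).
  have Hs : is_derive y (1 : R) (fun t : R => t - x) 1 := is_derive_shift y (1 : R) (- x).
  move=> sf; have := @is_derive1_comp R f (fun t => t - x) y _ _ (smooth_is_derive (y - x) sf) Hs.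
  by rewrite mulr1.
have H (f : R -> R) : smooth f -> smooth (fun t => f (t - x)).
  move=> sf; apply: (@smooth_class R [set p | exists2 f, smooth f & p = fun t => f (t - x)]).
    move=> _ [q sq ->]; split; first by move=> y; case: (D q y sq).
    exists (derive1 q); first exact: smooth_derive1.
    by apply: derive1_is_derive => y; exact: D.
  by exists f.
move=> [sr si]; split; first by split; [exact: (H (ReF phi) sr)|exact: (H (ImF phi) si)].
by apply: cder_cderive => y; split; [exact: (D (ReF phi) y sr)|exact: (D (ImF phi) y si)].
Qed.

Lemma integral_cderive phi : testfun a phi -> cintegral setT (cderive phi) = 0.
Proof.
move=> tp; have td := testfun_L2 (testfun_cderive tp); have Lp := testfun_L2 tp.
have -> : cintegral setT (cderive phi) = cintegral `[- a, a] (cderive phi).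
  rewrite [RHS]cintegral_mkcond; congr cintegral; apply/funext => t.
  case: ifPn => // ta; case: td => _ _ _ ->//.
  apply/negP => h; move/negP: ta; apply; rewrite inE /=; move: h; rewrite !in_itv /=.
  by move=> /andP[/ltW -> /ltW ->].
have aa : - a < a by apply: lt_trans a0; rewrite oppr_lt0.
have sp := testfun_csmooth tp.
rewrite (cintegral_FTC2 aa (csmooth_cder sp) (csmooth_cderive sp)).
by rewrite (L2_right Lp (lexx _)) (L2_left Lp (lexx _)) subrr.
Qed.

Lemma gcorr_iD phi psi : testfun a phi -> testfun a psi ->
  gcorr (fun x => 'i%C * cderive phi x) psi = gcorr phi (fun x => 'i%C * cderive psi x).
Proof.
move=> tp tq; apply/funext => x; rewrite !gcorrE.
have sp := testfun_csmooth tp; have sq := testfun_csmooth tq.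
have [st dt] := csmooth_tau x sq.
have Ltq := tau_sqi x (L2_sqi (testfun_L2 tq)).
have Ldq := tau_sqi x (L2_sqi (testfun_L2 (testfun_cderive tq))).
have Lp := L2_sqi (testfun_L2 tp); have Ldp := L2_sqi (testfun_L2 (testfun_cderive tp)).
have tF : testfun a (fun y => phi y * (tau x psi y)^*%C).
  exact: (testfun_mul tp (csmoothJ st)).
have cJ : cder (fun y => (tau x psi y)^*%C) (fun y => (tau x (cderive psi) y)^*%C).
  rewrite -dt => y; have [r i] := csmooth_cder st y; split.
    have -> : ReF (fun y => (tau x psi y)^*%C) = ReF (tau x psi) by apply/funext => t; rewrite /ReF cReJ.
    by rewrite {2}/ReF cReJ.
  have -> : ImF (fun y => (tau x psi y)^*%C) = (fun t => - ImF (tau x psi) t).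
    by apply/funext => t; rewrite /ImF cImJ.
  by rewrite {2}/ImF cImJ; exact: is_deriveN.
have := integral_cderive tF; rewrite (cder_cderive (cderM (csmooth_cder sp) cJ)).
have -> : (fun y => phi y * (tau x (cderive psi) y)^*%C + cderive phi y * (tau x psi y)^*%C) =
   lincomb 1 (fun y => phi y * (tau x (cderive psi) y)^*%C) (fun y => cderive phi y * (tau x psi y)^*%C).
  by apply/funext => y; rewrite /lincomb mul1r.
rewrite (cintegral_lincomb _ measurableT (sqi_cint Lp Ldq) (sqi_cint Ldp Ltq)).
rewrite mul1r -/(ipL2 phi _) -/(ipL2 (cderive phi) _) => /eqP; rewrite addr_eq0 => /eqP E.
have S := @ipL2_semi R.
have z0 : sqi (cst 0 : R -> R[i]) := semi_ip0 S Lp.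
have scl c f h : sqi f -> sqi h -> ipL2 (fun y => c * f y) h = c * ipL2 f h.
  move=> sf sh; have := semi_ip_linl S c sh z0 sf.
  have -> : lincomb c (cst 0) f = fun y => c * f y by apply/funext => y; rewrite /lincomb add0r.
  move=> ->; have -> : ipL2 (cst 0) h = 0; last by rewrite add0r.
  by rewrite -[RHS](cintegral0 setT); congr cintegral; apply/funext => y; rewrite mul0r.
have -> : tau x (fun x0 => 'i%C * cderive psi x0) = fun y => 'i%C * tau x (cderive psi) y by [].
rewrite (semi_ipC S (semi_ip_scale S 'i%C Ldq) Lp) !scl// (semi_ipC S Lp Ldq).
rewrite E; move: (ipL2 (cderive phi) (tau x psi)) => d; case: d => r i /=.
by congr (_ +i* _); ring.
Qed.

Lemma ipT_iD phi psi : testfun a phi -> testfun a psi ->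
  ipT lambda (fun x => 'i%C * cderive phi x) psi = ipT lambda phi (fun x => 'i%C * cderive psi x).
Proof. by move=> tp tq; rewrite !ipTE gcorr_iD. Qed.

Notation adj := (op_adjoint a lambda (Dop a)).
Notation clo := (op_closure a lambda (Dop a)).

Lemma clo_adj v0 w0 v h : clo (v0, w0) -> adj (v, h) -> ipT lambda w0 v = ipT lambda v0 h.
Proof.
move=> [/= Hv0 Hw0 [q [Gq c1 c2]]] [/= Hv Hh Hadj].
apply/eqP; rewrite -subr_eq0; apply/eqP.
have t1 n : HT a lambda (q n).1 by apply: testfun_HT; case: (Gq n).
have t2 n : HT a lambda (q n).2.
  by have [tq ->] := Gq n; apply: testfun_HT; exact: testfun_iD.
apply: (@normc_lim0 _ _ (fun n => normT lambda h * normT lambda ((q n).1 \- v0) +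
   normT lambda v * normT lambda ((q n).2 \- w0))); last exact: cvg0_lin.
move=> n.
have B1 := semi_ipB SH (t1 n) Hv0; have B2 := semi_ipB SH (t2 n) Hw0.
have E : ipT lambda w0 v - ipT lambda v0 h =
   ipT lambda ((q n).1 \- v0) h - ipT lambda ((q n).2 \- w0) v.
  rewrite (semi_ipBl SH Hh (t1 n) Hv0) (semi_ipBl SH Hv (t2 n) Hw0) (Hadj _ (Gq n)).
  move: (ipT _ _ _) (ipT _ w0 _) (ipT _ v0 _) => A B D; ring.
rewrite E; apply: le_trans (le_normcD _ _) _; rewrite normcN; apply: lerD.
  by rewrite mulrC; exact: (semi_ip_CS SH).
by rewrite mulrC; exact: (semi_ip_CS SH).
Qed.

Lemma clo_sub_adj v0 w0 : clo (v0, w0) -> adj (v0, w0).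
Proof.
move=> [/= Hv0 Hw0 [q [Gq c1 c2]]]; split=> //= -[p1 p2] [/= tp ->].
have Hp := testfun_HT tp; have Hip := testfun_HT (testfun_iD tp).
apply/eqP; rewrite -subr_eq0; apply/eqP.
have t1 n : HT a lambda (q n).1 by apply: testfun_HT; case: (Gq n).
have t2 n : HT a lambda (q n).2.
  by have [tq ->] := Gq n; apply: testfun_HT; exact: testfun_iD.
set ip1 := fun x => 'i%C * cderive p1 x in Hip *.
apply: (@normc_lim0 _ _ (fun n => normT lambda ip1 * normT lambda ((q n).1 \- v0) +
   normT lambda p1 * normT lambda ((q n).2 \- w0))); last exact: cvg0_lin.
move=> n.
have B1 := semi_ipB SH (t1 n) Hv0; have B2 := semi_ipB SH (t2 n) Hw0.
have E : ipT lambda ip1 v0 - ipT lambda p1 w0 =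
   ipT lambda p1 ((q n).2 \- w0) - ipT lambda ip1 ((q n).1 \- v0).
  rewrite (semi_ipBr SH Hip (t1 n) Hv0) (semi_ipBr SH Hp (t2 n) Hw0).
  have -> : ipT lambda ip1 (q n).1 = ipT lambda p1 (q n).2.
    by have [tq ->] := Gq n; exact: ipT_iD.
  move: (ipT _ _ _) (ipT _ ip1 _) (ipT _ p1 _) => A B D; ring.
rewrite E addrC; apply: le_trans (le_normcD _ _) _; rewrite normcN; apply: lerD.
  exact: (semi_ip_CS SH).
exact: (semi_ip_CS SH).
Qed.

Lemma clo_sym v0 w0 : clo (v0, w0) -> ipT lambda w0 v0 = ipT lambda v0 w0.
Proof. by move=> H; apply: clo_adj H (clo_sub_adj H). Qed.

Lemma adj_lincomb c v h v' h' : adj (v, h) -> adj (v', h') -> adj (lincomb c v v', lincomb c h h').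
Proof.
move=> [/= Hv Hh E] [/= Hv' Hh' E']; split=> /=; try exact: HT_lincomb.
move=> q Gq; have t1 : HT a lambda q.1 by apply: testfun_HT; case: Gq.
have t2 : HT a lambda q.2 by case: Gq => tq ->; apply: testfun_HT; exact: testfun_iD.
by rewrite !(semi_ip_linr SH)// (E _ Gq) (E' _ Gq).
Qed.

Lemma fprim_CS z : exists2 K : R, 0 <= K & forall g, L2 a g -> normc (fprim z g a) <= K * normL2 g.
Proof.
exists (normL2 (expi_trunc a z a)); first exact: normL2_ge0.
move=> g Lg; rewrite (fprim_ip z a Lg) mulrC.
by apply: (semi_ip_CS (@ipL2_semi R)); [exact: L2_sqi Lg|exact: expi_trunc_sqi].
Qed.

Lemma clo_approx z v0 w0 : clo (v0, w0) -> exists phi : nat -> R -> R[i],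
  [/\ forall n, testfun a (phi n),
   (fun n => normL2 (phi n \- v0)) @ \oo --> (0 : R) &
   (fun n => normL2 (shiftD z (phi n) \- lincomb (- z) w0 v0)) @ \oo --> (0 : R)].
Proof.
move=> [/= Hv0 Hw0 [q [Gq c1 c2]]]; have [C C0 HC] := normL2_normT.
have t1 n : HT a lambda (q n).1 by apply: testfun_HT; case: (Gq n).
have t2 n : HT a lambda (q n).2.
  by have [tq ->] := Gq n; apply: testfun_HT; exact: testfun_iD.
have B1 n := semi_ipB SH (t1 n) Hv0; have B2 n := semi_ipB SH (t2 n) Hw0.
exists (fun n => (q n).1); split; first by move=> n; case: (Gq n).
  apply: (@cvg0_le _ _ (fun n => C * normT lambda ((q n).1 \- v0) + 0 * normT lambda ((q n).1 \- v0))).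
  - by move=> n; exact: normL2_ge0.
  - by move=> n; rewrite mul0r addr0; exact: (HC _ (HT_weil_dom (B1 n))).
  - exact: cvg0_lin.
apply: (@cvg0_le _ _ (fun n => C * normT lambda ((q n).2 \- w0) + (normc z * C) * normT lambda ((q n).1 \- v0))).
- by move=> n; exact: normL2_ge0.
- move=> n.
  have -> : shiftD z (q n).1 \- lincomb (- z) w0 v0 = lincomb (- z) ((q n).2 \- w0) ((q n).1 \- v0).
    by have [_ ->] := Gq n; apply/funext => x; rewrite /shiftD /lincomb /=; ring.
  apply: le_trans (snorm_lincomb (@ipL2_semi R) _ (HT_sqi (B2 n)) (HT_sqi (B1 n))) _.
  rewrite normcN -mulrA; apply: lerD; first exact: (HC _ (HT_weil_dom (B2 n))).
  by apply: ler_wpM2l; [exact: normc_ge0|exact: (HC _ (HT_weil_dom (B1 n)))].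
- exact: cvg0_lin.
Qed.

Lemma clo_fprim z v0 w0 : clo (v0, w0) -> fprim z (lincomb (- z) w0 v0) a = 0.
Proof.
move=> H; have [phi [tp _ c2]] := clo_approx z H; have [K K0 HK] := fprim_CS z.
have [/= Hv0 Hw0 _] := H.
have Lg : L2 a (lincomb (- z) w0 v0) by apply: L2_lincomb; exact: HT_L2.
have Ls n : L2 a (shiftD z (phi n)) by apply: testfun_L2; exact: testfun_shiftD.
apply: (@normc_lim0 _ _ (fun n => K * normL2 (shiftD z (phi n) \- lincomb (- z) w0 v0) +
   0 * normL2 (shiftD z (phi n) \- lincomb (- z) w0 v0))); last exact: cvg0_lin.
move=> n; rewrite mul0r addr0.
have := HK _ (semi_ipB (ipL2_semi_L2 (R := R) a) (Ls n) Lg); rewrite lincombN1 (fprim_lincomb z _ a a0)//.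
by rewrite (fprim_shiftD_end z a0 (tp n)) add0r mulN1r normcN.
Qed.

Lemma clo_inj z v0 w0 : clo (v0, w0) -> normL2 (lincomb (- z) w0 v0) = 0 -> normL2 v0 = 0.
Proof.
move=> H g0; have [phi [tp c1 c2]] := clo_approx z H.
have [C C0 HC] := resolvent_bounds z a0.
have [/= Hv0 Hw0 _] := H.
have Lg : L2 a (lincomb (- z) w0 v0) by apply: L2_lincomb; exact: HT_L2.
have Ls n : L2 a (shiftD z (phi n)) by apply: testfun_L2; exact: testfun_shiftD.
have SL := ipL2_semi_L2 (R := R) a.
apply/eqP; rewrite eq_le normL2_ge0 andbT.
apply: (@lim0_le _ _ (fun n => C * normL2 (shiftD z (phi n) \- lincomb (- z) w0 v0) +
   1 * normL2 (phi n \- v0))); last exact: cvg0_lin.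
move=> n; have Lp := testfun_L2 (tp n).
have h1 : normL2 (phi n) <= C * normL2 (shiftD z (phi n)).
  have [_ + _] := HC _ (Ls n) (fprim_shiftD_end z a0 (tp n)).
  by rewrite (resolvent_shiftD z (tp n)).
have h2 : `|normL2 (shiftD z (phi n)) - normL2 (lincomb (- z) w0 v0)| <=
  normL2 (shiftD z (phi n) \- lincomb (- z) w0 v0) := snorm_dist SL (Ls n) Lg.
have h3 : `|normL2 (phi n) - normL2 v0| <= normL2 (phi n \- v0) := snorm_dist SL Lp (HT_L2 Hv0).
move: h2 h3; rewrite g0 subr0 ger0_norm ?normL2_ge0// => h2.
rewrite ler_distl => /andP[h3 _]; rewrite mul1r.
rewrite -lerBlDr; apply: le_trans h3 _; apply: le_trans h1 _.
by rewrite ler_wpM2l.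
Qed.

Lemma resolvent_normT z : exists2 C : R, 0 <= C & forall g, L2 a g -> fprim z g a = 0 ->
  weil_dom a (resolvent z g) /\ normT lambda (resolvent z g) <= C * normL2 g.
Proof.
have [C C0 HC] := resolvent_bounds z a0; have [D D0 HD] := normT_bounds hl.
exists (1 + C + D * C ^+ 2).
  by rewrite !addr_ge0// mulr_ge0 ?sqr_ge0// ltW.
move=> g Lg P0; have [FS nS BS] := HC g Lg P0; split=> //.
have [_ _ B] := HD _ FS; have n0 := normL2_ge0 g.
have DC : 0 <= D * C ^+ 2 by rewrite mulr_ge0 ?sqr_ge0// ltW.
have K0 : 0 <= 1 + C + D * C ^+ 2 by rewrite !addr_ge0.
rewrite -(@ler_pXn2r _ 2)// ?nnegrE ?normT_ge0 ?mulr_ge0//.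
apply: le_trans B _.
have h : normL2 (resolvent z g) ^+ 2 <= (C * normL2 g) ^+ 2.
  by rewrite ler_pXn2r// ?nnegrE ?normL2_ge0 ?mulr_ge0.
have h' : D * normL2 (resolvent z g) ^+ 2 <= D * C ^+ 2 * normL2 g ^+ 2.
  by rewrite -mulrA -exprMn ler_wpM2l// ltW.
apply: (@le_trans _ _ ((C + D * C ^+ 2) * normL2 g ^+ 2)); first by rewrite mulrDl lerD.
rewrite exprMn ler_wpM2r ?sqr_ge0//; nra.
Qed.

End HT.

(** * Entirety *)

Section Entire.
Context {R : realType}.
Implicit Types (F : R[i] -> R[i]) (z h d : R[i]) (a : R) (g : R -> R[i]).

Lemma normE z : `|z| = (normc z)%:C.
Proof. by rewrite normc_def; case: z. Qed.

Lemma derivable_quadratic F z d (K : R) :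
  (forall h, normc h <= 1 -> normc (F (h + z) - F z - h * d) <= K * normc h ^+ 2) ->
  derivable (F : R[i]^o -> R[i]^o) z 1.
Proof.
move=> H.
have K0 : 0 <= K.
  have := H 1; rewrite normc1 lexx expr1n mulr1 => /(_ isT); exact: le_trans (normc_ge0 _).
apply/cvg_ex; exists (d : R[i]^o); apply/cvgrPdist_le => e e0.
pose e' := complex.Re e.
have [ee e'0] : e = e'%:C /\ 0 < e'.
  move: e0; rewrite ltcE /= => /andP[/eqP i0 r0]; split=> //.
  by apply: ReIm_eq => //=; rewrite i0.
pose dl := Num.min 1 (e' / (K + 1)).
have K1 : 0 < K + 1 by lra.
have dl0 : 0 < dl by rewrite lt_min ltr01 divr_gt0.
exists (dl%:C) => /=; first by rewrite ltcR.
move=> h /=; rewrite sub0r normrN normE ltcR => hd hn0.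
have hn : normc h != 0 by apply: contra hn0 => /eqP /eq0_normc ->.
have h0 : 0 < normc h by rewrite lt0r hn normc_ge0.
move: hd; rewrite lt_min => /andP[h1 h2].
rewrite [X in F X](_ : _ = h + z); last by rewrite /GRing.scale /= mulr1.
have -> : d - h^-1 *: (F (h + z) - F z) = - (h^-1 * (F (h + z) - F z - h * d)).
  by rewrite /GRing.scale /=; move: (F (h + z)) (F z) => p q; field.
rewrite normrN normE ee lecR normcM normcV.
rewrite ler_pdivrMl//; apply: le_trans (H h (ltW h1)) _.
have : normc h * (K + 1) <= e' by rewrite -ler_pdivlMr// ltW.
have -> : K * normc h ^+ 2 = normc h * (K * normc h) by ring.
by move=> h3; rewrite ler_wpM2l ?(ltW h0)//; lra.
Qed.

Definition expi_trunc_deriv a z : R -> R[i] :=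
  fun t => if - a <= t <= a then ('i%C * t%:C * expi z t)^*%C else 0.

Lemma csmooth_real : csmooth (fun t : R => t%:C).
Proof.
split; last exact: smooth_cst.
apply: (@smooth_primitive _ _ (fun=> 1)); last exact: smooth_cst.
Qed.

Lemma expi_trunc_deriv_sqi a z : 0 < a -> sqi (expi_trunc_deriv a z).
Proof.
move=> a0.
have S : csmooth (fun t : R => ('i%C * t%:C * expi z t)^*%C).
  exact: (csmoothJ (csmoothM (csmoothM (csmooth_cst 'i%C) csmooth_real) (expi_csmooth z))).
have [mr mi] := csmooth_measurable S.
have mI : measurable_fun [set: R] (\1_(`[- a, a]) : R -> R) by exact: measurable_indic.
have aa : - a <= a by lra.
have dec (t : R) : (- a <= t <= a) = (t \in (`[- a, a]%classic : set R)).
  by apply/idP/idP; rewrite inE /= in_itv.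
apply: (bounded_sqi (K := a * expi_bound a z) aa _ _ _).1.
- have -> : ReF (expi_trunc_deriv a z) = fun t => ReF (fun t : R => ('i%C * t%:C * expi z t)^*%C) t * \1_(`[- a, a]) t.
    apply/funext => t; rewrite /ReF /expi_trunc_deriv dec indicE.
    by case: ifP => _; rewrite ?mulr1 ?mulr0.
  exact: measurable_funM.
- have -> : ImF (expi_trunc_deriv a z) = fun t => ImF (fun t : R => ('i%C * t%:C * expi z t)^*%C) t * \1_(`[- a, a]) t.
    apply/funext => t; rewrite /ImF /expi_trunc_deriv dec indicE.
    by case: ifP => _; rewrite ?mulr1 ?mulr0.
  exact: measurable_funM.
- move=> t; rewrite /expi_trunc_deriv indicE dec; case: ifP => ta; last first.
    by rewrite mulr0 normc0.
  rewrite mulr1 normcJ normcM.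
  have ta' : `|t| <= a by rewrite ler_norml dec.
  have -> : normc ('i%C * t%:C : R[i]) = `|t|.
    by have := normc_iz 1 t; rewrite mulr1 normc1 mul1r.
  by apply: ler_pM => //; [exact: normc_ge0|exact: normc_expi_le].
Qed.

Lemma fprim_quadratic a z g : 0 < a -> L2 a g -> exists d (K : R), forall h, normc h <= 1 ->
  normc (fprim (h + z) g a - fprim z g a - h * d) <= K * normc h ^+ 2.
Proof.
move=> a0 Lg; exists (ipL2 g (expi_trunc_deriv a z)).
have S := @ipL2_semi R; have sg := L2_sqi Lg.
pose C := expi_bound a z * (4 * expR a * a ^+ 2).
have a0' := ltW a0; have C0 : 0 <= C by rewrite !mulr_ge0 ?expR_ge0.
exists (normL2 g * (C * Num.sqrt (2 * a))) => h h1.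
have s1 := expi_trunc_sqi (h + z) a a0; have s2 := expi_trunc_sqi z a a0; have s3 := expi_trunc_deriv_sqi z a0.
have s12 := semi_ipB S s1 s2.
pose k := lincomb (- h^*%C) (expi_trunc a (h + z) a \- expi_trunc a z a) (expi_trunc_deriv a z).
have sk : sqi k by exact: sqi_lincomb.
have E : fprim (h + z) g a - fprim z g a - h * ipL2 g (expi_trunc_deriv a z) = ipL2 g k.
  rewrite !(fprim_ip _ _ Lg) (semi_ip_linr S)// (semi_ipBr S)// rmorphN /= conjcK mulNr.
  by [].
have [[mr _] [mi _]] := sk.
have aa : - a <= a by lra.
have n0 := normc_ge0 h.
have [|_ B] := bounded_sqi (K := C * normc h ^+ 2) aa mr mi.
  move=> t; rewrite /k /lincomb.
  have -> : (expi_trunc a (h + z) a \- expi_trunc a z a) t = expi_trunc a (h + z) a t - expi_trunc a z a t by [].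
  rewrite /expi_trunc /expi_trunc_deriv indicE.
  have [ta|ta] := boolP (- a <= t <= a); last first.
    rewrite !andFb subrr mulr0 addr0 normc0; apply: mulr_ge0; last exact: ler0n.
    by apply: mulr_ge0 => //; exact: sqr_ge0.
  have [_ ta2] := andP ta; rewrite ta2 !andbT mem_set ?mulr1; last by rewrite /= in_itv.
  have tn : `|t| <= a by rewrite ler_norml.
  have Eh : expi (h + z) t = cexp ('i%C * h * t%:C) * expi z t.
    by rewrite /expi -cexpD; congr cexp; ring.
  have cJ : (expi (h + z) t)^*%C - (expi z t)^*%C + - h^*%C * ('i%C * t%:C * expi z t)^*%C =
     (expi z t * (cexp ('i%C * h * t%:C) - 1 - 'i%C * h * t%:C))^*%C.
    rewrite Eh; move: (cexp ('i%C * h * t%:C)) (expi z t) => [p1 p2] [q1 q2].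
    by case: h {h1 s1 s12 k sk E mr mi n0 Eh} => h1 h2; apply: ReIm_eq => /=; ring.
  rewrite cJ normcJ normcM /C -[leRHS]mulrA; apply: ler_pM; rewrite ?normc_ge0//.
    exact: normc_expi_le.
  apply: le_trans (normc_cexp_sub2 _) _; rewrite normc_iz.
  have hta : normc h * `|t| <= a by rewrite -[leRHS]mul1r; apply: ler_pM.
  have -> : 4 * expR a * a ^+ 2 * normc h ^+ 2 = 4 * expR a * (normc h * a) ^+ 2 by ring.
  apply: ler_pM; rewrite ?mulr_ge0 ?expR_ge0 ?sqr_ge0//.
    by rewrite ler_wpM2l// ler_expR.
  rewrite ler_pXn2r// ?nnegrE ?mulr_ge0//; by rewrite ler_wpM2l.
rewrite E; apply: le_trans (semi_ip_CS S sg sk) _.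
rewrite -mulrA; apply: ler_pM; rewrite ?sqrtr_ge0//.
have c0 : 0 <= C * Num.sqrt (2 * a) * normc h ^+ 2.
  by apply: mulr_ge0; [apply: mulr_ge0 => //; exact: sqrtr_ge0|exact: sqr_ge0].
rewrite -/(normL2 k) -(@ler_pXn2r _ 2)// ?nnegrE ?normL2_ge0//.
apply: le_trans B _; rewrite !exprMn sqr_sqrtr; last by rewrite mulr_ge0// ltW.
by rewrite le_eqVlt; apply/orP; left; apply/eqP; ring.
Qed.

Definition quadratic F z := exists d (K : R), forall h, normc h <= 1 ->
  normc (F (h + z) - F z - h * d) <= K * normc h ^+ 2.

Lemma quadratic_mul F z (c e : R[i]) : quadratic F z ->
  quadratic (fun y => (c * y + e) * F y) z.
Proof.
move=> [d [K H]]; exists ((c * z + e) * d + c * F z).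
exists (normc (c * z + e) * K + normc c * (K + normc d)) => h h1.
have Hh := H h h1; have n0 := normc_ge0 h.
set D := F (h + z) - F z - h * d in Hh.
have -> : (c * (h + z) + e) * F (h + z) - (c * z + e) * F z - h * ((c * z + e) * d + c * F z) =
    (c * z + e) * D + c * (h * (D + h * d)) by rewrite /D; ring.
apply: le_trans (le_normcD _ _) _; rewrite [leRHS]mulrDl; apply: lerD.
  by rewrite normcM -[leRHS]mulrA; apply: ler_wpM2l => //; exact: normc_ge0.
rewrite normcM -[leRHS]mulrA; apply: ler_wpM2l; first exact: normc_ge0.
rewrite normcM.
have -> : (K + normc d) * normc h ^+ 2 = normc h * (K * normc h + normc h * normc d) by ring.
apply: ler_wpM2l => //; apply: le_trans (le_normcD _ _) _; apply: lerD; last by rewrite normcM.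
apply: le_trans Hh _.
have K0 : 0 <= K.
  have := H 1; rewrite normc1 lexx expr1n mulr1 => /(_ isT); exact: le_trans (normc_ge0 _).
by apply: ler_wpM2l => //; rewrite expr2 -[leRHS]mulr1; apply: ler_wpM2l.
Qed.

Lemma quadratic_add F G z : quadratic F z -> quadratic G z ->
  quadratic (fun y => F y + G y) z.
Proof.
move=> [d [K H]] [d' [K' H']]; exists (d + d'), (K + K') => h h1.
have -> : F (h + z) + G (h + z) - (F z + G z) - h * (d + d') =
  (F (h + z) - F z - h * d) + (G (h + z) - G z - h * d') by ring.
by apply: le_trans (le_normcD _ _) _; rewrite [leRHS]mulrDl; apply: lerD; [exact: H|exact: H'].
Qed.

Lemma FT_fprim a z g : L2 a g ->
  cintegral `[- a, a] (fun x => g x * cexp ('i%C * z * x%:C)) = fprim z g a.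
Proof.
move=> Lg; rewrite /fprim cintegral_mkcond [RHS]cintegral_mkcond; congr cintegral.
apply/funext => t.
have [ta|ta] := ltP t (- a).
  by rewrite (L2_left Lg (ltW ta)) !mul0r; case: ifP; case: ifP.
have -> : (t \in (`[- a, a]%classic : set R)) = (t \in (`]-oo, a]%classic : set R)) => //.
by apply/idP/idP; rewrite !inE /= !in_itv /= ta.
Qed.

Lemma WfunE a theta vp vm z : L2 a vp -> L2 a vm ->
  Wfun a theta vp vm z = (z - 'i%C) * fprim z vp a + cexp ('i%C * theta%:C) * (z + 'i%C) * fprim z vm a.
Proof. by move=> Lp Lm; rewrite /Wfun !FT_fprim. Qed.

Lemma Wfun_entire a theta vp vm : 0 < a -> L2 a vp -> L2 a vm ->
  entire (Wfun a theta vp vm).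
Proof.
move=> a0 Lp Lm z.
pose e := cexp ('i%C * theta%:C).
have Qp : quadratic (fun z => fprim z vp a) z := fprim_quadratic z a0 Lp.
have Qm : quadratic (fun z => fprim z vm a) z := fprim_quadratic z a0 Lm.
have [d [K H]] := quadratic_add (quadratic_mul 1 (- 'i%C) Qp) (quadratic_mul e (e * 'i%C) Qm).
apply: (@derivable_quadratic _ z d K) => h h1; have := H h h1.
by rewrite !(WfunE theta _ Lp Lm) -/e !mul1r !mulrDr.
Qed.

End Entire.

(** * The self-adjoint extensions *)

Section Extension.
Context {R : realType}.
Variables (a lambda theta : R) (vp vm : R -> R[i]).
Hypotheses (a0 : 0 < a) (hl : (lambda%:E < lowest a)%E).
Notation adj := (op_adjoint a lambda (Dop a)).
Notation clo := (op_closure a lambda (Dop a)).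
Hypothesis hvp : op_eigenfun a lambda adj 'i%C vp.
Hypothesis hvm : op_eigenfun a lambda adj (- 'i%C) vm.
Hypothesis hnorm : normT lambda vp = normT lambda vm.
Implicit Types (v w g : R -> R[i]) (c z : R[i]).

Let SH := ipT_HT a0 hl.
Let e : R[i] := cexp ('i%C * theta%:C).

Let Hp : HT a lambda vp. Proof. by case: hvp. Qed.
Let Hm : HT a lambda vm. Proof. by case: hvm. Qed.

Definition dirU : R -> R[i] := fun x => vp x + e * vm x.
Definition dirS : R -> R[i] := fun x => 'i%C * (vp x - e * vm x).

Lemma phase_unit : e * e^*%C = 1.
Proof.
have n1 : normc e = 1.
  rewrite /e normc_cexp; have -> : complex.Re ('i%C * theta%:C : R[i]) = 0 by rewrite /=; ring.
  exact: expR0.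
have sq : normc e ^+ 2 = 1 by rewrite n1 expr1n.
move: sq; rewrite normc_sq; case: e => p q /= E.
by apply: ReIm_eq; rewrite /= -?E; ring.
Qed.

Lemma adj_U : adj (dirU, dirS).
Proof.
have [_ _ Ap] := hvp; have [_ _ Am] := hvm.
have := adj_lincomb a0 hl e Ap Am; congr (adj (_, _)).
by apply/funext => x; rewrite /lincomb /dirS; ring.
Qed.

Lemma HT_U : HT a lambda dirU. Proof. by case: adj_U. Qed.
Lemma HT_S : HT a lambda dirS. Proof. by case: adj_U. Qed.

Lemma ipT_self v : HT a lambda v -> ipT lambda v v = (normT lambda v ^+ 2)%:C.
Proof.
move=> Hv; apply: ReIm_eq; last exact: (semi_ip_Im SH Hv).
by rewrite -(snorm_sq SH Hv).
Qed.

Lemma ip_scalel c v w : HT a lambda v -> HT a lambda w ->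
  ipT lambda (fun x => c * v x) w = c * ipT lambda v w.
Proof.
move=> Hv Hw; have H0 := semi_ip0 SH Hv.
have := semi_ip_linl SH c Hw H0 Hv.
have -> : lincomb c (cst 0) v = fun x => c * v x by apply/funext => x; rewrite /lincomb add0r.
move=> ->; have sq := HT_sqi a0 hl.
by rewrite (ipT_aeeq0 lambda (sq _ H0) (sq _ Hw) (aeW _ (fun=> erefl))) add0r.
Qed.

Lemma ip_scaler c v w : HT a lambda v -> HT a lambda w ->
  ipT lambda v (fun x => c * w x) = c^*%C * ipT lambda v w.
Proof.
move=> Hv Hw; rewrite (semi_ipC SH (semi_ip_scale SH c Hw) Hv) ip_scalel//.
rewrite (semi_ipC SH Hv Hw); move: (ipT lambda v w) => P.
by case: c P => p q [r s]; apply: ReIm_eq => /=; ring.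
Qed.

Lemma dirS_lincomb : dirS = lincomb (- 'i%C * e) (fun x => 'i%C * vp x) vm.
Proof. by apply/funext => x; rewrite /lincomb /dirS; ring. Qed.

Lemma Hip : HT a lambda (fun x => 'i%C * vp x).
Proof. exact: (semi_ip_scale SH _ Hp). Qed.

Lemma ip_SU : ipT lambda dirS dirU = ipT lambda dirU dirS.
Proof.
have X := ipT_self Hp; have Y := ipT_self Hm.
have Z := semi_ipC SH Hp Hm.
have U1 := HT_U; have Ip := Hip.
rewrite dirS_lincomb (semi_ip_linl SH _ U1 Ip Hm) (semi_ip_linr SH _ U1 Ip Hm).
rewrite (ip_scalel _ Hp U1) (ip_scaler _ U1 Hp).
have -> : dirU = lincomb e vp vm by [].
rewrite !(semi_ip_linr SH e _ Hp Hm)// !(semi_ip_linl SH e _ Hp Hm)// X Y Z hnorm.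
have ee := phase_unit.
have -> : (- 'i%C * e)^*%C = 'i%C * e^*%C.
  by case: e => p q; apply: ReIm_eq => /=; ring.
have -> : ('i%C : R[i])^*%C = - 'i%C by apply: ReIm_eq => /=; ring.
move: (e^*%C) ee (ipT lambda vp vm) ((ipT lambda vp vm)^*%C) ((normT lambda vm ^+ 2)%:C).
move=> f ef P Q T.
have -> : 'i%C * (T + f * P) + - 'i%C * e * (Q + f * T) =
  'i%C * T + 'i%C * f * P - 'i%C * e * Q - 'i%C * (e * f) * T by ring.
have -> : - 'i%C * (T + e * Q) + 'i%C * f * (P + e * T) =
  - 'i%C * T - 'i%C * e * Q + 'i%C * f * P + 'i%C * (e * f) * T by ring.
by rewrite ef; ring.
Qed.

Notation ext := (Dext a lambda theta vp vm).

Lemma ext_sym v w : ext (v, w) -> ipT lambda w v = ipT lambda v w.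
Proof.
move=> [/= Hv Hw [v0 [w0 [c [C0 E1 E2]]]]].
have [/= Hv0 Hw0 _] := C0.
have U := HT_U; have S := HT_S.
have sq := HT_sqi a0 hl.
have F1 : aeeq v (lincomb c v0 dirU) by [].
have F2 : aeeq w (lincomb c w0 dirS).
  by apply: ae_imply E2 => x ->; rewrite /lincomb /dirS -/e; ring.
have H1 := HT_lincomb a0 hl c Hv0 U; have H2 := HT_lincomb a0 hl c Hw0 S.
rewrite (ipT_aeeq lambda (sq _ Hw) (sq _ H2) (sq _ Hv) (sq _ H1) F2 F1).
rewrite (ipT_aeeq lambda (sq _ Hv) (sq _ H1) (sq _ Hw) (sq _ H2) F1 F2).
rewrite (semi_ip_linl SH c H1 Hw0 S) (semi_ip_linl SH c H2 Hv0 U).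
rewrite (semi_ip_linr SH c Hw0 Hv0 U) (semi_ip_linr SH c S Hv0 U).
rewrite (semi_ip_linr SH c Hv0 Hw0 S) (semi_ip_linr SH c U Hw0 S).
have K1 := clo_sym a0 hl C0.
have K2 : ipT lambda w0 dirU = ipT lambda v0 dirS by exact: clo_adj a0 hl _ _ _ _ C0 adj_U.
have K3 : ipT lambda dirS v0 = ipT lambda dirU w0.
  by rewrite (semi_ipC SH Hv0 S) -K2 -(semi_ipC SH Hw0 U).
by rewrite K1 K2 K3 ip_SU; ring.
Qed.

Lemma HT_nonzero v : HT a lambda v -> ~ aeeq v (cst 0) -> 0 < normT lambda v.
Proof.
move=> Hv nv; have [C C0 HC] := normL2_normT hl.
rewrite lt0r normT_ge0 andbT; apply/eqP => n0; apply: nv.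
apply: normL2_eq0; first exact: (HT_sqi a0 hl).
apply/eqP; rewrite eq_le normL2_ge0 andbT.
by have := HC v (HT_weil_dom a0 hl Hv); rewrite n0 mulr0.
Qed.

Lemma ext_real z : op_eigenvalue a lambda ext z -> complex.Im z = 0.
Proof.
move=> [v [Hv nv E]]; have := ext_sym E.
rewrite ip_scalel// ip_scaler// ipT_self//.
have n0 := HT_nonzero Hv nv; have : normT lambda v ^+ 2 != 0 by rewrite gt_eqF// exprn_gt0.
case: z {E} => p q /= nz [_ h].
have : q * normT lambda v ^+ 2 = - q * normT lambda v ^+ 2 by lra.
by move/(mulIf nz); lra.
Qed.

Definition Wvec z : R -> R[i] := lincomb (e * (z + 'i%C)) (fun x => (z - 'i%C) * vp x) vm.

Lemma Wvec_HT z : HT a lambda (Wvec z).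
Proof. exact: (HT_lincomb a0 hl _ (semi_ip_scale SH _ Hp) Hm). Qed.

Lemma fprim_scale z c g : L2 a g -> fprim z (fun x => c * g x) a = c * fprim z g a.
Proof.
move=> Lg; have L0 : L2 a (cst 0 : R -> R[i]) := semi_ip0 (ipL2_semi_L2 a) Lg.
have := fprim_lincomb z c a a0 L0 Lg.
have -> : lincomb c (cst 0) g = fun x => c * g x by apply/funext => x; rewrite /lincomb add0r.
by move=> ->; rewrite [fprim z (cst 0) a](fprim_zero z (x := a)) ?add0r.
Qed.

Lemma Wfun_fprim z : Wfun a theta vp vm z = fprim z (Wvec z) a.
Proof.
have Lp := HT_L2 Hp; have Lm := HT_L2 Hm.
rewrite (WfunE theta z Lp Lm) -/e /Wvec (fprim_lincomb z _ a a0 _ Lm) ?fprim_scale//.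
exact: (semi_ip_scale (ipL2_semi_L2 a) _ Lp).
Qed.

Lemma fprim_aeeq z g h : L2 a g -> L2 a h -> aeeq g h -> fprim z g a = fprim z h a.
Proof.
move=> Lg Lh gh; rewrite !(@fprim_ip _ a)//.
exact: (aeeq_ipL2 (L2_sqi Lg) (L2_sqi Lh) (expi_trunc_sqi z a a0) (expi_trunc_sqi z a a0) gh (aeW _ (fun=> erefl))).
Qed.

Lemma Wvec_cancel z c v v0 w0 :
  aeeq v (fun x => v0 x + c * (vp x + e * vm x)) ->
  aeeq (fun x => z * v x) (fun x => w0 x + 'i%C * c * (vp x - e * vm x)) ->
  aeeq (lincomb (- z) w0 v0) (fun x => c * Wvec z x).
Proof.
move=> E1 E2; apply: ae_imply2 E1 E2 => x h1 h2.
have -> : lincomb (- z) w0 v0 x =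
    (w0 x + 'i%C * c * (vp x - e * vm x)) - 'i%C * c * (vp x - e * vm x) - z * v0 x.
  by rewrite /lincomb; ring.
by rewrite -h2 h1 /Wvec /lincomb; ring.
Qed.

Lemma eigenvalue_zero z : op_eigenvalue a lambda ext z -> Wfun a theta vp vm z = 0.
Proof.
move=> [v [Hv nv [/= _ Hzv [v0 [w0 [c [C0 E1 E2]]]]]]].
have [/= Hv0 Hw0 _] := C0.
have Hd := HT_lincomb a0 hl (- z) Hw0 Hv0.
have E : aeeq (lincomb (- z) w0 v0) (fun x => c * Wvec z x) := Wvec_cancel E1 E2.
have LW := HT_L2 (Wvec_HT z).
have LcW := semi_ip_scale (ipL2_semi_L2 a) c LW.
have Z := clo_fprim a0 hl z C0.
rewrite (fprim_aeeq z (HT_L2 Hd) LcW E) fprim_scale// -Wfun_fprim in Z.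
move/eqP: Z; rewrite mulf_eq0 => /orP[/eqP c0|/eqP//].
exfalso; apply: nv.
have N : normL2 (lincomb (- z) w0 v0) = 0.
  have -> : normL2 (lincomb (- z) w0 v0) = normL2 (cst 0 : R -> R[i]).
    rewrite /normL2; congr (Num.sqrt (complex.Re _)).
    have sd := HT_sqi a0 hl Hd.
    have s0 := HT_sqi a0 hl (semi_ip0 SH Hd).
    have E0 : aeeq (lincomb (- z) w0 v0) (cst 0).
      by apply: ae_imply E => x ->; rewrite c0 mul0r.
    exact: aeeq_ipL2.
  rewrite /normL2 /ipL2 (_ : (fun x => _) = cst 0) ?cintegral0 /= ?sqrtr0//.
  by apply/funext => x; rewrite mul0r.
have := normL2_eq0 (HT_sqi a0 hl Hv0) (clo_inj a0 hl C0 N).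
by move=> v00; apply: ae_imply2 v00 E1 => x -> ->; rewrite c0 mul0r addr0.
Qed.

(* [vp] is a limit of test functions. *)
Lemma nonzero_testfun : exists2 phi, testfun a phi & normL2 phi != 0.
Proof.
apply: contrapT => N.
have Z phi : testfun a phi -> normL2 phi = 0.
  by move=> tp; apply/eqP/negPn/negP => n; apply: N; exists phi.
have [_ np _] := hvp; apply: np; apply: normL2_eq0; first exact: (HT_sqi a0 hl Hp).
have [Lp [phi [tp _ cp]]] := Hp.
apply/eqP; rewrite eq_le normL2_ge0 andbT; apply: lim0_le cp => n.
have h : `|normL2 (phi n) - normL2 vp| <= normL2 (phi n \- vp) :=
  snorm_dist (ipL2_semi_L2 a) (testfun_L2 (tp n)) Lp.
by apply: le_trans h; rewrite (Z _ (tp n)) sub0r normrN ger0_norm// normL2_ge0.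
Qed.

Lemma fprim_testfun_nonzero z : exists2 rho, testfun a rho & fprim z rho a != 0.
Proof.
have [phi tp n0] := nonzero_testfun; have Lp := testfun_L2 tp.
have sE : csmooth (fun x => (phi x)^*%C * expi (- z) x).
  exact: (csmoothM (csmoothJ (testfun_csmooth tp)) (expi_csmooth (- z))).
exists (fun x => phi x * ((phi x)^*%C * expi (- z) x)); first exact: testfun_mul.
have -> : fprim z (fun x => phi x * ((phi x)^*%C * expi (- z) x)) a = ipL2 phi phi.
  rewrite /fprim cintegral_mkcond; congr cintegral; apply/funext => t.
  have [ta|ta] := leP t a.
    rewrite mem_set; last by rewrite /= in_itv.
    by rewrite -(mulrA (phi t)) -(mulrA _^*%C) [expi (- z) t * _]mulrC expiVr mulr1.
  rewrite (L2_right Lp (ltW ta)) !mul0r; by case: ifP.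
apply: contra n0 => /eqP h.
by rewrite -(@sqrf_eq0 R) normL2_sq ?h//; exact: L2_sqi Lp.
Qed.

(* Approximants of [g] are corrected by a multiple of a fixed test function [rho] with
   [fprim z rho a != 0] to make their transform vanish at [z]. *)
Lemma testfun_approx z g : HT a lambda g -> fprim z g a = 0 ->
  exists G : nat -> R -> R[i], [/\ forall n, testfun a (G n), forall n, fprim z (G n) a = 0 &
    (fun n => normT lambda (G n \- g)) @ \oo --> (0 : R)].
Proof.
move=> Hg P0; have Lg := HT_L2 Hg.
have [_ [psi [tpsi cpsi]]] := HT_dense a0 hl Hg.
have [rho trho k0] := fprim_testfun_nonzero z; set k := fprim z rho a in k0.
have [K K0 HK] := fprim_CS a0 z; have [C C0 HC] := normL2_normT hl.
have Hrho := testfun_HT a0 hl trho.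
pose c n := - fprim z (psi n) a / k.
exists (fun n => lincomb (c n) (psi n) rho); split.
- by move=> n; exact: testfun_lincomb.
- move=> n; rewrite (fprim_lincomb z _ a a0 (testfun_L2 (tpsi n)) (testfun_L2 trho)) -/k /c.
  by rewrite mulfVK// subrr.
have HB n : HT a lambda (psi n \- g) := semi_ipB SH (testfun_HT a0 hl (tpsi n)) Hg.
have cn n : normc (c n) <= normc k^-1 * K * C * normT lambda (psi n \- g).
  have -> : c n = - k^-1 * fprim z (psi n \- g) a.
    by rewrite lincombN1 (fprim_lincomb z _ a a0 (testfun_L2 (tpsi n)) Lg) P0 mulr0 addr0 /c; ring.
  rewrite normcM normcN -!mulrA; apply: ler_wpM2l; first exact: normc_ge0.
  apply: le_trans (HK _ (HT_L2 (HB n))) _; apply: ler_wpM2l => //.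
  exact: (HC _ (HT_weil_dom a0 hl (HB n))).
apply: (@cvg0_le _ _ (fun n => 1 * normT lambda (psi n \- g) +
  (normc k^-1 * K * C * normT lambda rho) * normT lambda (psi n \- g))).
- by move=> n; exact: normT_ge0.
- move=> n.
  have -> : lincomb (c n) (psi n) rho \- g = lincomb (c n) (psi n \- g) rho.
    by apply/funext => x; rewrite /lincomb /=; ring.
  apply: le_trans (snorm_lincomb SH (c n) (HB n) Hrho) _.
  rewrite mul1r; apply: lerD => //; rewrite mulrAC.
  by apply: ler_wpM2r; [exact: normT_ge0|exact: cn].
- exact: cvg0_lin.
Qed.

Lemma resolvent_clo z g : HT a lambda g -> fprim z g a = 0 ->
  clo (resolvent z g, lincomb z g (resolvent z g)).
Proof.
move=> Hg P0; have Lg := HT_L2 Hg.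
have [G [tG PG0 cG]] := testfun_approx Hg P0.
have [C C0 HC] := resolvent_normT a0 hl z; have [D D0 HD] := normL2_normT hl.
have LG n := testfun_L2 (tG n).
have HB n : HT a lambda (G n \- g) := semi_ipB SH (testfun_HT a0 hl (tG n)) Hg.
have tS n : testfun a (resolvent z (G n)) by have [] := resolvent_testfun a0 (tG n) (PG0 n).
have SB n : resolvent z (G n) \- resolvent z g = resolvent z (G n \- g).
  by rewrite !lincombN1 (resolvent_lincomb z _ a0 (LG n) Lg).
have cS : (fun n => normT lambda (resolvent z (G n) \- resolvent z g)) @ \oo --> (0 : R).
  apply: (@cvg0_le _ _ (fun n => (C * D) * normT lambda (G n \- g) + 0 * normT lambda (G n \- g))).
  - by move=> n; exact: normT_ge0.
  - move=> n; rewrite mul0r addr0 SB.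
    have PB : fprim z (G n \- g) a = 0 by rewrite lincombN1 (fprim_lincomb z _ a a0 (LG n) Lg) P0 PG0 mulr0 addr0.
    have [_ h] := HC _ (HT_L2 (HB n)) PB; apply: le_trans h _; rewrite -mulrA.
    by apply: ler_wpM2l => //; exact: (HD _ (HT_weil_dom a0 hl (HB n))).
  - exact: cvg0_lin.
have FS : weil_dom a (resolvent z g) by have [] := HC g Lg P0.
have HS : HT a lambda (resolvent z g) := HT_intro a0 hl FS tS cS.
split=> /=; [exact: HS|exact: (HT_lincomb a0 hl)|].
have HSB n : HT a lambda (resolvent z (G n) \- resolvent z g) :=
  semi_ipB SH (testfun_HT a0 hl (tS n)) HS.
exists (fun n => (resolvent z (G n), fun x => 'i%C * cderive (resolvent z (G n)) x)).
split; [by move=> n; split=> /=; [exact: tS|]|exact: cS|].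
apply: (@cvg0_le _ _ (fun n => 1 * normT lambda (G n \- g) +
  normc z * normT lambda (resolvent z (G n) \- resolvent z g))).
- by move=> n; exact: normT_ge0.
- move=> n /=.
  have -> : (fun x => 'i%C * cderive (resolvent z (G n)) x) \- lincomb z g (resolvent z g) =
      lincomb z (G n \- g) (resolvent z (G n) \- resolvent z g).
    have [_ E] := resolvent_testfun a0 (tG n) (PG0 n).
    apply/funext => x; rewrite /lincomb /=; rewrite -{2}E /shiftD; ring.
  by rewrite mul1r; exact: (snorm_lincomb SH z (HB n) (HSB n)).
- exact: cvg0_lin.
Qed.

Lemma zero_eigenvalue z : Wfun a theta vp vm z = 0 -> op_eigenvalue a lambda ext z.
Proof.
rewrite Wfun_fprim => P0; set v0 := resolvent z (Wvec z).
have C0 : clo (v0, lincomb z (Wvec z) v0) := resolvent_clo (Wvec_HT z) P0.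
have [/= Hv0 Hw0 _] := C0.
pose v := lincomb 1 v0 dirU.
have HU := HT_U; have HS := HT_S.
have Hv : HT a lambda v := HT_lincomb a0 hl 1 Hv0 HU.
have Hzv : HT a lambda (fun x => z * v x) := semi_ip_scale SH z Hv.
have Ezv x : z * v x = lincomb z (Wvec z) v0 x + dirS x.
  by rewrite /v /dirU /dirS /Wvec /lincomb; ring.
exists v; split; [exact: Hv| |]; last first.
  split; [exact: Hv|exact: Hzv|].
  exists v0, (lincomb z (Wvec z) v0), 1; split; [exact: C0|exact: aeW|].
  by apply: aeW => x; rewrite /= Ezv /dirS -/e; ring.
move=> nv; have sq := HT_sqi a0 hl.
have Hip := Hip; have Hn c w (Hw : HT a lambda w) : HT a lambda (fun x => c * w x) :=
  semi_ip_scale SH c Hw.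
have E1 : aeeq v0 (fun x => (-1) * dirU x).
  apply: ae_imply nv => x; rewrite /v /lincomb => h.
  by have -> : v0 x = (v0 x + 1 * dirU x) - dirU x; [ring|rewrite h; ring].
have E2 : aeeq (lincomb z (Wvec z) v0) (fun x => (-1) * dirS x).
  apply: ae_imply nv => x h; have := Ezv x; rewrite h mulr0.
  by move/esym/eqP; rewrite addr_eq0 => /eqP ->; ring.
have [_ np Ap] := hvp; have X := clo_adj a0 hl C0 Ap.
have rfl w : aeeq w w by exact: aeW.
rewrite (ipT_aeeq lambda (sq _ Hw0) (sq _ (Hn (-1) _ HS)) (sq _ Hp) (sq _ Hp) E2 (rfl _)) in X.
rewrite (ipT_aeeq lambda (sq _ Hv0) (sq _ (Hn (-1) _ HU)) (sq _ Hip) (sq _ Hip) E1 (rfl _)) in X.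
rewrite (ip_scalel _ HS Hp) (ip_scalel _ HU Hip) (ip_scaler _ HU Hp) in X.
rewrite dirS_lincomb (semi_ip_linl SH _ Hp Hip Hm) (ip_scalel _ Hp Hp) in X.
have U : ipT lambda dirU vp = ipT lambda vp vp + e * ipT lambda vm vp :=
  semi_ip_linl SH e Hp Hp Hm.
rewrite U (ipT_self Hp) in X.
have N := HT_nonzero Hp np; have : normT lambda vp ^+ 2 != 0 by rewrite gt_eqF// exprn_gt0.
move/eqP; apply; move: X; move: (normT lambda vp ^+ 2) (e) (ipT lambda vm vp).
move=> p [e1 e2] [m1 m2] /eqP; rewrite eq_complex /= => /andP[_ /eqP]; lra.
Qed.

End Extension.

Theorem theorem1p5 (R : realType) (a lambda theta : R)
  (ha : 0 < a) (hlambda : (lambda%:E < lowest a)%E)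
  (htheta : 0 <= theta < 2 * pi)
  (vp vm : R -> R[i])
  (hvp : op_eigenfun a lambda (op_adjoint a lambda (Dop a)) 'i%C vp)
  (hvm : op_eigenfun a lambda (op_adjoint a lambda (Dop a)) (- 'i%C) vm)
  (hnorm : normT lambda vp = normT lambda vm) :
  [/\ entire (Wfun a theta vp vm),
      forall z : R[i],
        op_eigenvalue a lambda (Dext a lambda theta vp vm) z <->
        Wfun a theta vp vm z = 0 &
      forall z : R[i], Wfun a theta vp vm z = 0 -> complex.Im z = 0].
Proof.
have Z z : Wfun a theta vp vm z = 0 -> op_eigenvalue a lambda (Dext a lambda theta vp vm) z.
  exact: zero_eigenvalue.
have [Hp _ _] := hvp; have [Hm _ _] := hvm.
split; first exact: (Wfun_entire ha (HT_L2 Hp) (HT_L2 Hm)).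
  by move=> z; split; [exact: (eigenvalue_zero ha hlambda hvp hvm)|exact: Z].
by move=> z /Z; exact: (ext_real ha hlambda hvp hvm hnorm).
Qed.
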